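(* Let $\rho_1,\rho_2,k_1,k_2>0$ with $\frac{\rho_1}{k_1}=\frac{\rho_2}{k_2}$ and $\sqrt{\frac{k_1}{k_2}}=k_0\pi$ for some $k_0\in\mathbb{N}^*$, and assume $$\frac{k_1}{\rho_2}\neq \frac{\left(\frac{k_2 m_1^2}{\rho_2}-\frac{k_1 m_2^2}{\rho_1}\right)\left(\frac{k_1 m_1^2}{\rho_1}-\frac{k_2 m_2^2}{\rho_2}\right)\pi^2}{\left(\frac{k_1}{\rho_1}+\frac{k_2}{\rho_2}\right)\left(m_1^2+m_2^2\right)}\qquad \text{for all } (m_1,m_2)\in\mathbb{Z}^2\setminus\{(0,0)\}.$$ Let $T>4\sqrt{\frac{\rho_1}{k_1}}$. Then there exists a constant $c_3>0$ such that $$\int_0^T|\varphi_x(1,t)+\psi(1,t)|^2dt\le c_3\|(\varphi_0,\varphi_1,\psi_0,\psi_1)\|^2_{\mathcal{H}_2}$$ for every solution $\Phi=(\varphi,\varphi_t,\psi,\psi_t)$ of the homogeneous Timoshenko system described in the context with initial data $(\varphi_0,\varphi_1,\psi_0,\psi_1)$. Moreover, there exists a constant $0<c_4<c_3$ such that for all such solutions $$c_4\|(\varphi_0,\varphi_1,\psi_0,\psi_1)\|^2_{V_1'\times V_2'\times V_1'\times V_2'}\le\int_0^T|\varphi_x(1,t)+\psi(1,t)|^2dt.$$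
   Context: All functions are complex-valued. Homogeneous Timoshenko system on $(0,1)\times\mathbb{R}_+$: $\rho_1\varphi_{tt}-k_1(\varphi_x+\psi)_x=0$, $\rho_2\psi_{tt}-k_2\psi_{xx}+k_1(\varphi_x+\psi)=0$, with $\varphi(0,t)=\varphi(1,t)=\psi_x(0,t)=\psi_x(1,t)=0$ and initial data $\varphi(\cdot,0)=\varphi_0$, $\varphi_t(\cdot,0)=\varphi_1$, $\psi(\cdot,0)=\psi_0$, $\psi_t(\cdot,0)=\psi_1$. Let $H^1_*(0,1)=\{f\in H^1(0,1):\int_0^1 f\,dx=0\}$ and $\mathcal{H}_2=H^1_0(0,1)\times L^2(0,1)\times H^1_*(0,1)\times L^2(0,1)$ with norm $\|(\varphi,\varphi_1,\psi,\psi_1)\|_{\mathcal{H}_2}^2=\rho_1\|\varphi_1\|^2+\rho_2\|\psi_1\|^2+k_1\|\varphi_x+\psi\|^2+k_2\|\psi_x\|^2$ ($L^2(0,1)$ norms). The operator $\mathcal{A}_2(\varphi,\varphi_1,\psi,\psi_1)=(\varphi_1,\frac{k_1}{\rho_1}(\varphi_x+\psi)_x,\psi_1,\frac{k_2}{\rho_2}\psi_{xx}-\frac{k_1}{\rho_2}(\varphi_x+\psi))$ has domain $D(\mathcal{A}_2)=\{\varphi\in H^2\cap H^1_0,\ \psi\in H^2\cap H^1_*,\ \varphi_1\in H^1_0,\ \psi_x\in H^1_0,\ \psi_1\in H^1_*\}$. Solutions are $\Phi(t)=e^{t\mathcal{A}_2}\Phi_0$ with $\Phi_0=(\varphi_0,\varphi_1,\psi_0,\psi_1)\in\mathcal{H}_2$;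 for non-smooth data the trace $\varphi_x(1,\cdot)+\psi(1,\cdot)$ is understood by density. For $s\ge0$, $V_s=\{f=\sum_{n>0}\alpha_n\frac{\sin(n\pi x)}{n^s}\}$ with $\|f\|^2_{V_s}=\sum_{n>0}|\alpha_n|^2<\infty$, and $V_s'$ is its dual with respect to the pivot space $L^2(0,1)$.
   Formalization: For the ψ_0 and ψ_1 components, V_1' and V_2' are taken over the cosine system cos(nπx) instead of sin(nπx): with sines the lower inequality fails for ψ_1 in V_2' (nearly cancelling modes n and n+k_0), while for ψ_0 the cosine norm is the stronger one. *)

(* Defs.v *)
From HB Require Import structures.
From mathcomp Require Import all_boot all_order all_algebra.
From mathcomp Require Import all_classical all_reals all_analysis.
From mathcomp Require Import complex.

Set Implicit Arguments.
Unset Strict Implicit.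
Unset Printing Implicit Defensive.
Import Order.TTheory GRing.Theory Num.Theory.
Import numFieldNormedType.Exports.
Local Open Scope classical_set_scope.
Local Open Scope ring_scope.
Local Open Scope complex_scope.

Section FunctionSpaces.
Variable R : realType.
Local Notation mu := (@lebesgue_measure R).
Implicit Types (a b s x : R) (f g h : R -> R[i]).

Definition cintegral a b f : R[i] :=
  (\int[mu]_(x in `]a, b[) complex.Re (f x))%R +i*
  (\int[mu]_(x in `]a, b[) complex.Im (f x))%R.

Definition l2sq a b f : \bar R :=
  (\int[mu]_(x in `]a, b[) ((Normc.normc (f x)) ^+ 2)%:E)%E.

Definition L2 a b f : Prop :=
  [/\ measurable_fun `]a, b[ (fun x => complex.Re (f x)),
      measurable_fun `]a, b[ (fun x => complex.Im (f x)) &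
      (l2sq a b f < +oo)%E].

(* g is the weak derivative of f on (0,1), f being the absolutely continuous
   representative of its class, so that values at the end points make sense. *)
Definition is_weak_deriv f g : Prop :=
  L2 0 1 g /\ forall x, 0 <= x <= 1 -> f x = f 0 + cintegral 0 x g.

Definition H1 f : Prop := exists g, is_weak_deriv f g.
Definition H1_0 f : Prop := [/\ H1 f, f 0 = 0 & f 1 = 0].
Definition H1_star f : Prop := H1 f /\ cintegral 0 1 f = 0.
Definition H2 f : Prop := exists2 g, is_weak_deriv f g & H1 g.

(* The weak derivative is unique only almost everywhere.  When f is in H^2, the
   absolutely continuous representative is selected; it is unique on [0,1], so
   that (weak_deriv f) 1 is the trace of f_x at 1. *)
Definition weak_deriv f : R -> R[i] :=
  xget (fun=> 0) [set g | is_weak_deriv f g /\ (H2 f -> H1 g)].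

(* e trig n x, n >= 0, is trig ((n+1) pi x): all indices n > 0 are shifted by 1 *)
Definition trig_basis (trig : R -> R) (n : nat) x : R :=
  trig (n.+1%:R * pi * x).

Definition V_coef_sq (alpha : nat -> R[i]) : \bar R :=
  (\sum_(0 <= n <oo) ((Normc.normc (alpha n)) ^+ 2)%:E)%E.

Definition V_partial_sum (trig : R -> R) s (alpha : nat -> R[i]) (N : nat) x
    : R[i] :=
  \sum_(0 <= n < N)
     alpha n * (trig_basis trig n x / (n.+1%:R `^ s))%:C.

(* f belongs to V_s with coefficients alpha (series convergent in L^2(0,1)) *)
Definition in_V (trig : R -> R) s (alpha : nat -> R[i]) f : Prop :=
  [/\ L2 0 1 f, (V_coef_sq alpha < +oo)%E &
      l2sq 0 1 (fun x => f x - V_partial_sum trig s alpha N x)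
        @[N --> \oo] --> 0%E].

(* Squared norm of g in the dual V_s' with respect to the pivot space L^2:
   the squares of |(g, f)_{L^2}| are taken over the unit ball of V_s. *)
Definition V_dual_sq (trig : R -> R) s g : \bar R :=
  ereal_sup [set z | exists alpha f,
    [/\ in_V trig s alpha f, (V_coef_sq alpha <= 1)%E &
        z = ((Normc.normc (cintegral 0 1 (fun x => g x * conjc (f x)))) ^+ 2)%:E]].

End FunctionSpaces.

Section Timoshenko.
Variable R : realType.
Variables rho1 rho2 k1 k2 : R.

(* (phi, phi_1, psi, psi_1) *)
Definition state : Type :=
  ((R -> R[i]) * (R -> R[i]) * (R -> R[i]) * (R -> R[i]))%type.
Definition st_phi (U : state) : R -> R[i] := U.1.1.1.
Definition st_phi1 (U : state) : R -> R[i] := U.1.1.2.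
Definition st_psi (U : state) : R -> R[i] := U.1.2.
Definition st_psi1 (U : state) : R -> R[i] := U.2.

Definition shear (U : state) (x : R) : R[i] :=
  weak_deriv (st_phi U) x + st_psi U x.

Definition energy_space (U : state) : Prop :=
  [/\ H1_0 (st_phi U), L2 0 1 (st_phi1 U), H1_star (st_psi U) &
      L2 0 1 (st_psi1 U)].

Definition energy_sq (U : state) : \bar R :=
  (rho1%:E * l2sq 0 1 (st_phi1 U) + rho2%:E * l2sq 0 1 (st_psi1 U)
   + k1%:E * l2sq 0 1 (shear U) + k2%:E * l2sq 0 1 (weak_deriv (st_psi U)))%E.

Definition A2_domain (U : state) : Prop :=
  [/\ H2 (st_phi U) /\ H1_0 (st_phi U),
      H2 (st_psi U) /\ H1_star (st_psi U),
      H1_0 (st_phi1 U),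
      H1_0 (weak_deriv (st_psi U)) &
      H1_star (st_psi1 U)].

Definition A2 (U : state) : state :=
  (st_phi1 U,
   fun x => (k1 / rho1)%:C * weak_deriv (shear U) x,
   st_psi1 U,
   fun x => (k2 / rho2)%:C * weak_deriv (weak_deriv (st_psi U)) x
            - (k1 / rho2)%:C * shear U x).

(* t |-> e^{t A2} U0 with U0 in the domain of A2: the solution of Phi' = A2 Phi
   in C^1([0,oo); energy space) and C([0,oo); domain of A2). *)
Definition classical_solution (Phi : R -> state) : Prop :=
  [/\ forall t, 0 <= t -> A2_domain (Phi t),
      forall t, 0 <= t ->
        energy_sq ((h^-1)%:C *: (Phi (t + h) - Phi t) - A2 (Phi t))
          @[h --> within [set h : R | 0 <= t + h] 0^'] --> 0%E &
      forall t, 0 <= t ->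
        energy_sq (A2 (Phi r) - A2 (Phi t))
          @[r --> within [set r : R | 0 <= r] (nbhs t)] --> 0%E].

Definition approximates (Phin : nat -> R -> state) (Phi : R -> state) : Prop :=
  (forall n, classical_solution (Phin n)) /\
  forall t, 0 <= t -> energy_sq (Phin n t - Phi t) @[n --> \oo] --> 0%E.

(* t |-> e^{t A2} U0, extended from the domain of A2 by density *)
Definition solution (Phi : R -> state) : Prop :=
  (forall t, 0 <= t -> energy_space (Phi t)) /\
  exists Phin, approximates Phin Phi.

(* y is phi_x(1,.) + psi(1,.) in L^2(0,T), extended by density from the
   classical solutions, for which it is evaluated pointwise. *)
Definition boundary_trace (T : R) (Phi : R -> state) (y : R -> R[i]) : Prop :=
  L2 0 T y /\
  exists2 Phin, approximates Phin Phi &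
    l2sq 0 T (fun t => shear (Phin n t) 1 - y t) @[n --> \oo] --> 0%E.

(* Squared norm of V_1' x V_2' x V_1' x V_2'.  The rotation components psi
   satisfy Neumann conditions and are expanded in cos (n pi x), so V_s is taken
   over the cosine system for them, over the sine system for phi.  With sines
   for psi_1 the lower observability estimate fails: its V_2' norm dominates
   |(psi_1, sin (pi x))|, and when sqrt (k1 / k2) = k0 pi with equal speeds, a
   superposition over n in which the eigenmodes n and n + k0, whose frequencies
   differ by O(1/n^2), nearly cancel at x = 1 makes that pairing unbounded while
   the observation stays bounded. *)
Definition weak_sq (U : state) : \bar R :=
  (V_dual_sq (@sin R) 1 (st_phi U) + V_dual_sq (@sin R) 2 (st_phi1 U)
   + V_dual_sq (@cos R) 1 (st_psi U) + V_dual_sq (@cos R) 2 (st_psi1 U))%E.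

End Timoshenko.

(* Main.v *)
Require Import Defs.
From HB Require Import structures.
From mathcomp Require Import all_boot all_order all_algebra.
From mathcomp Require Import all_classical all_reals all_analysis.
From mathcomp Require Import measurable_realfun complex.
From mathcomp Require Import ring lra zify.

Set Implicit Arguments.
Unset Strict Implicit.
Unset Printing Implicit Defensive.
Import Order.TTheory GRing.Theory Num.Theory.
Import numFieldNormedType.Exports.
Local Open Scope classical_set_scope.
Local Open Scope ring_scope.

(** Write [a = sqrt (rho1 / k1)].  Expanding the displacement in the functions
    [sin (n pi x)] and the rotation in the functions [cos (n pi x)], [n > 0],
    splits the system into systems of two oscillators.  The hypotheses on the
    coefficients make their frequencies
      [sqrt (w_n^2 + g^2) + g] and [sqrt (w_n^2 + g^2) - g],
    where [w_n = n pi / a] and [2 g = k0 pi / a].  Suitable combinations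
    [cos_amp], [sin_amp] of the coefficients rotate at these frequencies
    ([classical_amp_rate]), are bounded by the energy
    ([energy_sum_le_energy]), and are normalized so that the observation at
    [x = 1] is the plain sum of all modes ([classical_trace_series]).  The last
    point is a statement on boundary values of an [H^1] function [w] of zero
    mean: [w 1] is the integral of [x w'(x)], and [x] is expanded in sines
    ([boundary_value_series]); the convergence of that expansion in the mean is
    the evaluation of the sum of the inverse squares.

    For the upper inequality ([mode_series_upper]), each branch differs by
    [O(1/n)] from an arithmetic progression of step [pi / a].  For the
    progression the inequality is orthogonality over periods; the perturbation
    is absolutely summable by the Cauchy-Schwarz inequality.

    For the lower inequality ([mode_series_lower]), [2 g] is [k0] steps of the
    progression, so the upper frequency of index [n] and the lower one of index
    [n + k0] have the same limit and differ by a quantity of exact order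
    [1/n^2].  To first order the sum of two such modes is an oscillation at the
    common limit frequency with an amplitude that is affine in time, and all of
    these together form [H + t G], with [H] and [G] periodic of period [2 a] up
    to a sign.  Comparing two consecutive periods separates [G] from [H]
    ([affine_periodic_lower]); hence the condition [T > 4 a].  What is recovered
    from a pair is the sum of the coefficients, and one of them multiplied by
    the gap, which accounts for the loss of [n^2] in the dual norms.  This
    argument needs [n] to be large ([high_observable]).  The remaining modes are
    added one at a time by Haraux's method ([observable_add]), which rests on the
    frequencies being distinct; that is the content of the nonresonance
    condition ([freq_inj]).

    All estimates are uniform and linear in the initial data, so they pass from
    classical solutions to their limits, real and imaginary parts being treated
    separately.  Applied to differences of classical solutions, the upper
    inequality also shows that the observation of a limit exists. *)

(** * Square-integrable real functions on an interval *)

Section SquareIntegrable.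
Variable R : realType.
Local Notation mu := (@lebesgue_measure R).
Implicit Types (a b c s t x : R) (f g h : R -> R).

Definition L2r a b f : Prop :=
  measurable_fun `]a, b[ f /\ mu.-integrable `]a, b[ (fun x => (f x ^+ 2)%:E).

Definition ip a b f g : R := \int[mu]_(x in `]a, b[) (f x * g x).

Definition nrm a b f : R := Num.sqrt (ip a b f f).

Lemma L2r_prod a b f g : L2r a b f -> L2r a b g ->
  mu.-integrable `]a, b[ (fun x => (f x * g x)%:E).
Proof.
move=> [mf f2] [mg g2].
apply: (@le_integrable _ _ _ mu _ _ _ (fun x => (f x ^+ 2)%:E + (g x ^+ 2)%:E)%E).
- by [].
- apply/measurable_EFinP; exact: measurable_funM.
- move=> x _; rewrite -EFinD !abse_EFin lee_fin normrM [leRHS]ger0_norm ?addr_ge0 ?sqr_ge0 //.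
  have := sqr_ge0 (`|f x| - `|g x|); have := normr_ge0 (f x); have := normr_ge0 (g x).
  have := real_normK (num_real (f x)); have := real_normK (num_real (g x)).
  nra.
- exact: integrableD.
Qed.

Lemma L2rD a b f g : L2r a b f -> L2r a b g -> L2r a b (fun x => f x + g x).
Proof.
move=> Lf Lg; have [mf f2] := Lf; have [mg g2] := Lg; split.
  exact: measurable_funD.
have h : mu.-integrable `]a, b[
    (fun x => ((f x ^+ 2)%:E + (g x ^+ 2)%:E + 2%:E * (f x * g x)%:E)%E).
  apply: integrableD => //; first exact: integrableD.
  by apply: integrableZl => //; exact: L2r_prod.
apply: eq_integrable h => // x _.
by rewrite -EFinM -!EFinD; congr EFin; ring.
Qed.

Lemma L2rZ a b c f : L2r a b f -> L2r a b (fun x => c * f x).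
Proof.
move=> [mf f2]; split; first exact: measurable_funM.
have h : mu.-integrable `]a, b[ (fun x => ((c ^+ 2)%:E * (f x ^+ 2)%:E)%E).
  exact: integrableZl.
by apply: eq_integrable h => // x _; rewrite -EFinM exprMn.
Qed.

Lemma L2r_ext a b f g : (forall x, a < x < b -> f x = g x) ->
  L2r a b f -> L2r a b g.
Proof.
move=> fg [mf f2]; split.
  by apply: eq_measurable_fun mf => x; rewrite inE /= in_itv => /fg.
by apply: eq_integrable f2 => // x; rewrite inE /= in_itv => /fg ->.
Qed.

Lemma L2rB a b f g : L2r a b f -> L2r a b g -> L2r a b (fun x => f x - g x).
Proof.
move=> Lf Lg; apply: L2r_ext (L2rD Lf (L2rZ (-1) Lg)) => x _ /=.
by rewrite mulN1r.
Qed.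

Lemma L2r0 a b : L2r a b (fun=> 0).
Proof.
split; first exact: measurable_cst.
have -> : (fun=> (0 ^+ 2)%:E) = cst 0%E :> (R -> \bar R).
  by apply/funext => x; rewrite expr0n.
exact: integrable0.
Qed.

Lemma L2r_sum (I : Type) (r : seq I) (F : I -> R -> R) a b :
  (forall i, L2r a b (F i)) -> L2r a b (fun x => \sum_(i <- r) F i x).
Proof.
move=> LF; elim: r => [|i r ih].
  by apply: L2r_ext (L2r0 a b) => x _; rewrite big_nil.
by apply: L2r_ext (L2rD (LF i) ih) => x _; rewrite big_cons.
Qed.

Lemma eq_ip a b f f' g g' : (forall x, a < x < b -> f x = f' x) ->
  (forall x, a < x < b -> g x = g' x) -> ip a b f g = ip a b f' g'.
Proof.
move=> ff gg; apply: eq_Rintegral => x; rewrite inE /= in_itv /= => abx.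
by rewrite ff // gg.
Qed.

Lemma ipC a b f g : ip a b f g = ip a b g f.
Proof. by apply: eq_Rintegral => x _; rewrite mulrC. Qed.

Lemma ipDl a b f g h : L2r a b f -> L2r a b g -> L2r a b h ->
  ip a b (fun x => f x + g x) h = ip a b f h + ip a b g h.
Proof.
move=> Lf Lg Lh; rewrite /ip -RintegralD //; try exact: L2r_prod.
by apply: eq_Rintegral => x _; rewrite mulrDl.
Qed.

Lemma ipZl a b c f h : L2r a b f -> L2r a b h ->
  ip a b (fun x => c * f x) h = c * ip a b f h.
Proof.
move=> Lf Lh; rewrite /ip -RintegralZl //; last exact: L2r_prod.
by apply: eq_Rintegral => x _; rewrite mulrA.
Qed.

Lemma ipBl a b f g h : L2r a b f -> L2r a b g -> L2r a b h ->
  ip a b (fun x => f x - g x) h = ip a b f h - ip a b g h.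
Proof.
move=> Lf Lg Lh; rewrite /ip -RintegralB //; try exact: L2r_prod.
by apply: eq_Rintegral => x _; rewrite mulrBl.
Qed.

Lemma ipZr a b c f h : L2r a b f -> L2r a b h ->
  ip a b h (fun x => c * f x) = c * ip a b h f.
Proof. by move=> Lf Lh; rewrite ipC ipZl // ipC. Qed.

Lemma ipDr a b f g h : L2r a b f -> L2r a b g -> L2r a b h ->
  ip a b h (fun x => f x + g x) = ip a b h f + ip a b h g.
Proof. by move=> Lf Lg Lh; rewrite ipC ipDl // !(ipC _ _ h). Qed.

Lemma ipBr a b f g h : L2r a b f -> L2r a b g -> L2r a b h ->
  ip a b h (fun x => f x - g x) = ip a b h f - ip a b h g.
Proof. by move=> Lf Lg Lh; rewrite ipC ipBl // !(ipC _ _ h). Qed.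

Lemma ip_suml (I : Type) (r : seq I) (F : I -> R -> R) a b h :
  (forall i, L2r a b (F i)) -> L2r a b h ->
  ip a b (fun x => \sum_(i <- r) F i x) h = \sum_(i <- r) ip a b (F i) h.
Proof.
move=> LF Lh; elim: r => [|i r ih].
  rewrite big_nil (@eq_ip a b _ (fun=> 0 * 0) h h) //.
    by rewrite (@ipZl a b 0 (fun=> 0)) ?mul0r //; exact: L2r0.
  by move=> x _; rewrite big_nil mul0r.
rewrite big_cons -ih -ipDl //; last exact: L2r_sum.
by apply: eq_ip => // x _; rewrite big_cons.
Qed.

Lemma ip_sumr (I : Type) (r : seq I) (F : I -> R -> R) a b h :
  (forall i, L2r a b (F i)) -> L2r a b h ->
  ip a b h (fun x => \sum_(i <- r) F i x) = \sum_(i <- r) ip a b h (F i).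
Proof.
move=> LF Lh; rewrite ipC ip_suml //.
by apply: eq_bigr => i _; rewrite ipC.
Qed.

Lemma ip_ge0 a b f : 0 <= ip a b f f.
Proof. by apply: Rintegral_ge0 => x _; rewrite -expr2 sqr_ge0. Qed.

Lemma ip_sqrB a b f g : L2r a b f -> L2r a b g ->
  ip a b (fun x => f x - g x) (fun x => f x - g x) =
  ip a b f f - 2 * ip a b f g + ip a b g g.
Proof.
move=> Lf Lg; rewrite ipBl ?ipBr //; try exact: L2rB.
by rewrite (ipC a b g f); ring.
Qed.

Lemma ip_sqrD a b f g : L2r a b f -> L2r a b g ->
  ip a b (fun x => f x + g x) (fun x => f x + g x) =
  ip a b f f + 2 * ip a b f g + ip a b g g.
Proof.
move=> Lf Lg; rewrite ipDl ?ipDr //; try exact: L2rD.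
by rewrite (ipC a b g f); ring.
Qed.

Lemma cauchy_schwarz a b f g : L2r a b f -> L2r a b g ->
  ip a b f g ^+ 2 <= ip a b f f * ip a b g g.
Proof.
move=> Lf Lg.
have key c : 0 <= ip a b f f - 2 * (c * ip a b f g) + c ^+ 2 * ip a b g g.
  have := ip_ge0 a b (fun x => f x - c * g x).
  rewrite ip_sqrB ?ipZr ?ipZl //; try exact: L2rZ.
  by rewrite [c * (c * _)]mulrA expr2.
have f0 := ip_ge0 a b f; have := ip_ge0 a b g.
rewrite le0r => /predU1P[g0|g0].
  rewrite g0 mulr0; have [->|fg0] := eqVneq (ip a b f g) 0; first by rewrite expr0n.
  have := key ((ip a b f f + 1) / (2 * ip a b f g)).
  have -> : (ip a b f f + 1) / (2 * ip a b f g) * ip a b f g = (ip a b f f + 1) / 2.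
    by field.
  by rewrite g0 mulr0 addr0 => ?; lra.
have := key (ip a b f g / ip a b g g).
rewrite -[in X in X -> _](pmulr_rge0 _ g0).
suff -> : ip a b g g * (ip a b f f - 2 * (ip a b f g / ip a b g g * ip a b f g) +
   (ip a b f g / ip a b g g) ^+ 2 * ip a b g g) =
   ip a b f f * ip a b g g - ip a b f g ^+ 2 by rewrite subr_ge0.
by field; rewrite gt_eqF.
Qed.

Lemma nrm_ge0 a b f : 0 <= nrm a b f.
Proof. exact: sqrtr_ge0. Qed.

Lemma sqr_nrm a b f : nrm a b f ^+ 2 = ip a b f f.
Proof. by rewrite sqr_sqrtr // ip_ge0. Qed.

Lemma eq_nrm a b f g : (forall x, a < x < b -> f x = g x) -> nrm a b f = nrm a b g.
Proof. by move=> fg; rewrite /nrm; congr Num.sqrt; exact: eq_ip. Qed.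

Lemma normr_ip a b f g : L2r a b f -> L2r a b g ->
  `|ip a b f g| <= nrm a b f * nrm a b g.
Proof.
move=> Lf Lg; rewrite -(@ler_pXn2r _ 2) ?nnegrE ?mulr_ge0 ?nrm_ge0 //.
by rewrite real_normK ?num_real // exprMn !sqr_nrm; exact: cauchy_schwarz.
Qed.

Lemma nrmD a b f g : L2r a b f -> L2r a b g ->
  nrm a b (fun x => f x + g x) <= nrm a b f + nrm a b g.
Proof.
move=> Lf Lg; rewrite -(@ler_pXn2r _ 2) ?nnegrE ?addr_ge0 ?nrm_ge0 //.
rewrite sqr_nrm sqrrD !sqr_nrm ip_sqrD // lerD2r lerD2l mulr_natl lerMn2r /=.
by rewrite (le_trans (ler_norm _)) ?normr_ip.
Qed.

Lemma nrmZ a b c f : L2r a b f -> nrm a b (fun x => c * f x) = `|c| * nrm a b f.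
Proof.
move=> Lf; rewrite /nrm ipZl ?ipZr //; last exact: L2rZ.
by rewrite mulrA -expr2 sqrtrM ?sqr_ge0 // sqrtr_sqr.
Qed.

Lemma nrmB a b f g : L2r a b f -> L2r a b g ->
  nrm a b (fun x => f x - g x) <= nrm a b f + nrm a b g.
Proof.
move=> Lf Lg; have := nrmD Lf (L2rZ (-1) Lg).
rewrite nrmZ // normrN normr1 mul1r; apply: le_trans.
by rewrite le_eqVlt; apply/orP; left; apply/eqP/eq_nrm => x _; rewrite mulN1r.
Qed.

Lemma nrm_sum (I : Type) (r : seq I) (F : I -> R -> R) a b :
  (forall i, L2r a b (F i)) ->
  nrm a b (fun x => \sum_(i <- r) F i x) <= \sum_(i <- r) nrm a b (F i).
Proof.
move=> LF; elim: r => [|i r ih].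
  rewrite big_nil (@eq_nrm a b _ (fun=> 0 * 0)).
    by rewrite (@nrmZ a b 0 (fun=> 0)) ?normr0 ?mul0r //; exact: L2r0.
  by move=> x _; rewrite big_nil mul0r.
rewrite big_cons (le_trans _ (lerD (lexx _) ih)) //.
apply: le_trans (nrmD (LF i) (L2r_sum r LF)).
rewrite le_eqVlt; apply/orP; left; apply/eqP/eq_nrm => x _.
by rewrite big_cons.
Qed.

Lemma integrable_cst_itv a b c : mu.-integrable `]a, b[ (fun=> c%:E).
Proof.
apply: (@measurable_bounded_integrable _ _ _ mu (fun=> c)) => //.
- by rewrite /= lebesgue_measure_itv /=; case: ifP => // _; rewrite -EFinD ltry.
- exists `|c|; split; first exact: num_real.
  by move=> M cM x _ /=; exact: ltW.
Qed.

Lemma L2r_bounded a b c f : measurable_fun `]a, b[ f ->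
  (forall x, a < x < b -> `|f x| <= c) -> L2r a b f.
Proof.
move=> mf fc; split => //.
apply: (le_integrable _ _ _ (integrable_cst_itv a b (c ^+ 2))) => //.
  by apply/measurable_EFinP/measurable_funX.
move=> x; rewrite /= in_itv /= => /fc fxc.
rewrite lee_fin !ger0_norm ?sqr_ge0 // -[f x ^+ 2]real_normK ?num_real //.
by rewrite ler_pXn2r ?nnegrE // (le_trans _ fxc).
Qed.

Lemma ip_bounded a b c f : a <= b -> L2r a b f ->
  (forall x, a < x < b -> `|f x| <= c) -> ip a b f f <= c ^+ 2 * (b - a).
Proof.
move=> ab Lf fc; rewrite /ip.
have -> : c ^+ 2 * (b - a) = \int[mu]_(x in `]a, b[) c ^+ 2.
  rewrite Rintegral_cst //= lebesgue_measure_itv /= lte_fin.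
  by case: ltP => //= ba; congr (_ * _); apply/eqP; rewrite subr_eq0 eq_le ab ba.
apply: le_Rintegral => //; [exact: L2r_prod|exact: integrable_cst_itv|].
move=> x; rewrite /= in_itv /= => /fc fxc.
rewrite -expr2 -[f x ^+ 2]real_normK ?num_real //.
by rewrite ler_pXn2r ?nnegrE // (le_trans _ fxc).
Qed.

Lemma nrm_bounded a b c f : a <= b -> 0 <= c -> L2r a b f ->
  (forall x, a < x < b -> `|f x| <= c) -> nrm a b f <= c * Num.sqrt (b - a).
Proof.
move=> ab c0 Lf fc; rewrite -(ger0_norm c0) -sqrtr_sqr -sqrtrM ?sqr_ge0 //.
by rewrite ler_sqrt ?mulr_ge0 ?sqr_ge0 ?subr_ge0 // ip_bounded.
Qed.

Lemma sub_itvoo a b a' b' : a' <= a -> b <= b' -> `]a, b[ `<=` (`]a', b'[ : set R).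
Proof.
move=> aa bb x; rewrite /= !in_itv /= => /andP[ax xb].
by rewrite (le_lt_trans aa ax) (lt_le_trans xb bb).
Qed.

Lemma nrmS a b a' b' f : a' <= a -> b <= b' -> L2r a' b' f ->
  nrm a b f <= nrm a' b' f.
Proof.
move=> aa bb Lf; rewrite ler_sqrt ?ip_ge0 // /ip /Rintegral.
have L := L2r_prod Lf Lf.
rewrite fine_le ?integrable_fin_num //.
  by apply: integrableS L => //; exact: sub_itvoo.
apply: ge0_subset_integral => //.
- by apply/measurable_EFinP; have := measurable_int mu L => /measurable_EFinP.
- by move=> x _; rewrite lee_fin -expr2 sqr_ge0.
- exact: sub_itvoo.
Qed.

Lemma continuous_L2r a b f : a < b -> continuous f -> L2r a b f.
Proof.
move=> ab cf; split.
  by apply: measurable_funS (continuous_measurable_fun cf).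
have cf2 : continuous (fun x => f x ^+ 2).
  by move=> x; apply: (@cvgM _ _ _ _ f f); exact: cf.
have : mu.-integrable `[a, b] (EFin \o (fun x => f x ^+ 2)).
  apply: continuous_compact_integrable; first exact: segment_compact.
  exact: continuous_subspaceT.
by apply: integrableS => //; exact: subset_itv_oo_cc.
Qed.

Lemma continuous_integrable a b f : continuous f ->
  mu.-integrable `[a, b] (EFin \o f).
Proof.
move=> cf; apply: continuous_compact_integrable; first exact: segment_compact.
exact: continuous_subspaceT.
Qed.

Lemma Rintegral_oo_cc a b f : continuous f ->
  \int[mu]_(x in `]a, b[) f x = \int[mu]_(x in `[a, b]) f x.
Proof.
move=> cf; have If := continuous_integrable a b cf.
rewrite Rintegral_itv_obnd_cbnd; last first.
  by apply: integrableS If => //; exact: subset_itv_oo_cc.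
rewrite Rintegral_itv_bndo_bndc //.
by apply: integrableS If => //; exact: subset_itv_co_cc.
Qed.

(** Letting [F] be differentiable a little to the left of [a], rather than
    continuous at [a], avoids one-sided limits at the end points. *)
Lemma Rintegral_FTC c a b f F : c < a -> a < b -> continuous f ->
  (forall x, c < x -> is_derive x 1 F (f x)) ->
  \int[mu]_(x in `]a, b[) f x = F b - F a.
Proof.
move=> ca ab cf dF; rewrite Rintegral_oo_cc //.
have dvF x : c < x -> derivable F x 1 by move=> cx; have := dF x cx => -[].
have cF x : c < x -> {for x, continuous F}.
  by move=> cx; apply/differentiable_continuous/derivable1_diffP; exact: dvF.
rewrite /Rintegral (@continuous_FTC2 _ f F) //.
- exact: continuous_subspaceT.
- split; first by move=> x; rewrite in_itv /= => /andP[ax _]; apply/dvF/(lt_trans ca).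
  + by apply: cvg_at_right_filter; exact: cF.
  + by apply: cvg_at_left_filter; apply: cF; exact: lt_trans ab.
- move=> x; rewrite in_itv /= derive1E => /andP[ax _].
  by have := dF x (lt_trans ca ax) => -[].
Qed.

Lemma ex_primitive c f : continuous f ->
  exists F, forall x, c < x -> is_derive x 1 F (f x).
Proof.
move=> cf; exists (fun x => \int[mu]_(t in `[c, x]) f t) => x cx.
have xx : x < x + 1 by rewrite ltrDl.
have [D E] := @continuous_FTC1_closed R f c x (x + 1) xx (continuous_integrable c (x + 1) cf) cx (cf x).
split; first exact: D.
by rewrite -derive1E; exact: E.
Qed.

Lemma nrm_shift a b s f : a < b -> continuous f ->
  nrm a b (fun x => f (x + s)) = nrm (a + s) (b + s) f.
Proof.
move=> ab cf; rewrite /nrm; congr Num.sqrt; rewrite /ip.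
pose G := fun x => f x * f x.
have cG : continuous G by move=> x; apply: cvgM; exact: cf.
have cs : continuous (fun x : R => x + s).
  by move=> x; apply: cvgD; [exact: cvg_id|exact: cvg_cst].
have cGs : continuous (fun x => G (x + s)).
  by move=> x; apply: (@continuous_comp _ _ _ (fun y => y + s) G); [exact: cs|exact: cG].
have [F dF] := ex_primitive (a + s - 1) cG.
rewrite [RHS](@Rintegral_FTC (a + s - 1) _ _ G F) ?ltrD2r ?ltrBlDr ?ltrDl //.
apply: (@Rintegral_FTC (a - 1) a b (fun x => G (x + s)) (fun x => F (x + s))) => //.
  by rewrite ltrBlDr ltrDl.
move=> x ax.
have dFx : is_derive (x + s) 1 F (G (x + s)).
  by apply: dF; rewrite addrAC ltrD2r.
have ds : is_derive x 1 (fun y : R => y + s) 1.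
  by apply: (is_derive_eq (is_deriveD (is_derive_id _ _) (is_derive_cst _ _ _))); rewrite addr0.
have := @is_derive1_comp _ F (fun y : R => y + s) x _ _ dFx ds.
by rewrite mulr1.
Qed.


Lemma nrm_mul_bounded a b c f h : 0 <= c -> measurable_fun `]a, b[ h ->
  (forall x, a < x < b -> `|h x| <= c) -> L2r a b f ->
  L2r a b (fun x => h x * f x) /\ nrm a b (fun x => h x * f x) <= c * nrm a b f.
Proof.
move=> c0 mh hc [mf f2].
have hfc x : a < x < b -> (h x * f x) ^+ 2 <= c ^+ 2 * f x ^+ 2.
  move=> /hc hxc; rewrite exprMn ler_wpM2r ?sqr_ge0 //.
  by rewrite -[h x ^+ 2]real_normK ?num_real // ler_pXn2r ?nnegrE.
have cf2 : mu.-integrable `]a, b[ (fun x => ((c ^+ 2)%:E * (f x ^+ 2)%:E)%E).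
  exact: integrableZl.
have Lhf : L2r a b (fun x => h x * f x).
  split; first exact: measurable_funM.
  apply: le_integrable cf2 => //.
    by apply/measurable_EFinP/measurable_funX; exact: measurable_funM.
  move=> x; rewrite /= in_itv /= => /hfc hx.
  by rewrite lee_fin [leLHS]ger0_norm ?sqr_ge0 // [leRHS]ger0_norm // mulr_ge0 ?sqr_ge0.
split=> //; rewrite -(ger0_norm c0) -nrmZ //.
have Lcf : L2r a b (fun x => c * f x) by exact: L2rZ.
rewrite ler_sqrt ?ip_ge0 //; apply: le_Rintegral => //; try exact: L2r_prod.
move=> x; rewrite /= in_itv /= => /hfc hx.
by rewrite -!expr2 [leRHS]exprMn.
Qed.

Lemma Rintegral_cos a b w : a < b -> w != 0 ->
  \int[mu]_(x in `]a, b[) cos (w * x) = (sin (w * b) - sin (w * a)) / w.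
Proof.
move=> ab w0; rewrite mulrBl.
apply: (@Rintegral_FTC (a - 1) a b _ (fun x => sin (w * x) / w)) => //.
- by rewrite ltrBlDr ltrDl.
- move=> x; apply: (@continuous_comp _ _ _ (fun y => w * y) cos).
    by apply: cvgM; [exact: cvg_cst|exact: cvg_id].
  exact: continuous_cos.
- move=> x _; apply: is_derive_eq.
  by rewrite scaler0 add0r /GRing.scale /= mulr1 mulrCA mulVf ?mulr1.
Qed.

Lemma Rintegral_sin a b w : a < b -> w != 0 ->
  \int[mu]_(x in `]a, b[) sin (w * x) = (cos (w * a) - cos (w * b)) / w.
Proof.
move=> ab w0.
have -> : (cos (w * a) - cos (w * b)) / w = - w^-1 * cos (w * b) - - w^-1 * cos (w * a).
  by field.
apply: (@Rintegral_FTC (a - 1) a b _ (fun x => - w^-1 * cos (w * x))) => //.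
- by rewrite ltrBlDr ltrDl.
- move=> x; apply: (@continuous_comp _ _ _ (fun y => w * y) sin).
    by apply: cvgM; [exact: cvg_cst|exact: cvg_id].
  exact: continuous_sin.
- move=> x _; apply: is_derive_eq.
  rewrite /GRing.scale /= mulr1.
  by field.
Qed.

Lemma continuous_cosM w : continuous (fun x => cos (w * x)).
Proof.
move=> x; apply: (@continuous_comp _ _ _ (fun y => w * y) cos).
  by apply: cvgM; [exact: cvg_cst|exact: cvg_id].
exact: continuous_cos.
Qed.

Lemma continuous_sinM w : continuous (fun x => sin (w * x)).
Proof.
move=> x; apply: (@continuous_comp _ _ _ (fun y => w * y) sin).
  by apply: cvgM; [exact: cvg_cst|exact: cvg_id].
exact: continuous_sin.
Qed.

Lemma L2r_cos a b w : L2r a b (fun x => cos (w * x)).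
Proof.
apply: (@L2r_bounded _ _ 1) => [|x _]; last exact: cos_max.
apply: (@measurable_funS _ _ _ _ setT) => //.
apply: continuous_measurable_fun; exact: continuous_cosM.
Qed.

Lemma L2r_sin a b w : L2r a b (fun x => sin (w * x)).
Proof.
apply: (@L2r_bounded _ _ 1) => [|x _]; last exact: sin_max.
apply: (@measurable_funS _ _ _ _ setT) => //.
apply: continuous_measurable_fun; exact: continuous_sinM.
Qed.

(** Bessel: the squared distance from [f] to its projection is nonnegative. *)
Lemma bessel a b c f (e : nat -> R -> R) N : 0 < c -> L2r a b f ->
  (forall i, L2r a b (e i)) ->
  (forall i j, ip a b (e i) (e j) = if i == j then c else 0) ->
  \sum_(i < N) ip a b f (e i) ^+ 2 <= c * ip a b f f.
Proof.
move=> c0 Lf Le oe.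
have LS : L2r a b (fun x => \sum_(i < N) (ip a b f (e i) / c) * e i x).
  by apply: L2r_sum => i; exact: L2rZ.
have := ip_ge0 a b (fun x => f x - \sum_(i < N) (ip a b f (e i) / c) * e i x).
rewrite ip_sqrB // ip_sumr //; last by move=> i; exact: L2rZ.
rewrite ip_suml //; last by move=> i; exact: L2rZ.
under eq_bigr do rewrite ipZr // mulrAC -expr2.
have -> : \sum_(i < N) ip a b (fun x => ip a b f (e i) / c * e i x)
    (fun x => \sum_(i0 < N) ip a b f (e i0) / c * e i0 x) =
    \sum_(i < N) ip a b f (e i) ^+ 2 / c.
  apply: eq_bigr => i _; rewrite ip_sumr //; try by move=> *; exact: L2rZ.
    rewrite (bigD1 i) //= big1 ?addr0; last first.
      move=> j ji; rewrite ipZr ?ipZl // ?oe; try exact: L2rZ.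
      have /negPf -> : val i != val j by rewrite eq_sym.
      by rewrite !mulr0.
    rewrite ipZr ?ipZl // ?oe; try exact: L2rZ.
    by rewrite eqxx divfK ?gt_eqF // mulrAC -expr2.
rewrite -mulr_suml => H.
by rewrite mulrC -ler_pdivrMr //; lra.
Qed.

(** Fatou: a bound on the norms survives pointwise limits. *)
Lemma L2r_cvg a b c f (F : nat -> R -> R) : (forall n, L2r a b (F n)) ->
  (forall x, a < x < b -> F ^~ x @ \oo --> f x) ->
  (forall n, ip a b (F n) (F n) <= c) -> L2r a b f /\ ip a b f f <= c.
Proof.
move=> LF Ff Fc.
have mf : measurable_fun `]a, b[ f.
  apply: (@measurable_fun_cvg _ _ _ _ F) => [n|x]; first by case: (LF n).
  by rewrite /= in_itv; exact: Ff.
have mF n : measurable_fun `]a, b[ (fun x => (F n x ^+ 2)%:E).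
  by apply/measurable_EFinP/measurable_funX; case: (LF n).
have mf2 : measurable_fun `]a, b[ (fun x => (f x ^+ 2)%:E).
  by apply/measurable_EFinP/measurable_funX.
have h : (\int[mu]_(x in `]a, b[) (f x ^+ 2)%:E <= c%:E)%E.
  have mI : measurable (`]a, b[ : set R) by [].
  have F0 n x : `]a, b[%classic x -> (0 <= (F n x ^+ 2)%:E)%E.
    by move=> _; rewrite lee_fin sqr_ge0.
  have := fatou mu mI mF F0; set A := (X in (X <= _)%E -> _).
  have -> : A = (\int[mu]_(x in `]a, b[) (f x ^+ 2)%:E)%E.
    apply: eq_integral => x; rewrite inE /= in_itv => /Ff Fx.
    have F2 : (F n x ^+ 2)%:E @[n --> \oo] --> (f x ^+ 2)%:E.
      by apply: cvg_EFin; [exact: nearW|apply: cvgM].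
    rewrite is_cvg_limn_einfE; last by apply/cvg_ex; eexists; exact: F2.
    exact/cvg_lim.
  move=> /le_trans; apply; rewrite limn_einf_lim.
  apply: lime_le; first exact: is_cvg_einfs.
  apply: nearW => n; apply: (@le_trans _ _ (\int[mu]_(x in `]a, b[) (F n x ^+ 2)%:E)%E).
    by apply: ereal_inf_lbound; exists n => /=.
  have := Fc n; rewrite -lee_fin; apply: le_trans.
  rewrite /ip /Rintegral fineK //.
  by rewrite integrable_fin_num // ; exact: L2r_prod.
have Lf : L2r a b f.
  split=> //; apply/integrableP; split=> //.
  under eq_integral do rewrite gee0_abs ?lee_fin ?sqr_ge0 //.
  by apply: le_lt_trans h _; exact: ltry.
split=> //; rewrite -lee_fin /ip /Rintegral fineK //.
by rewrite integrable_fin_num //; exact: L2r_prod.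
Qed.

Lemma L1_le_nrm a b f : a < b -> L2r a b f ->
  mu.-integrable `]a, b[ (EFin \o f) /\
  \int[mu]_(x in `]a, b[) `|f x| <= Num.sqrt (b - a) * nrm a b f.
Proof.
move=> ab Lf; have [mf f2] := Lf.
have L1 : L2r a b (fun=> 1 : R).
  by apply: (@L2r_bounded _ _ 1) => // x _; rewrite normr1.
have Laf : L2r a b (fun x => `|f x|).
  split; first exact: measurableT_comp.
  by apply: eq_integrable f2 => // x _; rewrite real_normK ?num_real.
have If : mu.-integrable `]a, b[ (EFin \o f).
  by apply: eq_integrable (L2r_prod L1 Lf) => // x _; rewrite /= mul1r.
split=> //.
have -> : \int[mu]_(x in `]a, b[) `|f x| = ip a b (fun=> 1) (fun x => `|f x|).
  by apply: eq_Rintegral => x _; rewrite mul1r.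
have -> : nrm a b f = nrm a b (fun x => `|f x|).
  rewrite /nrm; congr Num.sqrt; apply: eq_Rintegral => x _.
  by rewrite -!expr2 real_normK ?num_real.
apply: le_trans (ler_norm _) (le_trans (normr_ip L1 Laf) _).
rewrite ler_wpM2r ?nrm_ge0 // ler_sqrt; last by rewrite subr_ge0 ltW.
have := @ip_bounded a b 1 _ (ltW ab) L1 (fun x _ => _).
by rewrite expr1n mul1r; apply => *; rewrite normr1.
Qed.

(** A sequence whose consecutive differences are summable in [L^2] converges
    almost everywhere, because the sum of the absolute differences is
    integrable; modifying the functions on the exceptional null set makes the
    convergence hold everywhere. *)
Lemma L2r_fast_cvg a b (F : nat -> R -> R) : a < b -> (forall n, L2r a b (F n)) ->
  (forall n, nrm a b (fun x => F n.+1 x - F n x) <= 2^-1 ^+ n) ->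
  exists (G : nat -> R -> R) (y : R -> R), [/\ forall n, L2r a b (G n),
     forall f n, L2r a b f ->
       nrm a b (fun x => f x - F n x) = nrm a b (fun x => f x - G n x) &
     forall x, a < x < b -> G n x @[n --> \oo] --> y x].
Proof.
move=> ab LF dF.
pose d n x := `|F n.+1 x - F n x|.
have Ld n : L2r a b (fun x => F n.+1 x - F n x) by exact: L2rB.
pose h x := (\sum_(0 <= n <oo) (d n x)%:E)%E.
have md n : measurable_fun `]a, b[ (fun x => (d n x)%:E).
  apply/measurable_EFinP; apply: measurableT_comp => //.
  by case: (Ld n).
have d0 n x : (0 <= (d n x)%:E)%E by rewrite lee_fin normr_ge0.
have ih : mu.-integrable `]a, b[ h.
  apply/integrableP; split.
    by apply: ge0_emeasurable_sum => [k x _ _|k _]; [exact: d0|exact: md].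
  under eq_integral do rewrite gee0_abs ?nneseries_ge0 //.
  rewrite integral_nneseries //.
  apply: (@le_lt_trans _ _ (Num.sqrt (b - a) * (1 - 2^-1)^-1)%:E); last exact: ltry.
  apply: lime_le; first by apply: is_cvg_nneseries => n _ _; exact: integral_ge0.
  apply: nearW => N.
  apply: (@le_trans _ _ (\sum_(0 <= n < N) (Num.sqrt (b - a) * 2^-1 ^+ n)%:E)%E).
    apply: lee_sum => n _.
    have [I1 H1] := L1_le_nrm ab (Ld n).
    have := le_trans H1 (ler_wpM2l (sqrtr_ge0 _) (dF n)).
    rewrite -lee_fin; apply: le_trans.
    by rewrite /Rintegral fineK // integrable_fin_num //; exact: integrable_norm.
  rewrite sumEFin lee_fin.
  apply: (@geometric_le_lim _ N (Num.sqrt (b - a)) 2^-1); rewrite ?sqrtr_ge0 ?invr_gt0 //.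
  by rewrite ger0_norm ?invr_ge0 // invf_lt1 // ltr1n.
have [N [mN N0 hN]] : {ae mu, forall x, `]a, b[%classic x -> h x \is a fin_num}.
  exact: integrable_ae.
pose G n x := \1_(~` N) x * F n x.
have mI : measurable_fun `]a, b[ (\1_(~` N) : R -> R).
  by apply: measurable_indic; exact: measurableC.
have LG n : L2r a b (G n).
  have [|] := @nrm_mul_bounded a b 1 (F n) (\1_(~` N)) ler01 mI _ (LF n) => //.
  by move=> x _; rewrite indicE; case: (_ \in _); rewrite ?normr1 ?normr0.
have cG x : a < x < b -> cvgn (fun n => G n x).
  move=> abx; have [xN|xN] := pselect (N x).
    rewrite (_ : (fun n => G n x) = fun=> 0); first exact: is_cvg_cst.
    by apply/funext => n; rewrite /G indicE memNset ?mul0r // => /(_ xN).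
  have hx : h x \is a fin_num.
    apply: contrapT => hx; apply: xN; apply: hN => /= H; apply: hx; apply: H.
    by rewrite /= in_itv.
  have cd : cvgn (series (fun n => `|F n.+1 x - F n x|)).
    apply: nondecreasing_is_cvgn.
      by apply: nondecreasing_series => n _ _; exact: normr_ge0.
    exists (fine (h x)) => _ [n _ <-]; rewrite -lee_fin fineK // -sumEFin.
    by apply: nneseries_lim_ge => k _ _; exact: d0.
  have := normed_cvg cd => /cvg_ex[l Hl].
  apply/cvg_ex; exists (F 0%N x + l).
  rewrite (_ : (fun n => G n x) =
      fun n => F 0%N x + series (fun n => F n.+1 x - F n x) n).
    by apply: cvgD => //; exact: cvg_cst.
  apply/funext => n; rewrite /G indicE mem_set ?mul1r //.
  by rewrite /series /= telescope_sumr // addrCA subrr addr0.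
exists G, (fun x => limn (fun n => G n x)); split => // f n Lf.
rewrite /nrm; congr (Num.sqrt (fine _)).
have eqN (g : R -> R) : L2r a b g ->
    (\int[mu]_(x in `]a, b[) (g x * g x)%:E =
     \int[mu]_(x in `]a, b[ `\` N) (g x * g x)%:E)%E.
  by move=> Lg; apply: negligible_integral => //; exact: L2r_prod.
rewrite eqN; last exact: L2rB.
rewrite [RHS]eqN; last exact: L2rB.
apply: eq_integral => x; rewrite inE /= => -[_ xN].
by rewrite /G indicE mem_set ?mul1r.
Qed.

(** A Cauchy sequence has a subsequence with geometrically decreasing
    differences, whose limit it shares by Fatou. *)
Lemma L2r_complete a b (F : nat -> R -> R) : a < b -> (forall n, L2r a b (F n)) ->
  (forall e, 0 < e -> exists N, forall n m, (N <= n)%N -> (N <= m)%N ->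
     nrm a b (fun x => F n x - F m x) <= e) ->
  exists y, L2r a b y /\
    forall e, 0 < e -> exists N, forall n, (N <= n)%N ->
      nrm a b (fun x => F n x - y x) <= e.
Proof.
move=> ab LF cF.
have e2 n : 0 < (2^-1 : R) ^+ n by rewrite exprn_gt0 // invr_gt0.
have [K hK] := choice (fun n => cF _ (e2 n)).
pose k n := (n + \max_(i < n.+1) K i)%N.
have kK n : (K n <= k n)%N by apply: leq_trans (leq_addl _ _); apply: (@leq_bigmax _ (fun i : 'I_n.+1 => K i) ord_max).
have kS n : (k n <= k n.+1)%N by rewrite leq_add // [X in (_ <= X)%N]big_ord_recr leq_maxl.
have [|G [y [LG FG Gy]]] := L2r_fast_cvg ab (fun n => LF (k n)).
  by move=> n; apply: hK => //; exact: leq_trans (kK n) (kS n).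
have Ly e N : 0 <= e -> (forall n m, (N <= n)%N -> (N <= m)%N ->
     nrm a b (fun x => F n x - F m x) <= e) -> forall n, (N <= n)%N ->
     L2r a b (fun x => F n x - y x) /\ nrm a b (fun x => F n x - y x) <= e.
  move=> e0 H n Nn.
  have kn j : (j <= k j)%N by rewrite leq_addr.
  have [L1 L2] : L2r a b (fun x => F n x - y x) /\
      ip a b (fun x => F n x - y x) (fun x => F n x - y x) <= e ^+ 2.
    apply: (@L2r_cvg _ _ _ _ (fun j x => F n x - G (j + N)%N x)).
    - by move=> j; exact: L2rB.
    - move=> x abx; apply: cvgB; first exact: cvg_cst.
      by have := Gy x abx; rewrite -(cvg_shiftn N).
    - move=> j; rewrite -sqr_nrm -FG // ler_pXn2r ?nnegrE ?nrm_ge0 //.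
      by apply: H => //; apply: leq_trans (kn _); rewrite leq_addl.
  by split => //; rewrite -(ger0_norm e0) -sqrtr_sqr ler_sqrt ?sqr_ge0.
have [N HN] := cF 1 ltr01.
have [L1 _] := Ly 1 N ler01 HN N (leqnn _).
exists y; split.
  by apply: L2r_ext (L2rB (LF N) L1) => x _; rewrite subKr.
move=> e e0; have [M HM] := cF e e0; exists M => n Mn.
by have [] := Ly e M (ltW e0) HM n Mn.
Qed.

End SquareIntegrable.

(** * Elementary bounds on sine and cosine *)

Section TrigBounds.
Variable R : realType.
Implicit Types x y z : R.

Lemma MVT_everywhere (f df : R -> R) x y :
  x < y -> (forall z, is_derive z 1 f (df z)) ->
  exists2 c, x < c < y & f y - f x = df c * (y - x).
Proof.
move=> xy dF; have [|c] := MVT xy (fun z _ => dF z).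
  apply: continuous_subspaceT => z.
  by apply/differentiable_continuous/derivable1_diffP; have := dF z => -[].
by rewrite in_itv /= => cxy E; exists c.
Qed.

Lemma lipschitz_of_deriv (f df : R -> R) c x y :
  (forall z, is_derive z 1 f (df z)) -> 0 <= c ->
  (forall z, `|z - x| <= `|y - x| -> `|df z| <= c) -> `|f y - f x| <= c * `|y - x|.
Proof.
move=> dF c0 dc; have [xy|yx|->] := ltgtP x y; last by rewrite !subrr normr0 mulr0.
  have [z /andP[xz zy] ->] := MVT_everywhere xy dF.
  rewrite normrM ler_wpM2r // dc // !gtr0_norm ?subr_gt0 //.
  by rewrite lerD2r ltW.
have [z /andP[xz zy] E] := MVT_everywhere yx dF.
rewrite distrC E normrM [`|y - x|]distrC ler_wpM2r // dc //.
rewrite distrC [leRHS]distrC !gtr0_norm ?subr_gt0 //.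
by rewrite lerD2l lerN2 ltW.
Qed.

Lemma sin_lip x y : `|sin x - sin y| <= `|x - y|.
Proof.
rewrite -[leRHS]mul1r; apply: (@lipschitz_of_deriv sin cos) => // z _.
exact: cos_max.
Qed.

Lemma cos_lip x y : `|cos x - cos y| <= `|x - y|.
Proof.
rewrite -[leRHS]mul1r; apply: (@lipschitz_of_deriv cos (fun z => - sin z)) => // z _.
by rewrite normrN sin_max.
Qed.

Lemma norm_sin_le x : `|sin x| <= `|x|.
Proof. by have := sin_lip x 0; rewrite sin0 !subr0. Qed.

Lemma cos_sub1_le x : `|cos x - 1| <= x ^+ 2.
Proof.
rewrite -[x ^+ 2]real_normK ?num_real // expr2 -cos0 -[X in _ * `|X|]subr0.
apply: (@lipschitz_of_deriv cos (fun z => - sin z)) => // z.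
by rewrite !subr0 normrN; exact/le_trans/norm_sin_le.
Qed.

Lemma sin_subid_le x : `|sin x - x| <= x ^+ 2.
Proof.
have -> : sin x - x = (sin x - x) - (sin 0 - 0) by rewrite sin0 !subr0.
rewrite -[x ^+ 2]real_normK ?num_real // expr2 -[X in _ * `|X|]subr0.
apply: (@lipschitz_of_deriv (fun z => sin z - z) (fun z => cos z - 1)) => // z.
by rewrite !subr0 -cos0; apply: le_trans; have := cos_lip z 0; rewrite subr0.
Qed.

Lemma norm_sin_lt x : 0 < x -> `|sin x| < x.
Proof.
move=> x0; have [x1|x1] := leP x 1; last exact: le_lt_trans (sin_max x) x1.
have pi2 := pi_ge2 R.
rewrite ger0_norm; last by apply: sin_ge0_pi; apply/andP; split; lra.
have [c /andP[c0 cx] E] := MVT_everywhere x0 (@is_derive_sin R).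
move: E; rewrite sin0 !subr0 => ->; rewrite -subr_gt0 -[X in X - _]mul1r -mulrBl.
rewrite mulr_gt0 // subr_gt0 -cos0 ltr_cos // in_itv /=; apply/andP; split; lra.
Qed.

Definition sinc x : R := sin x / x.

(** [sin] is strictly concave on [[0, y]], so it lies above its chord. *)
Lemma sinc_anti x y : 0 < x -> x < y -> y <= 2 -> sinc y < sinc x.
Proof.
move=> x0 xy y2; have y0 := lt_trans x0 xy.
rewrite /sinc ltr_pdivrMr // mulrAC ltr_pdivlMr // ltNge; apply/negP => H.
pose h z := y * sin z - sin y * z.
have dh z : is_derive z 1 h (y * cos z - sin y).
  by apply: is_derive_eq; rewrite /GRing.scale /= mulr1.
have [c1 /andP[c10 c1x] E1] := MVT_everywhere x0 dh.
have [c2 /andP[xc2 c2y] E2] := MVT_everywhere xy dh.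
have hy : h y = 0 by rewrite /h mulrC subrr.
have h0 : h 0 = 0 by rewrite /h sin0 !mulr0 subrr.
have hx : h x <= 0 by rewrite /h subr_le0 mulrC.
have c1c2 : cos c2 < cos c1.
  have pi2 := pi_ge2 R.
  by rewrite ltr_cos ?in_itv /= ?(lt_trans c1x) //; apply/andP; split; lra.
move: E1 E2; rewrite hy h0 subr0 sub0r subr0 => E1 E2.
have A1 : y * cos c1 - sin y <= 0 by rewrite -(pmulr_lle0 _ x0) -E1.
have A2 : 0 <= y * cos c2 - sin y.
  by rewrite -(@pmulr_lge0 _ (y - x)) ?subr_gt0 // -E2 oppr_ge0.
have : y * cos c2 < y * cos c1 by rewrite ltr_pM2l.
lra.
Qed.

Lemma sinc_small x : 0 < x -> x <= 4^-1 -> 3 / 4 <= sinc x.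
Proof.
move=> x0 x4; rewrite /sinc ler_pdivlMr //.
have := sin_subid_le x; rewrite ler_norml => /andP[H _].
have : x ^+ 2 <= x / 4 by rewrite expr2 ler_wpM2l // ltW.
lra.
Qed.

Lemma sinc_large x : 0 < x -> `|sinc x| <= x^-1.
Proof.
move=> x0; rewrite /sinc normrM normfV (gtr0_norm x0) ler_piMl ?sin_max //.
by rewrite invr_ge0 ltW.
Qed.

(** Up to [2] the function [sinc] is injective, and beyond [2] it stays below
    [1/2], whereas [sinc x] is at least [3/4]. *)
Lemma sinc_neq x y : 0 < x -> x <= 4^-1 -> 0 < y -> y <> x -> sinc y <> sinc x.
Proof.
move=> x0 x4 y0 yx E; have sx := sinc_small x0 x4.
have y2 : y <= 2.
  rewrite leNgt; apply/negP => y2.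
  have := sinc_large y0; rewrite E ler_norml => /andP[_ H].
  have : y^-1 < 2^-1 by rewrite ltf_pV2 // posrE.
  lra.
have [xy|yx'|] := ltgtP x y; last by move=> H; apply: yx.
- by have := sinc_anti x0 xy y2; rewrite E ltxx.
- have x2 : x <= 2 by lra.
  by have := sinc_anti y0 yx' x2; rewrite E ltxx.
Qed.

Lemma sum_cauchy_schwarz (I : Type) (r : seq I) (f g : I -> R) :
  (\sum_(i <- r) f i * g i) ^+ 2 <=
  (\sum_(i <- r) f i ^+ 2) * (\sum_(i <- r) g i ^+ 2).
Proof.
elim: r => [|i r ih]; first by rewrite !big_nil mulr0 expr0n.
rewrite !big_cons.
move: ih; set X := \sum_(i <- r) f i * g i; set A := \sum_(i <- r) f i ^+ 2.
set B := \sum_(i <- r) g i ^+ 2; set u := f i; set v := g i => ih.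
have A0 : 0 <= A by apply: sumr_ge0 => j _; exact: sqr_ge0.
have B0 : 0 <= B by apply: sumr_ge0 => j _; exact: sqr_ge0.
suff : 2 * (X * (u * v)) <= A * v ^+ 2 + B * u ^+ 2 by lra.
have S0 : 0 <= A * v ^+ 2 + B * u ^+ 2 by rewrite addr_ge0 // mulr_ge0 // sqr_ge0.
apply: le_trans (ler_norm _) _; rewrite -(@ler_pXn2r _ 2) ?nnegrE //.
rewrite real_normK ?num_real //.
have := sqr_ge0 (A * v ^+ 2 - B * u ^+ 2).
have : X ^+ 2 * (u * v) ^+ 2 <= A * B * (u * v) ^+ 2 by rewrite ler_wpM2r // sqr_ge0.
lra.
Qed.

Lemma sum_norm_le (I : Type) (r : seq I) (f g : I -> R) A B :
  \sum_(i <- r) f i ^+ 2 <= A -> \sum_(i <- r) g i ^+ 2 <= B ->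
  \sum_(i <- r) `|f i| * `|g i| <= Num.sqrt A * Num.sqrt B.
Proof.
move=> fA gB.
have A0 : 0 <= \sum_(i <- r) f i ^+ 2 by apply: sumr_ge0 => j _; exact: sqr_ge0.
have B0 : 0 <= \sum_(i <- r) g i ^+ 2 by apply: sumr_ge0 => j _; exact: sqr_ge0.
rewrite -(@ler_pXn2r _ 2) ?nnegrE ?mulr_ge0 ?sqrtr_ge0 //; last first.
  by apply: sumr_ge0 => i _; rewrite mulr_ge0.
rewrite exprMn !sqr_sqrtr; [|exact: le_trans gB|exact: le_trans fA].
apply: le_trans (sum_cauchy_schwarz r (fun i => `|f i|) (fun i => `|g i|)) _.
under eq_bigr do rewrite real_normK ?num_real //.
under [X in _ * X]eq_bigr do rewrite real_normK ?num_real //.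
exact: ler_pM.
Qed.

Lemma le_add_harmonic (A B K : R) : (forall M : nat, A <= B + K / M.+1%:R) -> A <= B.
Proof.
move=> H; rewrite leNgt; apply/negP => BA.
have e0 : 0 < A - B by rewrite subr_gt0.
have := H (Num.bound (`|K| / (A - B))).
have := archi_boundP (divr_ge0 (normr_ge0 K) (ltW e0)).
set M := Num.bound _; rewrite ltr_pdivrMr // => KM.
rewrite -lerBlDl ler_pdivlMr ?ltr0n //.
have := ler_norm K; rewrite -addn1 natrD; nra.
Qed.

End TrigBounds.

(** * Averaging the translates of a trigonometric sum *)

Section Averaging.
Variable R : realType.
Variable I : eqType.
Variable Lam : I -> R.
Implicit Types (r : seq I) (P Q m : I -> R) (t s L eta : R).

Definition trig_sum r P Q t : R :=
  \sum_(i <- r) (P i * cos (Lam i * t) + Q i * sin (Lam i * t)).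

Lemma continuous_trig_sum r P Q : continuous (trig_sum r P Q).
Proof.
move=> t; rewrite /trig_sum; elim: r => [|i r ih].
  rewrite (_ : (fun t => _) = fun=> 0); first exact: cvg_cst.
  by apply/funext => x; rewrite big_nil.
rewrite (_ : (fun t => _) = fun t => (P i * cos (Lam i * t) + Q i * sin (Lam i * t)) +
   \sum_(i <- r) (P i * cos (Lam i * t) + Q i * sin (Lam i * t))).
  apply: cvgD; last exact: ih.
  apply: cvgD; apply: cvgM; try exact: cvg_cst.
    exact: continuous_cosM.
  exact: continuous_sinM.
by apply/funext => x; rewrite big_cons.
Qed.

Lemma L2r_trig_sum a b r P Q : L2r a b (trig_sum r P Q).
Proof.
apply: L2r_sum => i; apply: L2rD; apply: L2rZ; [exact: L2r_cos|exact: L2r_sin].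
Qed.

Lemma trig_sum_le r P Q t : `|trig_sum r P Q t| <= \sum_(i <- r) (`|P i| + `|Q i|).
Proof.
apply: le_trans (ler_norm_sum _ _ _) _; apply: ler_sum => i _.
apply: le_trans (ler_normD _ _) _; rewrite !normrM.
by apply: lerD; rewrite ler_piMr // ?cos_max ?sin_max.
Qed.

Lemma nrm_trig_sum_le L r P Q : 0 <= L ->
  nrm (- L) L (trig_sum r P Q) <= (\sum_(i <- r) (`|P i| + `|Q i|)) * Num.sqrt (2 * L).
Proof.
move=> L0; have -> : 2 * L = L - - L by ring.
apply: nrm_bounded; first by lra.
- by apply: sumr_ge0 => i _; rewrite addr_ge0.
- exact: L2r_trig_sum.
- by move=> t _; exact: trig_sum_le.
Qed.

Lemma trig_sumB r P Q P' Q' t :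
  trig_sum r P Q t - trig_sum r P' Q' t =
  trig_sum r (fun i => P i - P' i) (fun i => Q i - Q' i) t.
Proof.
rewrite /trig_sum -sumrB; apply: eq_bigr => i _; ring.
Qed.

Lemma trig_sumZ c r P Q t :
  c * trig_sum r P Q t = trig_sum r (fun i => c * P i) (fun i => c * Q i) t.
Proof. by rewrite /trig_sum big_distrr; apply: eq_bigr => i _ /=; ring. Qed.

Lemma trig_sum_shift2 r P Q t s :
  2^-1 * (trig_sum r P Q (t + s) + trig_sum r P Q (t - s)) =
  trig_sum r (fun i => cos (Lam i * s) * P i) (fun i => cos (Lam i * s) * Q i) t.
Proof.
rewrite /trig_sum -big_split big_distrr; apply: eq_bigr => i _ /=.
rewrite !mulrDr !mulrN !cosD !sinD !cosN !sinN; lra.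
Qed.

Lemma trig_sum_cons i r P Q t : trig_sum (i :: r) P Q t =
  (P i * cos (Lam i * t) + Q i * sin (Lam i * t)) + trig_sum r P Q t.
Proof. by rewrite /trig_sum big_cons. Qed.

Lemma eq_trig_sum r P P' Q Q' t : P =1 P' -> Q =1 Q' ->
  trig_sum r P Q t = trig_sum r P' Q' t.
Proof. by move=> PP QQ; apply: eq_bigr => i _; rewrite PP QQ. Qed.

Lemma perm_trig_sum r r' P Q t : perm_eq r r' -> trig_sum r P Q t = trig_sum r' P Q t.
Proof. by move=> rr; rewrite /trig_sum (perm_big _ rr). Qed.

(** The factor by which averaging translates over the midpoints of a
    subdivision of [[-eta, eta]] multiplies a mode of frequency [x]. A finite
    average keeps the argument within finite sums and triangle inequalities;
    [sinc] is its limit. *)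
Definition mid_mult eta (M : nat) (x : R) : R :=
  M.+1%:R^-1 * \sum_(j < M.+1) cos (x * (eta * (j%:R + 2^-1) / M.+1%:R)).

Lemma trig_sum_mid r P Q eta M t :
  trig_sum r (fun i => mid_mult eta M (Lam i) * P i)
             (fun i => mid_mult eta M (Lam i) * Q i) t =
  \sum_(j < M.+1) M.+1%:R^-1 *
   (2^-1 * (trig_sum r P Q (t + eta * (j%:R + 2^-1) / M.+1%:R) +
            trig_sum r P Q (t - eta * (j%:R + 2^-1) / M.+1%:R))).
Proof.
under eq_bigr do rewrite trig_sum_shift2.
rewrite -big_distrr /= /trig_sum exchange_big /= big_distrr /=; apply: eq_bigr => i _.
rewrite /mid_mult -!mulrA -mulrDr; congr (_ * _).
by rewrite !big_distrl /= -big_split /=; apply: eq_bigr => j _; ring.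
Qed.

Lemma nrm_mid L r P Q eta M : 0 < L -> 0 <= eta ->
  nrm (- L) L (trig_sum r (fun i => mid_mult eta M (Lam i) * P i)
             (fun i => mid_mult eta M (Lam i) * Q i)) <=
  nrm (- (L + eta)) (L + eta) (trig_sum r P Q).
Proof.
move=> L0 e0; set f := trig_sum r P Q.
have NL : - L < L by lra.
have cf : continuous f by exact: continuous_trig_sum.
have Lf a b : L2r a b f by exact: L2r_trig_sum.
have Ls s : L2r (- L) L (fun t => f (t + s)).
  apply: continuous_L2r => // x.
  apply: (@continuous_comp _ _ _ (fun y => y + s) f); last exact: cf.
  by apply: cvgD; [exact: cvg_id|exact: cvg_cst].
have Ns s : `|s| <= eta -> nrm (- L) L (fun t => f (t + s)) <= nrm (- (L + eta)) (L + eta) f.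
  move=> se; rewrite nrm_shift //; apply: nrmS => //.
    by move: se; rewrite ler_norml => /andP[? ?]; lra.
  by move: se; rewrite ler_norml => /andP[? ?]; lra.
pose s (j : nat) := eta * (j%:R + 2^-1) / M.+1%:R.
have sj (j : 'I_M.+1) : `|s j| <= eta.
  rewrite /s ger0_norm; last by rewrite divr_ge0 // mulr_ge0 // addr_ge0 // invr_ge0.
  rewrite ler_pdivrMr ?ltr0n // ler_wpM2l //.
  have : (j.+1%:R : R) <= M.+1%:R by rewrite ler_nat.
  by rewrite -[j.+1]addn1 natrD; lra.
rewrite (@eq_nrm _ _ _ _ (fun t => \sum_(j < M.+1) M.+1%:R^-1 *
   (2^-1 * (f (t + s j) + f (t - s j))))); last first.
  by move=> t _; rewrite trig_sum_mid.
apply: le_trans (nrm_sum _ _) _.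
  by move=> j; do 2 apply: L2rZ; apply: L2rD; exact: Ls.
apply: (@le_trans _ _ (\sum_(j < M.+1) M.+1%:R^-1 * nrm (- (L + eta)) (L + eta) f)).
  apply: ler_sum => j _.
  rewrite nrmZ; last by apply: L2rZ; apply: L2rD; exact: Ls.
  rewrite nrmZ; last by apply: L2rD; exact: Ls.
  rewrite ger0_norm ?invr_ge0 // ler_wpM2l ?invr_ge0 //.
  rewrite ger0_norm ?invr_ge0 // mulrC ler_pdivrMr //.
  apply: le_trans (nrmD (Ls _) (Ls _)) _.
  rewrite mulr_natr mulr2n; apply: lerD; apply: Ns => //.
  by rewrite normrN.
by rewrite -big_distrr /= sumr_const card_ord -[X in _ * X]mulr_natl mulrA mulVf ?mul1r // pnatr_eq0.
Qed.

(** Multiplied by [2 * sin (x * eta / (2 * M.+1))], the sum of cosines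
    telescopes to [sin (x * eta)]. *)
Lemma mid_mult_sinc eta M x : 0 < eta -> 0 < x ->
  `|mid_mult eta M x - sinc (x * eta)| <= (x * eta) / M.+1%:R.
Proof.
move=> e0 x0; set y := x * eta; have y0 : 0 < y by rewrite mulr_gt0.
set N : R := M.+1%:R; have N0 : 0 < N by rewrite ltr0n.
have tele (n : nat) : 2 * sin (y / N / 2) *
    \sum_(j < n) cos (x * (eta * (j%:R + 2^-1) / N)) = sin (n%:R * (y / N)).
  elim: n => [|n ih]; first by rewrite big_ord0 mul0r mulr0 sin0.
  rewrite big_ord_recr mulrDr ih /=.
  have -> : n.+1%:R * (y / N) = x * (eta * (n%:R + 2^-1) / N) + y / N / 2.
    by rewrite -addn1 natrD /y; field; rewrite gt_eqF.
  have -> : n%:R * (y / N) = x * (eta * (n%:R + 2^-1) / N) - y / N / 2.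
    by rewrite /y; field; rewrite gt_eqF.
  by rewrite sinB sinD; ring.
set m := mid_mult eta M x.
have E : m * (2 * N * sin (y / N / 2)) = sin y.
  have -> : sin y = sin (N * (y / N)) by rewrite mulrC divfK ?gt_eqF.
  rewrite -tele /m /mid_mult -/N; field; by rewrite gt_eqF.
have m1 : `|m| <= 1.
  rewrite /m /mid_mult -/N normrM normfV (gtr0_norm N0) mulrC ler_pdivrMr // mul1r.
  apply: le_trans (ler_norm_sum _ _ _) _.
  apply: (@le_trans _ _ (\sum_(j < M.+1) (1 : R))).
    by apply: ler_sum => j _; exact: cos_max.
  by rewrite sumr_const card_ord.
have -> : m - sinc y = m * (2 * N * ((y / N / 2) - sin (y / N / 2))) / y.
  rewrite /sinc -E; field; by rewrite !gt_eqF.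
rewrite normrM normfV (gtr0_norm y0) ler_pdivrMr // normrM.
apply: le_trans (ler_piMl (normr_ge0 _) m1) _.
rewrite normrM (@ger0_norm _ (2 * N)); last by rewrite mulr_ge0 ?ltW.
rewrite distrC.
apply: le_trans (ler_wpM2l _ (sin_subid_le _)) _; first by rewrite mulr_ge0 ?ltW.
have -> : 2 * N * (y / N / 2) ^+ 2 = y ^+ 2 / N / 2 by field; rewrite gt_eqF.
have -> : y / N * y = y ^+ 2 / N by rewrite expr2; ring.
have : 0 <= y ^+ 2 / N by rewrite divr_ge0 ?sqr_ge0 ?ltW.
by move: (y ^+ 2 / N) => z; lra.
Qed.

(** Averaging translates multiplies each mode by [sinc] and, by the triangle
    inequality, does not increase the norm except through the widening of the
    interval. *)
Lemma nrm_sinc L r P Q eta : 0 < L -> 0 < eta -> (forall i, 0 < Lam i) ->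
  nrm (- L) L (trig_sum r (fun i => sinc (Lam i * eta) * P i)
             (fun i => sinc (Lam i * eta) * Q i)) <=
  nrm (- (L + eta)) (L + eta) (trig_sum r P Q).
Proof.
move=> L0 e0 Lam0.
set A := nrm _ _ _; set B := nrm _ _ _.
pose K := (\sum_(i <- r) (Lam i * eta) * (`|P i| + `|Q i|)) * Num.sqrt (2 * L).
have H (M : nat) : A <= B + K / M.+1%:R.
  pose f1 := trig_sum r (fun i => mid_mult eta M (Lam i) * P i)
             (fun i => mid_mult eta M (Lam i) * Q i).
  pose f2 := trig_sum r (fun i => sinc (Lam i * eta) * P i - mid_mult eta M (Lam i) * P i)
             (fun i => sinc (Lam i * eta) * Q i - mid_mult eta M (Lam i) * Q i).
  have -> : A = nrm (- L) L (fun t => f1 t + f2 t).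
    by apply: eq_nrm => t _; rewrite /f2 -trig_sumB addrCA subrr addr0.
  apply: le_trans (nrmD (L2r_trig_sum _ _ _ _ _) (L2r_trig_sum _ _ _ _ _)) _.
  apply: lerD; first by apply: nrm_mid; rewrite // ltW.
  apply: le_trans (nrm_trig_sum_le _ _ _ (ltW L0)) _.
  rewrite /K mulrAC ler_wpM2r ?sqrtr_ge0 // big_distrl /=; apply: ler_sum => i _.
  rewrite -!mulrBl !normrM -mulrDr mulrAC ler_wpM2r ?addr_ge0 //.
  by rewrite distrC mid_mult_sinc.
exact: le_add_harmonic H.
Qed.

End Averaging.

(** * Adding a frequency to an observable family *)

Section AddFrequency.
Variable R : realType.
Variable I : eqType.
Variables (Lam w : I -> R).
Implicit Types (r : seq I) (P Q : I -> R) (S : pred I) (L : R).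
Local Notation trig_sum := (trig_sum Lam).

Definition coef_sq r P Q : R := \sum_(i <- r) w i * (P i ^+ 2 + Q i ^+ 2).

(** Quantifying over the lengths beyond [l] leaves room for the slight
    lengthening of the interval that each added frequency requires. *)
Definition observable S (l : R) : Prop := forall L, l < L ->
  exists2 C, 0 < C & forall r P Q, uniq r -> {in r, forall i, S i} ->
    coef_sq r P Q <= C * nrm (- L) L (trig_sum r P Q) ^+ 2.

(** The Gram matrix of [cos] and [sin] on a symmetric interval is diagonal,
    and positive because [sin] lies strictly below the identity. *)
Lemma one_mode_lower L x : 0 < L -> 0 < x -> exists2 c : R, 0 < c &
  forall p q : R, c * (p ^+ 2 + q ^+ 2) <=
    nrm (- L) L (fun t => p * cos (x * t) + q * sin (x * t)) ^+ 2.
Proof.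
move=> L0 x0; have NL : - L < L by lra.
have x2 : 2 * x != 0 by rewrite mulf_neq0 // gt_eqF.
have Lc a b v : L2r a b (fun t : R => cos (v * t)) by exact: L2r_cos.
have Ls a b v : L2r a b (fun t : R => sin (v * t)) by exact: L2r_sin.
have L1 : L2r (- L) L (fun=> 1 : R).
  by apply: (@L2r_bounded _ _ _ 1) => // t _; rewrite normr1.
pose u := sin (2 * x * L) / (2 * x).
have I1 : ip (- L) L (fun=> 1 : R) (fun=> 1 : R) = 2 * L.
  rewrite /ip; under eq_Rintegral do rewrite mul1r.
  rewrite Rintegral_cst //= lebesgue_measure_itv /= lte_fin NL mul1r -EFinD /=.
  by ring.
have Ic : ip (- L) L (fun=> 1 : R) (fun t => cos (2 * x * t)) = 2 * u.
  rewrite /ip; under eq_Rintegral do rewrite mul1r.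
  by rewrite Rintegral_cos // mulrN sinN /u; field; rewrite gt_eqF.
have Is : ip (- L) L (fun=> 1 : R) (fun t => sin (2 * x * t)) = 0.
  rewrite /ip; under eq_Rintegral do rewrite mul1r.
  by rewrite Rintegral_sin // mulrN cosN subrr mul0r.
have cc : ip (- L) L (fun t => cos (x * t)) (fun t => cos (x * t)) = L + u.
  transitivity (ip (- L) L (fun=> 1 : R) (fun t => 2^-1 * 1 + 2^-1 * cos (2 * x * t))).
    apply: eq_Rintegral => t _; rewrite mul1r mulr1.
    have -> : 2 * x * t = x * t + x * t by ring.
    rewrite cosD -!expr2 sin2cos2; lra.
  rewrite ipDr ?ipZr ?I1 ?Ic //; try exact: L2rZ.
  lra.
have ss : ip (- L) L (fun t => sin (x * t)) (fun t => sin (x * t)) = L - u.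
  transitivity (ip (- L) L (fun=> 1 : R) (fun t => 2^-1 * 1 - 2^-1 * cos (2 * x * t))).
    apply: eq_Rintegral => t _; rewrite mul1r mulr1.
    have -> : 2 * x * t = x * t + x * t by ring.
    rewrite cosD -!expr2 sin2cos2; lra.
  rewrite ipBr ?ipZr ?I1 ?Ic //; try exact: L2rZ.
  lra.
have cs : ip (- L) L (fun t => cos (x * t)) (fun t => sin (x * t)) = 0.
  transitivity (ip (- L) L (fun=> 1 : R) (fun t => 2^-1 * sin (2 * x * t))).
    apply: eq_Rintegral => t _; rewrite mul1r.
    have -> : 2 * x * t = x * t + x * t by ring.
    rewrite sinD; lra.
  by rewrite ipZr // Is mulr0.
have uL : `|u| < L.
  rewrite /u normrM normfV (@gtr0_norm _ (2 * x)) ?mulr_gt0 // ltr_pdivrMr ?mulr_gt0 //.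
  by rewrite [L * _]mulrC; apply: norm_sin_lt; rewrite !mulr_gt0.
exists (L - `|u|); first by rewrite subr_gt0.
move=> p q; rewrite sqr_nrm ip_sqrD; try exact: L2rZ.
rewrite !ipZl ?ipZr //; try exact: L2rZ.
rewrite cc ss cs mulr0 !mulr0 addr0.
have := ler_norm u; have := ler_norm (- u); rewrite normrN => h1 h2.
have := sqr_ge0 p; have := sqr_ge0 q; nra.
Qed.

Lemma coef_sq_le r P Q P' Q' c : 0 <= c -> (forall i, 0 < w i) ->
  {in r, forall i, c * `|P i| <= `|P' i| /\ c * `|Q i| <= `|Q' i|} ->
  c ^+ 2 * coef_sq r P Q <= coef_sq r P' Q'.
Proof.
move=> c0 w0 H; rewrite /coef_sq big_distrr /= big_seq [leRHS]big_seq.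
apply: ler_sum => i /H [HP HQ]; rewrite mulrCA ler_wpM2l ?(ltW (w0 i)) // mulrDr.
rewrite -!exprMn; apply: lerD.
  rewrite -[leLHS]real_normK ?num_real // -[leRHS]real_normK ?num_real //.
  by rewrite ler_pXn2r ?nnegrE // normrM (ger0_norm c0).
rewrite -[leLHS]real_normK ?num_real // -[leRHS]real_normK ?num_real //.
by rewrite ler_pXn2r ?nnegrE // normrM (ger0_norm c0).
Qed.

Lemma finite_pos_lower (l : seq I) (F : I -> R) : {in l, forall i, 0 < F i} ->
  exists2 c : R, 0 < c & {in l, forall i, c <= F i}.
Proof.
elim: l => [|i l ih] H; first by exists 1.
have [|c c0 Hc] := ih; first by move=> j jl; apply: H; rewrite inE jl orbT.
exists (Num.min c (F i)).
  by rewrite lt_min c0 H // inE eqxx.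
move=> j; rewrite inE => /predU1P[->|jl]; first by rewrite ge_min lexx orbT.
by rewrite ge_min Hc.
Qed.

Hypothesis w0 : forall i, 0 < w i.
Hypothesis Lam0 : forall i, 0 < Lam i.
Hypothesis Lam_fin : forall M : R, exists l : seq I, forall i, Lam i <= M -> i \in l.
Hypothesis Lam_sum : exists K : R, forall r, uniq r ->
  \sum_(i <- r) (w i)^-1 * (Lam i)^-1 ^+ 6 <= K.

(** At high frequencies [sinc] is at most [1/2], away from its value at [i0];
    among the finitely many others it avoids that value. *)
Lemma sinc_gap S i0 eta : 0 < eta -> Lam i0 * eta <= 4^-1 ->
  (forall i, S i -> Lam i <> Lam i0) ->
  exists2 c : R, 0 < c & forall i, S i ->
    c <= `|sinc (Lam i * eta) - sinc (Lam i0 * eta)|.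
Proof.
move=> e0 e4 Sne; have [l hl] := Lam_fin (2 / eta).
have x0 : 0 < Lam i0 * eta by rewrite mulr_gt0.
have [|c c0 Hc] := @finite_pos_lower [seq i <- l | Lam i != Lam i0]
    (fun i => `|sinc (Lam i * eta) - sinc (Lam i0 * eta)|).
  move=> i; rewrite mem_filter => /andP[/eqP ne _].
  rewrite normr_gt0 subr_eq0; apply/eqP; apply: sinc_neq => //.
    by rewrite mulr_gt0.
  by move=> /(mulIf (lt0r_neq0 e0)).
exists (Num.min c 4^-1); first by rewrite lt_min c0 invr_gt0 ltr0n.
move=> i Si; rewrite ge_min; have [iM|iM] := leP (Lam i) (2 / eta).
  by rewrite Hc // mem_filter hl // andbT; apply/eqP; exact: Sne.
have y2 : 2 < Lam i * eta by rewrite -ltr_pdivrMr.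
have y0 : 0 < Lam i * eta by rewrite mulr_gt0.
apply/orP; right.
have := sinc_small x0 e4; have := sinc_large y0; rewrite ler_norml => /andP[_ h1] h2.
have h3 : (Lam i * eta)^-1 <= 2^-1 by rewrite lef_pV2 ?posrE // ltW.
rewrite distrC; apply: le_trans (ler_norm _); lra.
Qed.

(** Haraux's device.  Subtracting from the [sinc] average of the sum its value on
    the mode [i0] removes that mode and damps no other one to zero; the amplitude
    of [i0] is then recovered from a triple average, whose multipliers are
    summable against the weights. *)
Lemma observable_add S i0 l : 0 <= l -> (forall i, S i -> Lam i <> Lam i0) ->
  observable S l -> observable (predU1 i0 S) l.
Proof.
move=> l0 Sne obs L lL.
pose L' := (L + l) / 2; have lL' : l < L' by rewrite /L'; lra.
have L'0 : 0 < L' by lra.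
have [C C0 HC] := obs L' lL'.
pose eta := Num.min ((L - l) / 6) ((4 * Lam i0)^-1).
have e0 : 0 < eta by rewrite lt_min divr_gt0 ?subr_gt0 // invr_gt0 mulr_gt0.
have e6 : L' + eta + eta + eta <= L.
  have : eta <= (L - l) / 6 by rewrite ge_min lexx.
  by rewrite /L'; lra.
have e4 : Lam i0 * eta <= 4^-1.
  have : eta <= (4 * Lam i0)^-1 by rewrite ge_min lexx orbT.
  rewrite invfM -(ler_pM2l (Lam0 i0)) mulrCA divff ?mulr1 // gt_eqF //.
have [c c0 Hc] := sinc_gap e0 e4 Sne.
have [K HK] := Lam_sum.
have [c1 c10 Hc1] := one_mode_lower L'0 (Lam0 i0).
have x0 : 0 < Lam i0 * eta by rewrite mulr_gt0.
pose s i := sinc (Lam i * eta).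
have s0 := sinc_small x0 e4; rewrite -/(s i0) in s0.
have s01 : s i0 <= 1.
  rewrite /s /sinc ler_pdivrMr // mul1r.
  by apply: le_trans (ler_norm _) (le_trans (norm_sin_le _) _); rewrite gtr0_norm.
have K0 : 0 <= K by apply: le_trans (HK [::] isT); rewrite big_nil.
have e1 : 0 < eta ^- 1 by rewrite invr_gt0.
pose m i := s i - s i0.
pose C1 := C * 4 / c ^+ 2.
have C10 : 0 < C1 by rewrite divr_gt0 ?exprn_gt0 // mulr_gt0.
pose D := (1 + 2 * Num.sqrt C1 * Num.sqrt (eta^-1 ^+ 6 * K) * Num.sqrt (2 * L')) / s i0 ^+ 3.
have s3 : 0 < s i0 ^+ 3 by rewrite exprn_gt0 //; lra.
have D0 : 0 <= D by rewrite divr_ge0 ?ltW // addr_ge0 // !mulr_ge0 ?sqrtr_ge0.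
have nS r P Q L2 : L2 <= L -> nrm (- L2) L2 (trig_sum r P Q) <= nrm (- L) L (trig_sum r P Q).
  by move=> h; apply: nrmS => //; [rewrite lerN2|exact: L2r_trig_sum].
have step1 r P Q : uniq r -> {in r, forall i, S i} ->
    coef_sq r P Q <= C1 * nrm (- L) L (trig_sum (i0 :: r) P Q) ^+ 2.
  move=> ur rS; set N := nrm (- L) L _.
  have N0 : 0 <= N by exact: nrm_ge0.
  have cm : c ^+ 2 * coef_sq r P Q <= coef_sq r (fun i => m i * P i) (fun i => m i * Q i).
    apply: coef_sq_le => //; first exact: ltW.
    by move=> i /rS Si; rewrite !normrM !ler_wpM2r // Hc.
  have Nm : nrm (- L') L' (trig_sum r (fun i => m i * P i) (fun i => m i * Q i)) <= 2 * N.
    rewrite (@eq_nrm _ _ _ _ (fun t =>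
      trig_sum (i0 :: r) (fun i => s i * P i) (fun i => s i * Q i) t -
      s i0 * trig_sum (i0 :: r) P Q t)); last first.
      move=> t _; rewrite trig_sumZ trig_sumB trig_sum_cons !subrr !mul0r !add0r.
      by apply: eq_trig_sum => i; rewrite /m mulrBl.
    apply: (le_trans (nrmB _ _)).
    - exact: L2r_trig_sum.
    - apply: L2rZ; exact: L2r_trig_sum.
    rewrite nrmZ; last exact: L2r_trig_sum.
    rewrite mulr_natl mulr2n; apply: lerD.
      apply: le_trans (nrm_sinc _ _ _ L'0 e0 Lam0) _; apply: nS; lra.
    apply: (@le_trans _ _ (1 * N)); last by rewrite mul1r.
    apply: ler_pM => //; first exact: nrm_ge0.
      by rewrite ger0_norm //; lra.
    by apply: nS; lra.
  have := le_trans cm (HC _ _ _ ur rS).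
  rewrite mulrC -ler_pdivlMr ?exprn_gt0 // => /le_trans; apply.
  have -> : C1 * N ^+ 2 = C * (4 * N ^+ 2) / c ^+ 2 by rewrite /C1; ring.
  rewrite ler_wpM2r ?invr_ge0 ?sqr_ge0 // ler_wpM2l ?(ltW C0) //.
  have -> : 4 * N ^+ 2 = (2 * N) ^+ 2 by ring.
  by rewrite ler_pXn2r ?nnegrE ?nrm_ge0 // mulr_ge0.
have step2 r P Q : uniq r -> {in r, forall i, S i} ->
    nrm (- L') L' (fun t => P i0 * cos (Lam i0 * t) + Q i0 * sin (Lam i0 * t)) <=
    D * nrm (- L) L (trig_sum (i0 :: r) P Q).
  move=> ur rS; set N := nrm (- L) L _.
  have N0 : 0 <= N by exact: nrm_ge0.
  set f0 := fun t => _.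
  have Lf0 : L2r (- L') L' f0.
    by apply: L2rD; apply: L2rZ; [exact: L2r_cos|exact: L2r_sin].
  rewrite /D mulrAC ler_pdivlMr // mulrC.
  rewrite -[s i0 ^+ 3](ger0_norm (ltW s3)) -nrmZ //.
  pose s3P i := s i * (s i * (s i * P i)); pose s3Q i := s i * (s i * (s i * Q i)).
  rewrite (@eq_nrm _ _ _ _ (fun t => trig_sum (i0 :: r) s3P s3Q t - trig_sum r s3P s3Q t)); last first.
    by move=> t _; rewrite trig_sum_cons addrK /f0 /s3P /s3Q; ring.
  apply: (le_trans (nrmB _ _)); try exact: L2r_trig_sum.
  rewrite mulrDl mul1r; apply: lerD.
    apply: le_trans (nrm_sinc _ _ _ L'0 e0 Lam0) _.
    apply: le_trans (nrm_sinc _ _ _ _ e0 Lam0) _; first lra.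
    by apply: le_trans (nrm_sinc _ _ _ _ e0 Lam0) _; [lra|exact: nS].
  apply: le_trans (nrm_trig_sum_le _ _ _ _ (ltW L'0)) _.
  rewrite mulrAC ler_wpM2r ?sqrtr_ge0 //.
  have cN : Num.sqrt (coef_sq r P Q) <= Num.sqrt C1 * N.
    rewrite -[N in leRHS]ger0_norm // -sqrtr_sqr -sqrtrM ?(ltW C10) //.
    by apply: ler_wsqrtr; exact: step1.
  have key (X : I -> R) : \sum_(i <- r) w i * X i ^+ 2 <= coef_sq r P Q ->
      \sum_(i <- r) `|s i * (s i * (s i * X i))| <=
      Num.sqrt C1 * N * Num.sqrt (eta^-1 ^+ 6 * K).
    move=> HX; apply: (@le_trans _ _ (Num.sqrt (coef_sq r P Q) * Num.sqrt (eta^-1 ^+ 6 * K))); last first.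
      by rewrite ler_wpM2r ?sqrtr_ge0.
    apply: le_trans (sum_norm_le (r := r) (f := fun i => Num.sqrt (w i) * X i)
      (g := fun i => s i ^+ 3 / Num.sqrt (w i)) _ _); last 2 first.
    - apply: le_trans HX; apply: ler_sum => i _.
      by rewrite exprMn sqr_sqrtr ?(ltW (w0 _)).
    - apply: le_trans (ler_wpM2l _ (HK r ur)); last by rewrite exprn_ge0 ?ltW.
      rewrite big_distrr /=; apply: ler_sum => i _.
      have y0 : 0 < Lam i * eta by rewrite mulr_gt0.
      have -> : (s i ^+ 3 / Num.sqrt (w i)) ^+ 2 = (w i)^-1 * `|s i| ^+ 6.
        rewrite expr_div_n sqr_sqrtr ?(ltW (w0 _)) // mulrC -exprM.
        by rewrite -normrX ger0_norm // -[6%N]/(2 * 3)%N exprM exprn_ge0 ?sqr_ge0.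
      have -> : eta^-1 ^+ 6 * ((w i)^-1 * (Lam i)^-1 ^+ 6) = (w i)^-1 * (Lam i * eta)^-1 ^+ 6.
        by rewrite invfM; ring.
      rewrite ler_wpM2l ?invr_ge0 ?(ltW (w0 _)) // ler_pXn2r ?nnegrE ?invr_ge0 ?(ltW y0) //.
      exact: sinc_large.
    apply: ler_sum => i _; rewrite -normrM.
    have sw : Num.sqrt (w i) != 0 by rewrite gt_eqF // sqrtr_gt0.
    rewrite le_eqVlt; apply/orP; left; apply/eqP; congr `|_|.
    rewrite [RHS](_ : _ = s i ^+ 3 * X i * (Num.sqrt (w i) / Num.sqrt (w i))); last by ring.
    by rewrite divff // mulr1; ring.
  rewrite big_split /=.
  have -> : 2 * Num.sqrt C1 * Num.sqrt (eta^-1 ^+ 6 * K) * N =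
     Num.sqrt C1 * N * Num.sqrt (eta^-1 ^+ 6 * K) +
     Num.sqrt C1 * N * Num.sqrt (eta^-1 ^+ 6 * K) by ring.
  by apply: lerD; apply: key; apply: ler_sum => i _; rewrite ler_wpM2l ?(ltW (w0 _)) //
    ?lerDl ?lerDr sqr_ge0.
pose Ct := C + (C1 + w i0 / c1 * D ^+ 2).
have wc : 0 < w i0 / c1 by rewrite divr_gt0.
have D2 : 0 <= w i0 / c1 * D ^+ 2 by rewrite mulr_ge0 ?sqr_ge0 // ltW.
exists Ct; first by rewrite /Ct; lra.
move=> r P Q ur rS; have [ir|ir] := boolP (i0 \in r); last first.
  have rS' : {in r, forall i, S i}.
    move=> i ri; have := rS i ri => /predU1P[ii|//].
    by rewrite -ii ri in ir.
  apply: le_trans (HC _ _ _ ur rS') _; apply: ler_pM; rewrite ?sqr_ge0 ?(ltW C0) //.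
    by rewrite /Ct; lra.
  by rewrite ler_pXn2r ?nnegrE ?nrm_ge0 // nS //; rewrite /L'; lra.
have pr := perm_to_rem ir; set r' := rem i0 r in pr.
have ur' : uniq r' by exact: rem_uniq.
have rS' : {in r', forall i, S i}.
  move=> i; rewrite (mem_rem_uniq _ ur) inE /= => /andP[/negPf ne ri].
  by have := rS i ri; rewrite /= ne.
have -> : nrm (- L) L (trig_sum r P Q) = nrm (- L) L (trig_sum (i0 :: r') P Q).
  by apply: eq_nrm => t _; exact: perm_trig_sum.
have -> : coef_sq r P Q = w i0 * (P i0 ^+ 2 + Q i0 ^+ 2) + coef_sq r' P Q.
  by rewrite /coef_sq (perm_big _ pr) big_cons.
have h1 := step1 r' P Q ur' rS'; have h2 := step2 r' P Q ur' rS'.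
move: h1 h2; set N := nrm (- L) L _ => h1 h2.
have N0 : 0 <= N by exact: nrm_ge0.
have h3 : P i0 ^+ 2 + Q i0 ^+ 2 <= D ^+ 2 * N ^+ 2 / c1.
  rewrite ler_pdivlMr // mulrC; apply: le_trans (Hc1 _ _) _.
  by rewrite -exprMn ler_pXn2r ?nnegrE ?nrm_ge0 // mulr_ge0.
have h4 : w i0 * (P i0 ^+ 2 + Q i0 ^+ 2) <= w i0 * (D ^+ 2 * N ^+ 2 / c1).
  by rewrite ler_wpM2l ?(ltW (w0 _)).
have h5 : 0 <= C * N ^+ 2 by rewrite mulr_ge0 ?sqr_ge0 ?ltW.
have -> : Ct * N ^+ 2 = C * N ^+ 2 + w i0 * (D ^+ 2 * N ^+ 2 / c1) + C1 * N ^+ 2.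
  by rewrite /Ct; ring.
lra.
Qed.

Lemma observable_adds S (s : seq I) l : 0 <= l -> injective Lam ->
  observable S l -> observable (fun i => (i \in s) || S i) l.
Proof.
move=> l0 inj obs; elim: s => [|i0 s ih] //.
have [i0s|i0s] := boolP ((i0 \in s) || S i0).
  move=> L lL; have [C C0 HC] := ih L lL; exists C => // r P Q ur rS.
  apply: HC => // i /rS; rewrite inE => /orP[/predU1P[->//|->//]|->].
  by rewrite orbT.
have := @observable_add (fun i => (i \in s) || S i) i0 l l0 _ ih.
move=> H L lL; have [|C C0 HC] := H _ L lL.
  by move=> i iS /inj E; move: i0s; rewrite -E iS.
exists C => // r P Q ur rS; apply: HC => // i /rS; rewrite inE /=.
by rewrite orbA.
Qed.

End AddFrequency.

(** * Trigonometric sums over a period *)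

Section PeriodicSums.
Variable R : realType.
Variable vp : R.
Hypothesis vp0 : 0 < vp.
Implicit Types (a b t x y : R) (n m K : nat).

Local Notation T0 := (2 * pi / vp).

Lemma period_gt0 : 0 < T0.
Proof. by rewrite divr_gt0 // mulr_gt0 // pi_gt0. Qed.

Lemma sin_nat2pi n : sin (n%:R * (2 * pi)) = 0 :> R.
Proof.
elim: n => [|n ih]; first by rewrite mul0r sin0.
by rewrite -addn1 natrD mulrDl mul1r [in X in _ + X]mulr_natl sinD2pi.
Qed.

Lemma cos_nat2pi n : cos (n%:R * (2 * pi)) = 1 :> R.
Proof.
elim: n => [|n ih]; first by rewrite mul0r cos0.
by rewrite -addn1 natrD mulrDl mul1r [in X in _ + X]mulr_natl cosD2pi.
Qed.

Lemma sin_shift_period n m K x :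
  sin ((n%:R - m%:R) * vp * (x + K%:R * T0)) = sin ((n%:R - m%:R) * vp * x).
Proof.
have -> : (n%:R - m%:R) * vp * (x + K%:R * T0) =
  (n%:R - m%:R) * vp * x + (n * K)%:R * (2 * pi) - (m * K)%:R * (2 * pi).
  by rewrite !natrM; field; rewrite gt_eqF.
by rewrite sinB sinD cosD !sin_nat2pi !cos_nat2pi !mulr0 !mulr1 addr0 !subr0.
Qed.

Lemma cos_shift_period n m K x :
  cos ((n%:R - m%:R) * vp * (x + K%:R * T0)) = cos ((n%:R - m%:R) * vp * x).
Proof.
have -> : (n%:R - m%:R) * vp * (x + K%:R * T0) =
  (n%:R - m%:R) * vp * x + (n * K)%:R * (2 * pi) - (m * K)%:R * (2 * pi).
  by rewrite !natrM; field; rewrite gt_eqF.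
by rewrite cosB sinD cosD !sin_nat2pi !cos_nat2pi !mulr0 !mulr1 subr0 addr0.
Qed.

Lemma ip_cos_period a K n m : (0 < K)%N ->
  ip a (a + K%:R * T0) (fun=> 1) (fun t => cos ((n%:R - m%:R) * vp * t)) =
  if n == m then K%:R * T0 else 0.
Proof.
move=> K0; have ab : a < a + K%:R * T0.
  by rewrite ltrDl mulr_gt0 ?period_gt0 // ltr0n.
rewrite /ip; under eq_Rintegral do rewrite mul1r.
case: eqP => [->|/eqP nm].
  under eq_Rintegral do rewrite subrr !mul0r cos0.
  by rewrite Rintegral_cst //= lebesgue_measure_itv /= lte_fin ab mul1r -EFinD /= addrAC subrr add0r.
rewrite Rintegral_cos //.
  by rewrite sin_shift_period subrr mul0r.
by rewrite mulf_neq0 ?subr_eq0 ?eqr_nat ?(gt_eqF vp0).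
Qed.

Lemma ip_sin_period a K n m : (0 < K)%N ->
  ip a (a + K%:R * T0) (fun=> 1) (fun t => sin ((n%:R - m%:R) * vp * t)) = 0.
Proof.
move=> K0; have ab : a < a + K%:R * T0.
  by rewrite ltrDl mulr_gt0 ?period_gt0 // ltr0n.
rewrite /ip; under eq_Rintegral do rewrite mul1r.
case: (eqVneq n m) => [->|nm].
  under eq_Rintegral do rewrite subrr !mul0r sin0.
  by rewrite Rintegral_cst // mul0r.
rewrite Rintegral_sin //.
  by rewrite cos_shift_period subrr mul0r.
by rewrite mulf_neq0 ?subr_eq0 ?eqr_nat ?(gt_eqF vp0).
Qed.

Lemma L2r_1 a b : L2r a b (fun=> 1 : R).
Proof. by apply: (@L2r_bounded _ _ _ 1) => // t _; rewrite normr1. Qed.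

Variable th : nat -> R.
Hypothesis thB : forall n m, th n - th m = (n%:R - m%:R) * vp.

(** Adding the Gram matrices of the cosines and of the sines leaves [cos ((th
    n - th m) t)], which depends on the differences of the frequencies,
    multiples of [vp]. *)
Lemma ip_cos_sin_diff a K n m : (0 < K)%N ->
  ip a (a + K%:R * T0) (fun t => cos (th n * t)) (fun t => cos (th m * t)) +
  ip a (a + K%:R * T0) (fun t => sin (th n * t)) (fun t => sin (th m * t)) =
  if n == m then K%:R * T0 else 0.
Proof.
move=> K0; rewrite -(ip_cos_period a n m K0) /ip -RintegralD //;
  try by apply: L2r_prod; first [exact: L2r_cos|exact: L2r_sin].
apply: eq_Rintegral => t _; rewrite mul1r -thB.
by rewrite mulrBl cosB.
Qed.

Lemma ip_sum_cos_sin_le a K M (c : nat -> R) : (0 < K)%N ->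
  ip a (a + K%:R * T0) (fun t => \sum_(n < M) c n * cos (th n * t))
    (fun t => \sum_(n < M) c n * cos (th n * t)) +
  ip a (a + K%:R * T0) (fun t => \sum_(n < M) c n * sin (th n * t))
    (fun t => \sum_(n < M) c n * sin (th n * t)) =
  K%:R * T0 * \sum_(n < M) c n ^+ 2.
Proof.
move=> K0; set b := a + _.
have Lc n : L2r a b (fun t => cos (th n * t)) by exact: L2r_cos.
have Ls n : L2r a b (fun t => sin (th n * t)) by exact: L2r_sin.
have Lcc n : L2r a b (fun t => c n * cos (th n * t)) by exact: L2rZ.
have Lcs n : L2r a b (fun t => c n * sin (th n * t)) by exact: L2rZ.
have Sc : L2r a b (fun t => \sum_(n < M) c n * cos (th n * t)) by exact: L2r_sum.
have Ss : L2r a b (fun t => \sum_(n < M) c n * sin (th n * t)) by exact: L2r_sum.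
rewrite !ip_suml // -big_split mulr_sumr; apply: eq_bigr => n _ /=.
rewrite !ip_sumr // -big_split /= (bigD1 n) //= big1 ?addr0; last first.
  move=> m mn; rewrite !ipZl // !ipZr // -!mulrDr ip_cos_sin_diff //.
  have /negPf -> : val n != val m by rewrite eq_sym.
  by rewrite !mulr0.
by rewrite !ipZl // !ipZr // -!mulrDr ip_cos_sin_diff // eqxx; ring.
Qed.

(** Neither Gram matrix is diagonal by itself, but each is nonnegative and
    their sum is diagonal, which is enough for an upper bound. *)
Lemma nrm_trig_periodic a K M (p q : nat -> R) : (0 < K)%N ->
  nrm a (a + K%:R * T0)
    (fun t => \sum_(n < M) (p n * cos (th n * t) + q n * sin (th n * t))) ^+ 2 <=
  2 * (K%:R * T0) * \sum_(n < M) (p n ^+ 2 + q n ^+ 2).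
Proof.
move=> K0; set b := a + _.
have Lc n : L2r a b (fun t => p n * cos (th n * t)) by apply: L2rZ; exact: L2r_cos.
have Ls n : L2r a b (fun t => q n * sin (th n * t)) by apply: L2rZ; exact: L2r_sin.
set f := fun t => \sum_(n < M) p n * cos (th n * t).
set g := fun t => \sum_(n < M) q n * sin (th n * t).
have Lf : L2r a b f by exact: L2r_sum.
have Lg : L2r a b g by exact: L2r_sum.
rewrite (@eq_nrm _ _ _ _ (fun t => f t + g t)); last first.
  by move=> t _; rewrite big_split.
have hf := ip_sum_cos_sin_le a M p K0; have hg := ip_sum_cos_sin_le a M q K0.
have hf0 := ip_ge0 a b (fun t => \sum_(n < M) p n * sin (th n * t)).
have hg0 := ip_ge0 a b (fun t => \sum_(n < M) q n * cos (th n * t)).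
rewrite big_split /= -mulrA mulrDr -hf -hg -/f -/g.
have h : nrm a b (fun t => f t + g t) ^+ 2 <= (nrm a b f + nrm a b g) ^+ 2.
  by rewrite ler_pXn2r ?nnegrE ?addr_ge0 ?nrm_ge0 // nrmD.
apply: le_trans h _.
have := sqr_ge0 (nrm a b f - nrm a b g); have := sqr_nrm a b f; have := sqr_nrm a b g.
rewrite -/b => <- <-; nra.
Qed.

(** When the sums of frequencies also lie in the period lattice, the sines and
    cosines are orthogonal. *)
Variable k : nat.
Hypothesis thD : forall n m, th n + th m = ((n + m + k)%:R) * vp.
Hypothesis k0 : (0 < k)%N.

Lemma ip_trig_orth a n m :
  [/\ ip a (a + 1%:R * T0) (fun t => cos (th n * t)) (fun t => cos (th m * t)) =
       (if n == m then T0 / 2 else 0),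
     ip a (a + 1%:R * T0) (fun t => sin (th n * t)) (fun t => sin (th m * t)) =
       (if n == m then T0 / 2 else 0) &
     ip a (a + 1%:R * T0) (fun t => cos (th n * t)) (fun t => sin (th m * t)) = 0].
Proof.
have K0 : (0 < 1)%N by [].
set b := a + _.
have L1 := L2r_1 a b.
have Lc x : L2r a b (fun t => cos (x * t)) by exact: L2r_cos.
have Ls x : L2r a b (fun t => sin (x * t)) by exact: L2r_sin.
have E1 := ip_cos_period a n m K0.
have := ip_cos_period a (n + m + k) 0 K0.
have -> : ((n + m + k)%N == 0%N) = false by rewrite !addn_eq0 [k == 0%N]eqn0Ngt k0 andbF.
move=> E2.
have E3 := ip_sin_period a m n K0.
have E4 := ip_sin_period a (n + m + k) 0 K0.
rewrite -/b in E1 E2 E3 E4.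
have T0E : 1%:R * T0 / 2 = T0 / 2 by rewrite mul1r.
split.
- transitivity (ip a b (fun=> 1) (fun t => 2^-1 * cos ((n%:R - m%:R) * vp * t) +
     2^-1 * cos (((n + m + k)%:R - 0%:R) * vp * t))).
    apply: eq_Rintegral => t _; rewrite mul1r subr0 -thB -thD.
    by rewrite mulrBl mulrDl cosB cosD; field.
  rewrite ipDr ?ipZr ?E1 ?E2 //; try exact: L2rZ.
  by case: ifP => _; rewrite ?mul1r ?mulr0 ?addr0 // mulrC.
- transitivity (ip a b (fun=> 1) (fun t => 2^-1 * cos ((n%:R - m%:R) * vp * t) -
     2^-1 * cos (((n + m + k)%:R - 0%:R) * vp * t))).
    apply: eq_Rintegral => t _; rewrite mul1r subr0 -thB -thD.
    by rewrite mulrBl mulrDl cosB cosD; field.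
  rewrite ipBr ?ipZr ?E1 ?E2 //; try exact: L2rZ.
  by case: ifP => _; rewrite ?mul1r ?mulr0 ?subr0 // mulrC.
- transitivity (ip a b (fun=> 1) (fun t => 2^-1 * sin ((m%:R - n%:R) * vp * t) +
     2^-1 * sin (((n + m + k)%:R - 0%:R) * vp * t))).
    apply: eq_Rintegral => t _; rewrite mul1r subr0 -thB -thD.
    by rewrite mulrBl mulrDl sinB sinD; field.
  by rewrite ipDr ?ipZr ?E3 ?E4 ?mulr0 ?addr0 //; exact: L2rZ.
Qed.

Lemma nrm_trig_parseval a M (p q : nat -> R) :
  nrm a (a + 1%:R * T0)
    (fun t => \sum_(n < M) (p n * cos (th n * t) + q n * sin (th n * t))) ^+ 2 =
  T0 / 2 * \sum_(n < M) (p n ^+ 2 + q n ^+ 2).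
Proof.
set b := a + _.
have Lc n : L2r a b (fun t => cos (th n * t)) by exact: L2r_cos.
have Ls n : L2r a b (fun t => sin (th n * t)) by exact: L2r_sin.
have Lcc n : L2r a b (fun t => p n * cos (th n * t)) by exact: L2rZ.
have Lcs n : L2r a b (fun t => q n * sin (th n * t)) by exact: L2rZ.
have Lcd n : L2r a b (fun t => p n * cos (th n * t) + q n * sin (th n * t)) by exact: L2rD.
have S : L2r a b (fun t => \sum_(n < M) (p n * cos (th n * t) + q n * sin (th n * t))).
  exact: L2r_sum.
rewrite sqr_nrm ip_suml // mulr_sumr; apply: eq_bigr => n _.
rewrite ip_sumr // (bigD1 n) //= big1 ?addr0.
  have [E1 E2 E3] := ip_trig_orth a n n.
  rewrite eqxx -/b in E1 E2 E3.
  rewrite ip_sqrD // !ipZl // !ipZr // E1 E2 E3; ring.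
move=> m mn; have [E1 E2 E3] := ip_trig_orth a n m.
have [_ _ E4] := ip_trig_orth a m n.
have nm : val n != val m by rewrite eq_sym.
rewrite (negPf nm) -/b in E1 E2 E3; rewrite -/b in E4.
rewrite ipDl // !ipDr // !ipZl // !ipZr // E1 E2 E3 [ip a b (fun t => sin _) _]ipC E4.
by rewrite !mulr0 !addr0.
Qed.

End PeriodicSums.

(** * The dispersion relation *)

Section Frequencies.
Variable R : realType.
Variables (vp : R) (k0 : nat).
Hypothesis vp0 : 0 < vp.
Hypothesis k00 : (0 < k0)%N.
Implicit Types (t x y : R) (n m : nat) (i : nat * bool).

Local Notation T0 := (2 * pi / vp).

Definition half_gap : R := k0%:R * vp / 2.
Definition wave_num n : R := n.+1%:R * vp.
Definition disp_root n : R := Num.sqrt (wave_num n ^+ 2 + half_gap ^+ 2).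

(** The two frequency branches of the Timoshenko system with equal speeds; [true]
    is the upper branch. *)
Definition freq i : R := disp_root i.1 + (if i.2 then half_gap else - half_gap).

Definition freq_weight i : R := (i.1.+1%:R ^+ 4)^-1.

Lemma half_gap_gt0 : 0 < half_gap.
Proof. by rewrite /half_gap divr_gt0 // mulr_gt0 // ltr0n. Qed.

Lemma wave_num_gt0 n : 0 < wave_num n.
Proof. by rewrite mulr_gt0 // ltr0n. Qed.

Lemma sqr_disp_root n : disp_root n ^+ 2 = wave_num n ^+ 2 + half_gap ^+ 2.
Proof. by rewrite sqr_sqrtr // addr_ge0 // sqr_ge0. Qed.

Lemma disp_root_gt n : wave_num n < disp_root n /\ half_gap < disp_root n.
Proof.
have x0 := wave_num_gt0 n; have h0 := half_gap_gt0.
have s0 : 0 <= disp_root n by exact: sqrtr_ge0.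
have x2 : 0 < wave_num n ^+ 2 by rewrite exprn_gt0.
have h2 : 0 < half_gap ^+ 2 by rewrite exprn_gt0.
split; rewrite -(@ltr_pXn2r _ 2) ?nnegrE ?(ltW x0) ?(ltW h0) // sqr_disp_root.
  by rewrite ltrDl.
by rewrite ltrDr.
Qed.

Lemma disp_root_le n : disp_root n <= wave_num n + half_gap.
Proof.
have x0 := wave_num_gt0 n; have h0 := half_gap_gt0.
rewrite -(@ler_pXn2r _ 2) ?nnegrE ?sqrtr_ge0 ?addr_ge0 ?ltW //.
rewrite sqr_disp_root sqrrD; have := mulr_gt0 x0 h0; lra.
Qed.

Lemma freq_gt0 i : 0 < freq i.
Proof.
have [_ hs] := disp_root_gt i.1; have h0 := half_gap_gt0.
by rewrite /freq; case: i.2; lra.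
Qed.

Lemma freq_mul n : freq (n, true) * freq (n, false) = wave_num n ^+ 2.
Proof. by rewrite /freq /=; have := sqr_disp_root n; lra. Qed.

(** Its decay makes each branch a perturbation of an arithmetic progression;
    its differences are the gaps within the close pairs. *)
Definition excess n : R := disp_root n - wave_num n.

Lemma excessE n : excess n * (disp_root n + wave_num n) = half_gap ^+ 2.
Proof. by rewrite /excess; have := sqr_disp_root n; lra. Qed.

Lemma excess_bound n : 0 < excess n <= half_gap ^+ 2 / vp / n.+1%:R.
Proof.
have [xs _] := disp_root_gt n; have x0 := wave_num_gt0 n.
rewrite /excess subr_gt0 xs /=.
have n0 : 0 < n.+1%:R :> R by rewrite ltr0n.
rewrite ler_pdivlMr // ler_pdivlMr // -mulrA -/(wave_num n) -(excessE n).
rewrite -/(excess n) ler_wpM2l //; first by rewrite /excess subr_ge0 ltW.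
have := sqrtr_ge0 (wave_num n ^+ 2 + half_gap ^+ 2); rewrite -/(disp_root n); lra.
Qed.

Lemma wave_numD n m : wave_num (n + m) = wave_num n + m%:R * vp.
Proof. by rewrite /wave_num -addSn natrD mulrDl. Qed.

(** The frequencies of the modes [(n, true)] and [(n + k0, false)] tend to
    each other, since the branches are [k0] steps of the progression apart;
    this is their difference. *)
Definition near_gap n : R := excess n - excess (n + k0).

(** The excess is [half_gap ^+ 2 / (disp_root n + wave_num n)], of order
    [1/n], so that its difference over a fixed number of steps is of order
    [1/n^2], and no smaller. *)
Lemma near_gap_lower : exists2 c : R, 0 < c & forall n, c / n.+1%:R ^+ 2 <= near_gap n.
Proof.
have h0 := half_gap_gt0.
pose A := 2 * vp + half_gap; pose B := 2 * vp * (1 + k0%:R) + half_gap.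
have A0 : 0 < A by rewrite addr_gt0 // mulr_gt0.
have B0 : 0 < B by rewrite addr_gt0 // !mulr_gt0 // ltr_wpDr.
exists (2 * half_gap ^+ 3 / (A * B)).
  by apply: divr_gt0; rewrite mulr_gt0 // exprn_gt0.
move=> n; have n0 : 0 < n.+1%:R :> R by rewrite ltr0n.
have n1 : 1 <= n.+1%:R :> R by rewrite ler1n.
set m := (n + k0)%N.
have [xn _] := disp_root_gt n; have [xm _] := disp_root_gt m.
have x0 := wave_num_gt0 n; have xm0 := wave_num_gt0 m.
have hn := disp_root_le n; have hm := disp_root_le m.
have xmn : wave_num m = wave_num n + 2 * half_gap.
  by rewrite wave_numD /half_gap; field.
have smn : disp_root n <= disp_root m.
  rewrite -(@ler_pXn2r _ 2) ?nnegrE ?sqrtr_ge0 // !sqr_disp_root lerD2r.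
  by rewrite ler_pXn2r ?nnegrE ?(ltW x0) ?(ltW xm0) // xmn; lra.
set p := disp_root n + wave_num n; set q := disp_root m + wave_num m.
have p0 : 0 < p by rewrite /p; lra.
have q0 : 0 < q by rewrite /q; lra.
have gapE : near_gap n = half_gap ^+ 2 * (q - p) / (p * q).
  rewrite /near_gap -/m.
  have -> : excess n = half_gap ^+ 2 / p by rewrite -(excessE n) mulfK // gt_eqF.
  have -> : excess m = half_gap ^+ 2 / q by rewrite -(excessE m) mulfK // gt_eqF.
  by field; rewrite !gt_eqF.
have pA : p <= A * n.+1%:R.
  have h1 : half_gap <= half_gap * n.+1%:R by rewrite ler_peMr // ltW.
  by move: hn; rewrite /p /A /wave_num; lra.
have qB : q <= B * n.+1%:R.
  have h1 : half_gap <= half_gap * n.+1%:R by rewrite ler_peMr // ltW.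
  have h2 : k0%:R * vp <= k0%:R * vp * n.+1%:R.
    by rewrite ler_peMr // mulr_ge0 // ltW.
  by move: hm; rewrite /q /B wave_numD /wave_num; lra.
rewrite gapE.
have -> : 2 * half_gap ^+ 3 / (A * B) / n.+1%:R ^+ 2 =
  half_gap ^+ 2 * (2 * half_gap) / ((A * n.+1%:R) * (B * n.+1%:R)).
  by field; rewrite !gt_eqF //= pnatr_eq0.
apply: ler_pM.
- by rewrite mulr_ge0 ?sqr_ge0 // mulr_ge0 // ltW.
- by rewrite invr_ge0 !mulr_ge0 // ltW.
- by rewrite ler_wpM2l ?sqr_ge0 // /p /q xmn; lra.
- rewrite lef_pV2 ?posrE ?mulr_gt0 //.
  by apply: ler_pM => //; exact: ltW.
Qed.

Lemma freq_lower : exists2 c : R, 0 < c & forall i, c * i.1.+1%:R <= freq i.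
Proof.
have h0 := half_gap_gt0.
have A0 : 0 < vp + 2 * half_gap by rewrite addr_gt0 // mulr_gt0.
exists (vp ^+ 2 / (vp + 2 * half_gap)); first by rewrite divr_gt0 ?exprn_gt0.
move=> [n b] /=; have n1 : 1 <= n.+1%:R :> R by rewrite ler1n.
suff h : vp ^+ 2 / (vp + 2 * half_gap) * n.+1%:R <= freq (n, false).
  by case: b => //; apply: le_trans h _; rewrite /freq /=; lra.
have f0 := freq_gt0 (n, true); have g0 := freq_gt0 (n, false).
have fA : freq (n, true) <= n.+1%:R * (vp + 2 * half_gap).
  have h1 : half_gap <= half_gap * n.+1%:R by rewrite ler_peMr // ltW.
  by have := disp_root_le n; rewrite /freq /= /wave_num; lra.
have -> : freq (n, false) = wave_num n ^+ 2 / freq (n, true).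
  by rewrite -freq_mul mulrC mulKf // gt_eqF.
have fA' : freq (n, true) / (vp + 2 * half_gap) <= n.+1%:R by rewrite ler_pdivrMr.
rewrite ler_pdivlMr //.
have -> : vp ^+ 2 / (vp + 2 * half_gap) * n.+1%:R * freq (n, true) =
   vp ^+ 2 * n.+1%:R * (freq (n, true) / (vp + 2 * half_gap)) by ring.
have -> : wave_num n ^+ 2 = vp ^+ 2 * n.+1%:R * n.+1%:R by rewrite /wave_num; ring.
by rewrite ler_wpM2l // mulr_ge0 // sqr_ge0.
Qed.

(** Each branch is increasing, and a coincidence between the branches, squared
    twice, is a solution of the resonance equation. *)
Lemma freq_inj :
  (forall n m, ((n.+1%:R : R) ^+ 2 - m.+1%:R ^+ 2) ^+ 2 !=
     2 * k0%:R ^+ 2 * (n.+1%:R ^+ 2 + m.+1%:R ^+ 2)) -> injective freq.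
Proof.
move=> res.
have h0 := half_gap_gt0.
have sinj n m : disp_root n = disp_root m -> n = m.
  move=> /(congr1 (fun x => x ^+ 2)); rewrite !sqr_disp_root => /addIr E.
  have : wave_num n = wave_num m.
    by apply: (pexpIrn (n := 2)) => //; rewrite nnegrE ltW // wave_num_gt0.
  by rewrite /wave_num => /(mulIf (lt0r_neq0 vp0)) /eqP; rewrite eqr_nat => /eqP [].
have cross n m : freq (n, true) = freq (m, false) -> False.
  rewrite /freq /= => E.
  have {E} E : disp_root m - disp_root n = 2 * half_gap by lra.
  have sn := sqr_disp_root n; have sm := sqr_disp_root m.
  have E2 : 2 * (disp_root m * disp_root n) =
      wave_num n ^+ 2 + wave_num m ^+ 2 - 2 * half_gap ^+ 2.
    have : (disp_root m - disp_root n) ^+ 2 = (2 * half_gap) ^+ 2 by rewrite E.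
    by rewrite sqrrB exprMn sn sm mulr_natl; lra.
  have E3 : 4 * ((wave_num m ^+ 2 + half_gap ^+ 2) * (wave_num n ^+ 2 + half_gap ^+ 2)) =
     (wave_num n ^+ 2 + wave_num m ^+ 2 - 2 * half_gap ^+ 2) ^+ 2.
    by rewrite -E2 -sn -sm; ring.
  have /negP := res n m; apply; apply/eqP.
  have v4 : vp ^+ 4 != 0 by rewrite expf_neq0 // gt_eqF.
  apply: (mulIf v4).
  by move: E3; rewrite /wave_num /half_gap; lra.
move=> [n b] [m c] E.
case: b c E => -[] E; rewrite /freq /= in E.
- by move/addIr: E => /sinj ->.
- by case: (cross n m); rewrite /freq.
- by case: (cross m n); rewrite /freq.
- by move/addIr: E => /sinj ->.
Qed.

End Frequencies.

(** * Pairs of nearly equal frequencies *)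

Section ClosePairs.
Variable R : realType.
Implicit Types (x y z d t : R).

Lemma cos_secant y z d : `|cos (y + d) - cos y + d * sin z| <= `|d| * (2 * `|d| + `|y - z|).
Proof.
have -> : cos (y + d) - cos y + d * sin z =
  cos y * (cos d - 1) - sin y * (sin d - d) - d * (sin y - sin z).
  by rewrite cosD; ring.
have h1 : `|cos y * (cos d - 1)| <= `|d| * `|d|.
  rewrite normrM -[leRHS]mul1r ler_pM ?cos_max //.
  by rewrite -expr2 real_normK ?num_real // cos_sub1_le.
have h2 : `|sin y * (sin d - d)| <= `|d| * `|d|.
  rewrite normrM -[leRHS]mul1r ler_pM ?sin_max //.
  by rewrite -expr2 real_normK ?num_real // sin_subid_le.
have h3 : `|d * (sin y - sin z)| <= `|d| * `|y - z|.
  by rewrite normrM ler_wpM2l // sin_lip.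
apply: le_trans (ler_normB _ _) _; apply: le_trans (lerD (ler_normB _ _) (lexx _)) _.
lra.
Qed.

Lemma sin_secant y z d : `|sin (y + d) - sin y - d * cos z| <= `|d| * (2 * `|d| + `|y - z|).
Proof.
have -> : sin (y + d) - sin y - d * cos z =
  sin y * (cos d - 1) + cos y * (sin d - d) + d * (cos y - cos z).
  by rewrite sinD; ring.
have h1 : `|sin y * (cos d - 1)| <= `|d| * `|d|.
  rewrite normrM -[leRHS]mul1r ler_pM ?sin_max //.
  by rewrite -expr2 real_normK ?num_real // cos_sub1_le.
have h2 : `|cos y * (sin d - d)| <= `|d| * `|d|.
  rewrite normrM -[leRHS]mul1r ler_pM ?cos_max //.
  by rewrite -expr2 real_normK ?num_real // sin_subid_le.
have h3 : `|d * (cos y - cos z)| <= `|d| * `|y - z|.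
  by rewrite normrM ler_wpM2l // cos_lip.
apply: le_trans (ler_normD _ _) _; apply: le_trans (lerD (ler_normD _ _) (lexx _)) _.
lra.
Qed.

(** Two nearby modes of frequencies [om + e1] and [om + e2] are, to first order, a
    mode of frequency [om] with affine amplitude; the slope carries the
    coefficient multiplied by the gap. *)
Lemma close_pair om e1 e2 K T t (p q p' q' : R) :
  0 <= e2 -> e2 <= e1 -> e1 <= K -> 0 <= T -> `|t| <= T ->
  `|(p * cos ((om + e1) * t) + q * sin ((om + e1) * t) +
     (p' * cos ((om + e2) * t) + q' * sin ((om + e2) * t))) -
    ((p + p') * cos (om * t) + (q + q') * sin (om * t) +
     t * ((e1 - e2) * q * cos (om * t) + - ((e1 - e2) * p) * sin (om * t)))| <=
  K * (3 * T ^+ 2 + T) * (`|p + p'| + `|q + q'| + `|(e1 - e2) * p| + `|(e1 - e2) * q|).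
Proof.
move=> e20 e21 e1K T0 tT.
pose d := (e1 - e2) * t; pose y := (om + e2) * t; pose z := om * t.
have yd : (om + e1) * t = y + d by rewrite /y /d; ring.
have yz : y - z = e2 * t by rewrite /y /z; ring.
rewrite yd -/y -/z.
have K0 : 0 <= K by lra.
have e0 : 0 <= e1 - e2 by lra.
have E1 : `|e1 - e2| = e1 - e2 by rewrite ger0_norm.
have hy : `|y - z| <= K * T by rewrite yz normrM ger0_norm // ler_pM //; lra.
have hd : `|d| <= K * T by rewrite /d normrM E1 ler_pM //; lra.
have hd' : `|d| * (2 * `|d| + `|y - z|) <= (e1 - e2) * (3 * K * T ^+ 2).
  have -> : (e1 - e2) * (3 * K * T ^+ 2) = ((e1 - e2) * T) * (3 * (K * T)) by ring.
  by apply: ler_pM; rewrite ?addr_ge0 ?mulr_ge0 //; [rewrite /d normrM E1 ler_wpM2l|lra].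
have B1 : `|p * (cos (y + d) - cos y + d * sin z)| <= `|(e1 - e2) * p| * (3 * K * T ^+ 2).
  have -> : `|(e1 - e2) * p| * (3 * K * T ^+ 2) = `|p| * ((e1 - e2) * (3 * K * T ^+ 2)).
    by rewrite normrM E1; ring.
  rewrite normrM ler_wpM2l //.
  exact: le_trans (cos_secant _ _ _) hd'.
have B2 : `|q * (sin (y + d) - sin y - d * cos z)| <= `|(e1 - e2) * q| * (3 * K * T ^+ 2).
  have -> : `|(e1 - e2) * q| * (3 * K * T ^+ 2) = `|q| * ((e1 - e2) * (3 * K * T ^+ 2)).
    by rewrite normrM E1; ring.
  rewrite normrM ler_wpM2l //.
  exact: le_trans (sin_secant _ _ _) hd'.
have B3 : `|(p + p') * (cos y - cos z)| <= `|p + p'| * (K * T).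
  by rewrite normrM ler_wpM2l // (le_trans (cos_lip _ _)).
have B4 : `|(q + q') * (sin y - sin z)| <= `|q + q'| * (K * T).
  by rewrite normrM ler_wpM2l // (le_trans (sin_lip _ _)).
have -> : p * cos (y + d) + q * sin (y + d) + (p' * cos y + q' * sin y) -
    ((p + p') * cos z + (q + q') * sin z +
     t * ((e1 - e2) * q * cos z + - ((e1 - e2) * p) * sin z)) =
   p * (cos (y + d) - cos y + d * sin z) + q * (sin (y + d) - sin y - d * cos z) +
   (p + p') * (cos y - cos z) + (q + q') * (sin y - sin z) by rewrite /d; ring.
apply: le_trans (ler_normD _ _) _.
apply: le_trans (lerD (ler_normD _ _) (lexx _)) _.
apply: le_trans (lerD (lerD (ler_normD _ _) (lexx _)) (lexx _)) _.
have KT : 0 <= K * T by rewrite mulr_ge0.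
have KT2 : 0 <= K * T ^+ 2 by rewrite mulr_ge0 ?sqr_ge0.
have := normr_ge0 (p + p'); have := normr_ge0 (q + q').
have := normr_ge0 ((e1 - e2) * p); have := normr_ge0 ((e1 - e2) * q).
move: B1 B2 B3 B4.
move: (`|p * _|) (`|q * _|) (`|(p + p') * _|) (`|(q + q') * _|) => b1 b2 b3 b4.
move: (`|p + p'|) (`|q + q'|) (`|(e1 - e2) * p|) (`|(e1 - e2) * q|) => a1 a2 a3 a4.
move=> B1 B2 B3 B4 h4 h3 h2 h1.
have -> : K * (3 * T ^+ 2 + T) * (a1 + a2 + a3 + a4) =
   3 * (K * T ^+ 2) * (a1 + a2 + a3 + a4) + (K * T) * (a1 + a2 + a3 + a4) by ring.
have := mulr_ge0 KT2 h1; have := mulr_ge0 KT2 h2.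
have := mulr_ge0 KT h3; have := mulr_ge0 KT h4; lra.
Qed.

(** Up to the sign [s], translating by [T] adds [T * G]: the difference of two
    consecutive periods isolates [G], and then [H] is known. This is the step
    for which two periods are needed. *)
Lemma affine_periodic_lower (T s : R) (H G : R -> R) : 0 < T -> s ^+ 2 = 1 ->
  continuous H -> continuous G ->
  (forall t, H (t + T) = s * H t) -> (forall t, G (t + T) = s * G t) ->
  let N := nrm (- T) T (fun t => H t + t * G t) in
  nrm (- T) 0 G <= 2 / T * N /\ nrm (- T) 0 H <= 3 * N.
Proof.
move=> T0 s2 cH cG HT GT N.
have NT : - T < T by lra.
have NT0 : - T < 0 by lra.
pose f t := H t + t * G t.
have cf : continuous f.
  move=> t; apply: cvgD; first exact: cH.
  by apply: cvgM; [exact: cvg_id|exact: cG].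
have Lf a b : a < b -> L2r a b f by move=> ab; exact: continuous_L2r.
have LG a b : a < b -> L2r a b G by move=> ab; exact: continuous_L2r.
have s1 : `|s| = 1.
  by apply/eqP; rewrite -(@eqrXn2 _ 2) // real_normK ?num_real // s2 expr1n.
have N1 : nrm (- T) 0 f <= N by apply: nrmS; rewrite ?lexx ?ltW //; exact: Lf.
have N2 : nrm 0 T f <= N by apply: nrmS; rewrite ?lexx ?ltW //; exact: Lf.
have gE : nrm (- T) 0 (fun t => T * G t) <= 2 * N.
  have -> : nrm (- T) 0 (fun t => T * G t) =
      nrm (- T) 0 (fun t => s * f (t + T) - f t).
    apply: eq_nrm => t _; rewrite /f HT GT.
    have -> : s * (s * H t + (t + T) * (s * G t)) =
      s ^+ 2 * H t + s ^+ 2 * ((t + T) * G t) by ring.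
    rewrite s2; ring.
  have Lfs : L2r (- T) 0 (fun t => f (t + T)).
    apply: continuous_L2r => // t.
    apply: (@continuous_comp _ _ _ (fun y => y + T) f); last exact: cf.
    by apply: cvgD; [exact: cvg_id|exact: cvg_cst].
  apply: (le_trans (nrmB _ _)); [exact: L2rZ|exact: Lf|].
  rewrite nrmZ // s1 mul1r nrm_shift // addNr add0r.
  by rewrite mulr_natl mulr2n lerD.
have hG : nrm (- T) 0 G <= 2 / T * N.
  move: gE; rewrite nrmZ; last exact: LG.
  by rewrite (gtr0_norm T0) mulrC -ler_pdivlMr // => /le_trans; apply; rewrite mulrAC.
split => //.
have mid : measurable_fun `]- T, 0[ (fun t : R => t) by [].
have bt t : - T < t < 0 -> `|t| <= T.
  by move=> /andP[h1 h2]; rewrite ler_norml; lra.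
have [LtG NtG] := nrm_mul_bounded (ltW T0) mid bt (LG _ _ NT0).
have -> : nrm (- T) 0 H = nrm (- T) 0 (fun t => f t - t * G t).
  by apply: eq_nrm => t _; rewrite /f addrK.
apply: (le_trans (nrmB _ _)) => //; first exact: Lf.
have h : T * nrm (- T) 0 G <= 2 * N.
  have -> : 2 * N = T * (2 / T * N) by field; rewrite gt_eqF.
  by rewrite ler_wpM2l // ltW.
lra.
Qed.

Lemma sum_inv_sq_tail (N M : nat) : (0 < N)%N ->
  \sum_(n < M) (if (n < N)%N then 0 else (n.+1%:R : R)^-1) ^+ 2 <= N%:R^-1.
Proof.
move=> N0; have NR : 0 < N%:R :> R by rewrite ltr0n.
suff h : forall M : nat, (N <= M)%N ->
    \sum_(n < M) (if (n < N)%N then 0 else (n.+1%:R : R)^-1) ^+ 2 <= N%:R^-1 - M%:R^-1.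
  have [NM|MN] := leqP N M.
    by apply: le_trans (h _ NM) _; rewrite gerBl invr_ge0.
  rewrite big1 ?invr_ge0 // => n _.
  by rewrite (ltn_trans (ltn_ord n) MN) expr0n.
elim=> [|m ih]; first by rewrite leqn0 => /eqP E; rewrite E in N0.
rewrite leq_eqVlt => /predU1P[E|].
  rewrite E subrr big1 // => n _; rewrite ltn_ord.
  by rewrite expr0n.
rewrite ltnS => Nm; rewrite big_ord_recr /= ltnNge Nm /=.
have m0 : 0 < m%:R :> R by rewrite ltr0n (leq_trans N0).
have mS : 0 < m.+1%:R :> R by rewrite ltr0n.
apply: le_trans (lerD (ih Nm) (lexx _)) _.
suff : (m.+1%:R : R)^-1 ^+ 2 <= m%:R^-1 - m.+1%:R^-1.
  by move: (m.+1%:R^-1) (m%:R^-1) (N%:R^-1) => u v z; lra.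
have -> : m%:R^-1 - m.+1%:R^-1 = (m%:R * m.+1%:R)^-1 :> R.
  by rewrite -addn1 natrD; field; rewrite -natr1 in mS; rewrite !gt_eqF.
rewrite expr2 -invfM lef_pV2 ?posrE ?mulr_gt0 // ler_wpM2r ?ler_nat //.
Qed.

End ClosePairs.

(** * Observability of the modes *)

Section HighFrequencies.
Variable R : realType.
Variables (vp : R) (k0 : nat).
Hypothesis vp0 : 0 < vp.
Hypothesis k00 : (0 < k0)%N.
Implicit Types (t x y : R) (n m N M : nat) (p q : nat -> R).

Local Notation T0 := (2 * pi / vp).
Local Notation hgap := (half_gap vp k0).
Local Notation wnum := (wave_num vp).
Local Notation exc := (excess vp k0).
Local Notation ngap := (near_gap vp k0).
Local Notation frq := (freq vp k0).

Definition limit_freq n : R := wnum n + hgap.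

Lemma limit_freqB n m : limit_freq n - limit_freq m = (n%:R - m%:R) * vp.
Proof. by rewrite /limit_freq /wave_num -!natr1; ring. Qed.

Lemma limit_freqD n m : limit_freq n + limit_freq m = (n + m + (k0 + 2))%:R * vp.
Proof.
by rewrite /limit_freq /wave_num /half_gap !natrD -!natr1; field.
Qed.

Lemma freq_upper n : frq (n, true) = limit_freq n + exc n.
Proof. by rewrite /freq /excess /limit_freq /=; ring. Qed.

Lemma freq_lower_shift n : frq ((n + k0)%N, false) = limit_freq n + exc (n + k0).
Proof.
by rewrite /freq /excess /limit_freq /= wave_numD /half_gap; field.
Qed.

Lemma sin_natpi n : sin (n%:R * pi) = 0 :> R.
Proof.
elim: n => [|n ih]; first by rewrite mul0r sin0.
by rewrite -addn1 natrD mulrDl mul1r sinDpi ih oppr0.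
Qed.

Lemma cos_natpi_sq n : cos (n%:R * pi) ^+ 2 = 1 :> R.
Proof. by have := cos2Dsin2 (n%:R * pi : R); rewrite sin_natpi expr0n addr0. Qed.

(** The limit frequencies are the multiples of [vp] shifted by [hgap], so
    one period multiplies all of them by the same sign. *)
Lemma limit_freq_shift n t :
  cos (limit_freq n * (t + T0)) = cos (k0%:R * pi) * cos (limit_freq n * t) /\
  sin (limit_freq n * (t + T0)) = cos (k0%:R * pi) * sin (limit_freq n * t).
Proof.
have -> : limit_freq n * (t + T0) =
    limit_freq n * t + n.+1%:R * (2 * pi) + k0%:R * pi.
  by rewrite /limit_freq /wave_num /half_gap; field; rewrite gt_eqF.
rewrite cosD [sin (_ + _ + k0%:R * pi)]sinD sin_natpi !mulr0 subr0 addr0.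
by rewrite cosD sinD sin_nat2pi cos_nat2pi !mulr0 !mulr1 subr0 addr0 !(mulrC (cos (k0%:R * pi))).
Qed.

Lemma continuous_sum_ord (M : nat) (F : nat -> R -> R) :
  (forall n, continuous (F n)) -> continuous (fun t => \sum_(n < M) F n t).
Proof.
move=> cF; elim: M => [|M ih].
  rewrite (_ : (fun t => _) = fun=> 0); first by move=> t; exact: cvg_cst.
  by apply/funext => t; rewrite big_ord0.
rewrite (_ : (fun t => _) = fun t => \sum_(n < M) F n t + F M t).
  by move=> t; apply: cvgD; [exact: ih|exact: cF].
by apply/funext => t; rewrite big_ord_recr.
Qed.

Definition one_mode p q n t : R := p n * cos (limit_freq n * t) + q n * sin (limit_freq n * t).

Lemma continuous_one_mode p q n : continuous (one_mode p q n).
Proof.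
move=> t; apply: cvgD; apply: cvgM; try exact: cvg_cst.
  exact: continuous_cosM.
exact: continuous_sinM.
Qed.

Lemma one_mode_shift p q n t : one_mode p q n (t + T0) = cos (k0%:R * pi) * one_mode p q n t.
Proof.
by rewrite /one_mode; have [-> ->] := limit_freq_shift n t; ring.
Qed.

Lemma limit_pairs_lower : exists2 C : R, 0 < C & forall M (D D' E E' : nat -> R),
  \sum_(n < M) (D n ^+ 2 + D' n ^+ 2 + (E n ^+ 2 + E' n ^+ 2)) <=
  C * nrm (- T0) T0 (fun t => \sum_(n < M) one_mode D D' n t +
                       t * \sum_(n < M) one_mode E E' n t) ^+ 2.
Proof.
have T00 := period_gt0 vp0.
pose C := 2 / T0 * (9 + (2 / T0) ^+ 2).
have T2 : 0 < 2 / T0 by rewrite divr_gt0.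
exists C; first by rewrite mulr_gt0 // ltr_wpDr ?sqr_ge0.
move=> M D D' E E'.
set H := fun t => \sum_(n < M) one_mode D D' n t.
set G := fun t => \sum_(n < M) one_mode E E' n t.
have cH : continuous H by apply: continuous_sum_ord => n; exact: continuous_one_mode.
have cG : continuous G by apply: continuous_sum_ord => n; exact: continuous_one_mode.
have [||hG hH] := @affine_periodic_lower _ T0 (cos (k0%:R * pi)) H G T00 (cos_natpi_sq k0) cH cG.
- by move=> t; rewrite /H mulr_sumr; apply: eq_bigr => n _; exact: one_mode_shift.
- by move=> t; rewrite /G mulr_sumr; apply: eq_bigr => n _; exact: one_mode_shift.
move: hG hH; set N := nrm (- T0) T0 _ => hG hH.
have N0 : 0 <= N by exact: nrm_ge0.
have k2 : (0 < k0 + 2)%N by rewrite addn2.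
have PH := nrm_trig_parseval vp0 limit_freqB limit_freqD k2 (- T0) M D D'.
have PG := nrm_trig_parseval vp0 limit_freqB limit_freqD k2 (- T0) M E E'.
rewrite mul1r addNr in PH PG.
rewrite -/H in PH; rewrite -/G in PG.
have {hG} : nrm (- T0) 0 G ^+ 2 <= (2 / T0 * N) ^+ 2.
  by rewrite ler_pXn2r ?nnegrE ?nrm_ge0 // mulr_ge0 // ltW.
have {hH} : nrm (- T0) 0 H ^+ 2 <= (3 * N) ^+ 2.
  by rewrite ler_pXn2r ?nnegrE ?nrm_ge0 // mulr_ge0.
rewrite PH PG => h1 h2; rewrite [leLHS]big_split /=.
move: h1 h2; set A := \sum_(n < M) _; set B := \sum_(n < M) _ => h1 h2.
have -> : C * N ^+ 2 = 2 / T0 * ((3 * N) ^+ 2 + (2 / T0 * N) ^+ 2) by rewrite /C; ring.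
have dT (x y z : R) : 0 < x -> y + z = 2 / x * (x / 2 * y + x / 2 * z).
  by move=> x0; field; rewrite gt_eqF.
rewrite (dT T0) //.
by rewrite ler_wpM2l ?lerD // ltW.
Qed.

Definition pair_sum p q p' q' n t : R :=
  p n * cos (frq (n, true) * t) + q n * sin (frq (n, true) * t) +
  (p' n * cos (frq ((n + k0)%N, false) * t) + q' n * sin (frq ((n + k0)%N, false) * t)).

(** Beyond a high enough cut-off, the first-order model of the close pairs is a
    small perturbation: the frequency errors are square-summable, so the error is
    bounded pointwise by the Cauchy-Schwarz inequality. *)
Lemma pairs_lower : exists N, exists2 C : R, 0 < C & forall M p q p' q',
  (forall n, (n < N)%N -> [/\ p n = 0, q n = 0, p' n = 0 & q' n = 0]) ->
  \sum_(n < M) ((p n + p' n) ^+ 2 + (q n + q' n) ^+ 2 +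
     ((ngap n * q n) ^+ 2 + (- (ngap n * p n)) ^+ 2)) <=
  C * nrm (- T0) T0 (fun t => \sum_(n < M) pair_sum p q p' q' n t) ^+ 2.
Proof.
have T00 := period_gt0 vp0.
have NT : - T0 < T0 by rewrite gtrN.
have [C1 C10 HC1] := limit_pairs_lower.
pose K1 := hgap ^+ 2 / vp * (3 * T0 ^+ 2 + T0).
have K10 : 0 <= K1.
  apply: mulr_ge0; first by apply: divr_ge0; [exact: sqr_ge0|exact: ltW].
  by apply: addr_ge0; [apply: mulr_ge0 => //; exact: sqr_ge0|exact: ltW].
pose K2 := 4 * K1 * Num.sqrt (2 * T0).
have K20 : 0 <= K2 by apply: mulr_ge0; [exact: mulr_ge0|exact: sqrtr_ge0].
pose N := (Num.bound (4 * C1 * K2 ^+ 2)).+1.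
have HN : 4 * C1 * K2 ^+ 2 / N%:R <= 1.
  rewrite ler_pdivrMr ?ltr0n // mul1r ltW //.
  have h : 0 <= 4 * C1 * K2 ^+ 2.
    by apply: mulr_ge0; [apply: mulr_ge0 => //; exact: ltW|exact: sqr_ge0].
  by apply: lt_le_trans (archi_boundP h) _; rewrite ler_nat leqnSn.
exists N, (4 * C1); first by rewrite mulr_gt0.
move=> M p q p' q' z.
pose D n := p n + p' n; pose D' n := q n + q' n.
pose E n := ngap n * q n; pose E' n := - (ngap n * p n).
set S := \sum_(n < M) _; set F := fun t => \sum_(n < M) pair_sum p q p' q' n t.
pose F0 t := \sum_(n < M) one_mode D D' n t + t * \sum_(n < M) one_mode E E' n t.
have S0 : 0 <= S by apply: sumr_ge0 => n _; rewrite !addr_ge0 ?sqr_ge0.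
have cF : continuous F.
  apply: continuous_sum_ord => n t; rewrite /pair_sum.
  by apply: cvgD; apply: cvgD; apply: cvgM; first [exact: cvg_cst|exact: continuous_cosM|exact: continuous_sinM].
have cF0 : continuous F0.
  move=> t; apply: cvgD.
    by apply: continuous_sum_ord => n; exact: continuous_one_mode.
  apply: cvgM; first exact: cvg_id.
  by apply: continuous_sum_ord => n; exact: continuous_one_mode.
have LF : L2r (- T0) T0 F by exact: continuous_L2r.
have LF0 : L2r (- T0) T0 F0 by exact: continuous_L2r.
pose g n := if (n < N)%N then 0 else (n.+1%:R : R)^-1.
have gN : \sum_(n < M) g n ^+ 2 <= N%:R^-1 by exact: sum_inv_sq_tail.
have l1 (X : nat -> R) : (forall n, X n ^+ 2 <= D n ^+ 2 + D' n ^+ 2 + (E n ^+ 2 + E' n ^+ 2)) ->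
    \sum_(n < M) `|X n| * `|g n| <= Num.sqrt S * Num.sqrt N%:R^-1.
  by move=> HX; apply: sum_norm_le => //; apply: ler_sum => n _; exact: HX.
have err t : - T0 < t < T0 -> `|F t - F0 t| <= 4 * K1 * (Num.sqrt S * Num.sqrt N%:R^-1).
  move=> /andP[t1 t2].
  have -> : F t - F0 t = \sum_(n < M) (pair_sum p q p' q' n t -
      (D n * cos (limit_freq n * t) + D' n * sin (limit_freq n * t) +
       t * (E n * cos (limit_freq n * t) + E' n * sin (limit_freq n * t)))).
    by rewrite /F /F0 mulr_sumr -big_split -sumrB.
  apply: le_trans (ler_norm_sum _ _ _) _.
  apply: (@le_trans _ _ (\sum_(n < M) K1 *
    (`|D n| * `|g n| + `|D' n| * `|g n| + `|E' n| * `|g n| + `|E n| * `|g n|))).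
    apply: ler_sum => n _.
    have [nN|Nn] := ltnP n N.
      have [z1 z2 z3 z4] := z n nN.
      rewrite /pair_sum /D /D' /E /E' z1 z2 z3 z4 /g nN normr0.
      by rewrite !(mulr0, mul0r, addr0, oppr0, subr0, normr0).
    rewrite /pair_sum freq_upper freq_lower_shift.
    have /andP[e0 eK] := excess_bound vp0 k00 n.
    have /andP[f0 fK] := excess_bound vp0 k00 (n + k0).
    have [c c0 Hc] := near_gap_lower vp0 k00.
    have gap0 : 0 <= ngap n.
      by apply: le_trans (Hc n); rewrite divr_ge0 ?exprn_ge0 // ltW.
    have e21 : exc (n + k0) <= exc n by move: gap0; rewrite /near_gap subr_ge0.
    have tT : `|t| <= T0 by rewrite ler_norml; apply/andP; split; exact: ltW.
    have := @close_pair R (limit_freq n) (exc n) (exc (n + k0))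
      (hgap ^+ 2 / vp / n.+1%:R) T0 t (p n) (q n) (p' n) (q' n)
      (ltW f0) e21 eK (ltW T00) tT.
    rewrite -/(D n) -/(D' n) -/(ngap n) -/(E n) -/(E' n) => /le_trans; apply.
    have -> : `|ngap n * p n| = `|E' n| by rewrite normrN.
    have -> : `|g n| = n.+1%:R^-1 by rewrite /g ltnNge Nn /= ger0_norm // invr_ge0.
    rewrite /K1 le_eqVlt; apply/orP; left; apply/eqP; ring.
  rewrite -mulr_sumr !big_split /=.
  have := l1 D; have := l1 D'; have := l1 E'; have := l1 E.
  have pos n : [/\ 0 <= D n ^+ 2, 0 <= D' n ^+ 2, 0 <= E n ^+ 2 & 0 <= E' n ^+ 2].
    by rewrite !sqr_ge0.
  move=> h1 h2 h3 h4.
  have {}h1 := h1 (fun n => _); have {}h2 := h2 (fun n => _).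
  have {}h3 := h3 (fun n => _); have {}h4 := h4 (fun n => _).
  have -> : 4 * K1 * (Num.sqrt S * Num.sqrt N%:R^-1) = K1 * (4 * (Num.sqrt S * Num.sqrt N%:R^-1)) by ring.
  rewrite ler_wpM2l //.
  have k1 : forall n, E n ^+ 2 <= D n ^+ 2 + D' n ^+ 2 + (E n ^+ 2 + E' n ^+ 2).
    by move=> n; have [? ? ? ?] := pos n; lra.
  have k2 : forall n, E' n ^+ 2 <= D n ^+ 2 + D' n ^+ 2 + (E n ^+ 2 + E' n ^+ 2).
    by move=> n; have [? ? ? ?] := pos n; lra.
  have k3 : forall n, D' n ^+ 2 <= D n ^+ 2 + D' n ^+ 2 + (E n ^+ 2 + E' n ^+ 2).
    by move=> n; have [? ? ? ?] := pos n; lra.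
  have k4 : forall n, D n ^+ 2 <= D n ^+ 2 + D' n ^+ 2 + (E n ^+ 2 + E' n ^+ 2).
    by move=> n; have [? ? ? ?] := pos n; lra.
  have := l1 _ k1; have := l1 _ k2; have := l1 _ k3; have := l1 _ k4; lra.
have errN : nrm (- T0) T0 (fun t => F t - F0 t) <= K2 * (Num.sqrt S * Num.sqrt N%:R^-1).
  have c0 : 0 <= 4 * K1 * (Num.sqrt S * Num.sqrt N%:R^-1).
    by apply: mulr_ge0; apply: mulr_ge0; rewrite ?sqrtr_ge0.
  apply: le_trans (nrm_bounded (ltW NT) c0 (L2rB LF LF0) err) _.
  have -> : T0 - - T0 = 2 * T0 by ring.
  by rewrite /K2 le_eqVlt; apply/orP; left; apply/eqP; ring.
have F0N : nrm (- T0) T0 F0 <= nrm (- T0) T0 F + K2 * (Num.sqrt S * Num.sqrt N%:R^-1).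
  apply: le_trans (lerD (lexx _) errN).
  have := nrmB LF (L2rB LF LF0); apply: le_trans.
  rewrite le_eqVlt; apply/orP; left; apply/eqP/eq_nrm => t _; ring.
have hS := HC1 M D D' E E'; rewrite -/F0 -/S in hS.
have h : nrm (- T0) T0 F0 ^+ 2 <= 2 * nrm (- T0) T0 F ^+ 2 + 2 * (K2 ^+ 2 * S / N%:R).
  have h0 : nrm (- T0) T0 F0 ^+ 2 <= (nrm (- T0) T0 F + K2 * (Num.sqrt S * Num.sqrt N%:R^-1)) ^+ 2.
    rewrite ler_pXn2r ?nnegrE ?nrm_ge0 // addr_ge0 ?nrm_ge0 //.
    by apply: mulr_ge0 => //; apply: mulr_ge0; rewrite sqrtr_ge0.
  have -> : K2 ^+ 2 * S / N%:R = (K2 * (Num.sqrt S * Num.sqrt N%:R^-1)) ^+ 2.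
    have sq (x y v : R) : (x * (y * v)) ^+ 2 = x ^+ 2 * (y ^+ 2 * v ^+ 2) by ring.
    by rewrite sq !sqr_sqrtr ?invr_ge0 ?ler0n // mulrA.
  by apply: le_trans h0 _; have := sqr_ge0 (nrm (- T0) T0 F - K2 * (Num.sqrt S * Num.sqrt N%:R^-1)); lra.
have h' : C1 * nrm (- T0) T0 F0 ^+ 2 <=
    2 * C1 * nrm (- T0) T0 F ^+ 2 + S / 2.
  have : C1 * nrm (- T0) T0 F0 ^+ 2 <= C1 * (2 * nrm (- T0) T0 F ^+ 2 + 2 * (K2 ^+ 2 * S / N%:R)).
    by rewrite ler_wpM2l // ltW.
  have : 4 * C1 * K2 ^+ 2 / N%:R * S <= 1 * S by rewrite ler_wpM2r.
  have -> : 4 * C1 * K2 ^+ 2 / N%:R * S = 4 * C1 * (K2 ^+ 2 * S / N%:R) by ring.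
  move: (K2 ^+ 2 * S / N%:R) (nrm _ _ F0) (nrm _ _ F) => u v z'; lra.
move: hS h'; move: (nrm _ _ F0) (nrm _ _ F) => u v; lra.
Qed.

Lemma sum_mask (I : eqType) (r l : seq I) (F : I -> R) : uniq r -> uniq l ->
  {subset r <= l} -> \sum_(i <- r) F i = \sum_(i <- l) (if i \in r then F i else 0).
Proof.
move=> ur ul rl; transitivity (\sum_(i <- [seq i <- l | i \in r]) F i); last first.
  by rewrite big_filter big_mkcond.
apply: perm_big.
apply: uniq_perm => //; first exact: filter_uniq.
by move=> i; rewrite mem_filter; case: (boolP (i \in r)) => // /rl ->.
Qed.

(** The shift of the cut-off on the lower branch keeps the two members of each
    close pair together. *)
Definition high_modes N (i : nat * bool) : bool :=
  if i.2 then (N <= i.1)%N else (N + k0 <= i.1)%N.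

Definition pair_seq M : seq (nat * bool) :=
  [seq (n, true) | n <- iota 0 M] ++ [seq ((n + k0)%N, false) | n <- iota 0 M].

Lemma uniq_pair_seq M : uniq (pair_seq M).
Proof.
rewrite cat_uniq !map_inj_uniq ?iota_uniq ?andbT //=.
- by apply/hasPn => _ /mapP[n _ ->]; apply/negP => /mapP[].
- by move=> n m [] /addIn.
- by move=> n m [].
Qed.

Lemma sub_pair_seq N r : {in r, forall i, high_modes N i} ->
  {subset r <= pair_seq (\max_(i <- r) i.1).+1}.
Proof.
move=> rS [n b] ri; rewrite mem_cat; have := rS _ ri.
have nM : (n <= \max_(i <- r) i.1)%N.
  by apply: (@leq_bigmax_seq _ r xpredT (fun i : nat * bool => i.1) (n, b)).
case: b ri => ri; rewrite /high_modes => h; apply/orP.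
  by left; apply/mapP; exists n => //; rewrite mem_iota ltnS.
have kn : (k0 <= n)%N by apply: leq_trans h; exact: leq_addl.
right; apply/mapP; exists (n - k0)%N; last by rewrite subnK.
by rewrite mem_iota add0n ltnS (leq_trans (leq_subr _ _)).
Qed.

Lemma sum_pair_seq M (F : nat * bool -> R) :
  \sum_(i <- pair_seq M) F i = \sum_(n < M) (F (n : nat, true) + F ((n + k0)%N, false)).
Proof.
rewrite big_cat !big_map big_split /= -!(big_mkord xpredT (fun n => F (n, true))).
rewrite -(big_mkord xpredT (fun n => F ((n + k0)%N, false))).
by rewrite /index_iota !subn0.
Qed.

(** A pair controls the sum of its two coefficients, and one of them
    multiplied by the gap. The gap is of order [1/n^2]: hence the weight
    [1/n^4] on the squares. *)
Lemma high_observable : exists N, observable frq (@freq_weight R) (high_modes N) T0.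
Proof.
have T00 := period_gt0 vp0.
have [N [C C0 HC]] := pairs_lower.
have [c c0 Hc] := near_gap_lower vp0 k00.
exists N => L TL; pose C' := 2 + 3 / c ^+ 2.
have C'0 : 0 < C' by rewrite addr_gt0 // divr_gt0 // exprn_gt0.
exists (C' * C) => [|r P Q ur rS]; first by rewrite mulr_gt0.
have rl := sub_pair_seq rS; set M := (\max_(i <- r) i.1).+1 in rl.
have ul := uniq_pair_seq M.
pose mk (X : nat * bool -> R) i := if i \in r then X i else 0.
pose p n := mk P (n, true); pose q n := mk Q (n, true).
pose p' n := mk P ((n + k0)%N, false); pose q' n := mk Q ((n + k0)%N, false).
have z n : (n < N)%N -> [/\ p n = 0, q n = 0, p' n = 0 & q' n = 0].
  move=> nN; have h1 : (n, true) \notin r.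
    by apply/negP => /rS; rewrite /high_modes /= leqNgt nN.
  have h2 : ((n + k0)%N, false) \notin r.
    by apply/negP => /rS; rewrite /high_modes /= leq_add2r leqNgt nN.
  by rewrite /p /q /p' /q' /mk (negPf h1) (negPf h2).
have fE t : trig_sum frq r P Q t = \sum_(n < M) pair_sum p q p' q' n t.
  rewrite /trig_sum (sum_mask _ ur ul rl) sum_pair_seq; apply: eq_bigr => n _.
  rewrite /pair_sum /p /q /p' /q' /mk.
  by congr (_ + _); case: ifP => _ //; rewrite !mul0r addr0.
have NN : nrm (- T0) T0 (fun t => \sum_(n < M) pair_sum p q p' q' n t) <=
    nrm (- L) L (trig_sum frq r P Q).
  rewrite (@eq_nrm _ _ _ _ (trig_sum frq r P Q)); last by move=> t _; rewrite fE.
  apply: nrmS; [by rewrite lerN2 ltW|exact: ltW|exact: L2r_trig_sum].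
have h := HC M p q p' q' z.
apply: (@le_trans _ _ (C' * (C * nrm (- T0) T0 (fun t => \sum_(n < M) pair_sum p q p' q' n t) ^+ 2))); last first.
  rewrite -[leRHS]mulrA ler_wpM2l ?(ltW C'0) // ler_wpM2l ?(ltW C0) //.
  by rewrite ler_pXn2r ?nnegrE ?nrm_ge0.
apply: le_trans (ler_wpM2l (ltW C'0) h).
rewrite /coef_sq (sum_mask _ ur ul rl) sum_pair_seq mulr_sumr; apply: ler_sum => n _.
have -> : (if (n : nat, true) \in r then freq_weight R (n : nat, true) *
    (P (n : nat, true) ^+ 2 + Q (n : nat, true) ^+ 2) else 0) =
    freq_weight R (n : nat, true) * (p n ^+ 2 + q n ^+ 2).
  by rewrite /p /q /mk; case: ifP => _ //; rewrite !expr0n addr0 mulr0.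
have -> : (if ((n + k0)%N, false) \in r then freq_weight R ((n + k0)%N, false) *
    (P ((n + k0)%N, false) ^+ 2 + Q ((n + k0)%N, false) ^+ 2) else 0) =
    freq_weight R ((n + k0)%N, false) * (p' n ^+ 2 + q' n ^+ 2).
  by rewrite /p' /q' /mk; case: ifP => _ //; rewrite !expr0n addr0 mulr0.
have n0 : 0 < n.+1%:R :> R by rewrite ltr0n.
have w1 : freq_weight R (n : nat, true) <= ngap n ^+ 2 / c ^+ 2.
  rewrite /freq_weight /= ler_pdivlMr ?exprn_gt0 //.
  have -> : (n.+1%:R ^+ 4)^-1 * c ^+ 2 = (c / n.+1%:R ^+ 2) ^+ 2 :> R.
    by field; rewrite gt_eqF.
  have cn : 0 <= c / n.+1%:R ^+ 2 by rewrite divr_ge0 ?exprn_ge0 ?ltW.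
  by rewrite ler_pXn2r ?nnegrE // (le_trans cn).
have w2 : freq_weight R ((n + k0)%N, false) <= freq_weight R (n : nat, true).
  rewrite /freq_weight /= lef_pV2 ?posrE ?exprn_gt0 ?ltr0n //.
  by rewrite ler_pXn2r ?nnegrE // ler_nat ltnS leq_addr.
have w3 : freq_weight R ((n + k0)%N, false) <= 1.
  rewrite /freq_weight /= invf_le1 ?exprn_gt0 ?ltr0n //.
  by rewrite exprn_ege1 // ler1n.
have w4 : 0 <= freq_weight R ((n + k0)%N, false) by rewrite invr_ge0 exprn_ge0.
have w5 : 0 <= freq_weight R (n : nat, true) by rewrite invr_ge0 exprn_ge0.
rewrite sqrrN !exprMn -[_ * q n ^+ 2 + _]mulrDr.
move: (p n) (q n) (p' n) (q' n) w1 w2 w3 w4 w5 => {z h NN fE}a b a' b'.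
move: (freq_weight R (n : nat, true)) (freq_weight R ((n + k0)%N, false)) => u v w1 w2 w3 w4 w5.
have s0 : 0 <= a ^+ 2 + b ^+ 2 by rewrite addr_ge0 ?sqr_ge0.
have d0 : 0 <= (a + a') ^+ 2 + (b + b') ^+ 2 by rewrite addr_ge0 ?sqr_ge0.
have g0 : 0 <= ngap n ^+ 2 * (a ^+ 2 + b ^+ 2) by rewrite mulr_ge0 ?sqr_ge0.
have e1 : u * (a ^+ 2 + b ^+ 2) <= ngap n ^+ 2 / c ^+ 2 * (a ^+ 2 + b ^+ 2).
  by rewrite ler_wpM2r.
have e2 : v * (a ^+ 2 + b ^+ 2) <= u * (a ^+ 2 + b ^+ 2) by rewrite ler_wpM2r.
have e3 : v * ((a + a') ^+ 2 + (b + b') ^+ 2) <= (a + a') ^+ 2 + (b + b') ^+ 2.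
  by rewrite ler_piMl.
have e4 : v * (a' ^+ 2 + b' ^+ 2) <= v * (2 * ((a + a') ^+ 2 + (b + b') ^+ 2) + 2 * (a ^+ 2 + b ^+ 2)).
  rewrite ler_wpM2l //; have := sqr_ge0 (2 * a + a'); have := sqr_ge0 (2 * b + b'); nra.
have c2 : 0 <= 3 / c ^+ 2 * ((a + a') ^+ 2 + (b + b') ^+ 2).
  by rewrite mulr_ge0 // divr_ge0 ?sqr_ge0.
rewrite [b ^+ 2 + _]addrC.
have -> : C' * ((a + a') ^+ 2 + (b + b') ^+ 2 + ngap n ^+ 2 * (a ^+ 2 + b ^+ 2)) =
  2 * ((a + a') ^+ 2 + (b + b') ^+ 2) + 3 / c ^+ 2 * ((a + a') ^+ 2 + (b + b') ^+ 2) +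
  2 * (ngap n ^+ 2 * (a ^+ 2 + b ^+ 2)) +
  3 * (ngap n ^+ 2 / c ^+ 2 * (a ^+ 2 + b ^+ 2)) by rewrite /C'; ring.
set x1 := ngap n ^+ 2 / c ^+ 2 * _ in e1 *; set x2 := 3 / c ^+ 2 * _ in c2 *.
set x3 := ngap n ^+ 2 * _ in g0 *; move: x1 x2 x3 e1 c2 g0 => x1 x2 x3 e1 c2 g0.
lra.
Qed.

(** Only finitely many modes lie below the cut-off, and they are added one by one. *)
Lemma freq_observable : injective frq ->
  observable frq (@freq_weight R) xpredT T0.
Proof.
move=> inj; have [N HN] := high_observable.
have [c c0 Hc] := freq_lower vp0 k00.
have f0 i : 0 < frq i by exact: freq_gt0.
have w0 i : 0 < freq_weight R i by rewrite invr_gt0 exprn_gt0 // ltr0n.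
pose low M : seq (nat * bool) := [seq (n, true) | n <- iota 0 M] ++ [seq (n, false) | n <- iota 0 M].
have lowP M (i : nat * bool) : (i.1 < M)%N -> i \in low M.
  case: i => n b /= nM; rewrite mem_cat; apply/orP.
  by case: b; [left|right]; apply/mapP; exists n; rewrite // mem_iota.
have fin (M : R) : exists l : seq (nat * bool), forall i, frq i <= M -> i \in l.
  exists (low (Num.bound (`|M| / c))) => i iM; apply: lowP.
  have h : i.1.+1%:R <= `|M| / c.
    rewrite ler_pdivlMr // mulrC; apply: le_trans (Hc i) _.
    exact: le_trans iM (ler_norm _).
  have := le_lt_trans h (archi_boundP (divr_ge0 (normr_ge0 M) (ltW c0))).
  by rewrite ltr_nat => /ltnW.
have summ : exists K : R, forall r, uniq r ->
    \sum_(i <- r) (freq_weight R i)^-1 * (frq i)^-1 ^+ 6 <= K.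
  exists (c^-1 ^+ 6 * (2 * 2)) => r ur.
  have [M rl] : exists M, {subset r <= low M}.
    exists (\max_(i <- r) i.1).+1 => i ri; apply: lowP; rewrite ltnS.
    by apply: (@leq_bigmax_seq _ r xpredT (fun i : nat * bool => i.1) i).
  have ul : uniq (low M).
    rewrite cat_uniq !map_inj_uniq ?iota_uniq ?andbT //=; try by move=> ? ? [].
    by apply/hasPn => _ /mapP[n _ ->]; apply/negP => /mapP[].
  have bnd i : (freq_weight R i)^-1 * (frq i)^-1 ^+ 6 <= c^-1 ^+ 6 * (i.1.+1%:R)^-1 ^+ 2.
    have n0 : 0 < i.1.+1%:R :> R by rewrite ltr0n.
    have h : (frq i)^-1 <= (c * i.1.+1%:R)^-1 by rewrite lef_pV2 ?posrE // mulr_gt0.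
    have h6 : (frq i)^-1 ^+ 6 <= (c * i.1.+1%:R)^-1 ^+ 6.
      by rewrite ler_pXn2r ?nnegrE ?invr_ge0 // ?ltW // mulr_gt0.
    apply: le_trans (ler_wpM2l _ h6) _; first by rewrite invr_ge0 ltW.
    rewrite /freq_weight invrK le_eqVlt; apply/orP; left; apply/eqP.
    by field; rewrite !gt_eqF.
  rewrite (sum_mask _ ur ul rl).
  apply: (@le_trans _ _ (\sum_(i <- low M) c^-1 ^+ 6 * (i.1.+1%:R)^-1 ^+ 2)).
    apply: ler_sum => i _; case: ifP => _ //.
    by rewrite mulr_ge0 // exprn_ge0 // invr_ge0 // ltW.
  rewrite -mulr_sumr ler_wpM2l ?exprn_ge0 ?invr_ge0 ?(ltW c0) //.
  have h2 : \sum_(n <- iota 0 M) (n.+1%:R : R)^-1 ^+ 2 <= 2.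
    rewrite -[M in iota 0 M]subn0 -/(index_iota 0 M) big_mkord.
    case: M {rl ul} => [|M]; first by rewrite big_ord0.
    have := @sum_inv_sq_tail R 1 M.+1 isT.
    rewrite !big_ord_recl /= !invr1 expr0n expr1n add0r => h.
    by rewrite -[X in _ <= X]/(1 + 1 : R) lerD2l.
  by rewrite big_cat !big_map /=; lra.
have T00 := period_gt0 vp0.
have := observable_adds w0 f0 fin summ (low (N + k0)) (ltW T00) inj HN.
move=> obs L TL; have [C C0 HC] := obs L TL; exists C => // r P Q ur _.
apply: HC => // i _; have [h|h] := ltnP i.1 (N + k0); first by rewrite lowP.
apply/orP; right; rewrite /high_modes; case: ifP => _ //.
by apply: leq_trans h; exact: leq_addr.
Qed.

End HighFrequencies.

(** * Series of modes *)

Section ModeSeries.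
Variable R : realType.
Variables (vp : R) (k0 : nat) (T : R).
Hypothesis vp0 : 0 < vp.
Hypothesis k00 : (0 < k0)%N.
Hypothesis T_gt0 : 0 < T.
Implicit Types (t x y : R) (n N M : nat) (P Q : nat * bool -> R).

Local Notation T0 := (2 * pi / vp).
Local Notation frq := (freq vp k0).

Definition mode P Q (i : nat * bool) t : R :=
  P i * cos (frq i * t) + Q i * sin (frq i * t).

Definition mode_sum P Q N t : R :=
  \sum_(n < N) (mode P Q (n : nat, true) t + mode P Q (n : nat, false) t).

Definition amp_sq P Q (i : nat * bool) : R := P i ^+ 2 + Q i ^+ 2.

Definition energy_sum P Q N : R :=
  \sum_(n < N) (amp_sq P Q (n : nat, true) + amp_sq P Q (n : nat, false)).

Definition weak_sum P Q N : R :=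
  \sum_(n < N) (n.+1%:R ^+ 4)^-1 * (amp_sq P Q (n : nat, true) + amp_sq P Q (n : nat, false)).

Definition mode_seq N : seq (nat * bool) :=
  [seq (n, true) | n <- iota 0 N] ++ [seq (n, false) | n <- iota 0 N].

Lemma sum_mode_seq N (F : nat * bool -> R) :
  \sum_(i <- mode_seq N) F i = \sum_(n < N) (F (n : nat, true) + F (n : nat, false)).
Proof.
rewrite big_cat !big_map big_split /= -!(big_mkord xpredT (fun n => F (n, _))).
by rewrite /index_iota !subn0.
Qed.

Lemma uniq_mode_seq N : uniq (mode_seq N).
Proof.
rewrite cat_uniq !map_inj_uniq ?iota_uniq ?andbT //; try by move=> ? ? [].
by apply/hasPn => _ /mapP[n _ ->]; apply/negP => /mapP[].
Qed.

Lemma mode_sumE P Q N : mode_sum P Q N = trig_sum frq (mode_seq N) P Q.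
Proof. by apply/funext => t; rewrite /trig_sum sum_mode_seq. Qed.

Lemma L2r_mode_sum a b P Q N : L2r a b (mode_sum P Q N).
Proof. by rewrite mode_sumE; exact: L2r_trig_sum. Qed.

Lemma mode_sumB P Q P' Q' N t : mode_sum P Q N t - mode_sum P' Q' N t =
  mode_sum (fun i => P i - P' i) (fun i => Q i - Q' i) N t.
Proof. by rewrite !mode_sumE trig_sumB. Qed.

Lemma energy_sum_nd P Q N M : (N <= M)%N -> energy_sum P Q N <= energy_sum P Q M.
Proof.
move=> /subnK <-; elim: (M - N)%N => // m ih; rewrite addSn.
by apply: le_trans ih _; rewrite /energy_sum big_ord_recr /= lerDl !addr_ge0 ?sqr_ge0.
Qed.

(** Each branch is a square-summable perturbation of an arithmetic progression of
    frequencies, for which the upper bound is the Gram identity over periods. *)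
Lemma branch_upper b : exists2 C : R, 0 < C & forall N (p q : nat -> R),
  nrm 0 T (fun t => \sum_(n < N) (p n * cos (frq (n : nat, b) * t) +
     q n * sin (frq (n : nat, b) * t))) ^+ 2 <= C * \sum_(n < N) (p n ^+ 2 + q n ^+ 2).
Proof.
have T00 := period_gt0 vp0; have T1 := ltW T_gt0.
pose h := half_gap vp k0.
pose th n := wave_num vp n + (if b then h else - h).
have thB n m : th n - th m = (n%:R - m%:R) * vp.
  by rewrite /th /wave_num -!natr1; ring.
have fth n : frq (n, b) = th n + excess vp k0 n.
  by rewrite /th /freq /excess /h /=; case: (b); ring.
pose K := (Num.bound (T / T0)).+1.
have KT : T <= K%:R * T0.
  rewrite -ler_pdivrMr //.
  have := archi_boundP (divr_ge0 T1 (ltW T00)) => h1.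
  by rewrite ltW // (lt_le_trans h1) // ler_nat leqnSn.
pose A := h ^+ 2 / vp * T.
have A0 : 0 <= A by apply: mulr_ge0 => //; apply: divr_ge0; [exact: sqr_ge0|exact: ltW].
pose C := 4 * (K%:R * T0) + 16 * A ^+ 2 * T + 1.
have KT0 : 0 <= K%:R * T0 by rewrite mulr_ge0 // ltW.
have AT : 0 <= A ^+ 2 * T by rewrite mulr_ge0 // sqr_ge0.
exists C; first by rewrite /C; move: (K%:R * T0) (A ^+ 2 * T) KT0 AT => u v *; nra.
move=> N p q; set S := \sum_(n < N) _; set F := fun t => _.
have S0 : 0 <= S by apply: sumr_ge0 => n _; rewrite addr_ge0 ?sqr_ge0.
pose G t := \sum_(n < N) (p n * cos (th n * t) + q n * sin (th n * t)).
have cG : continuous G.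
  apply: (@continuous_sum_ord _ N (fun n t => p n * cos (th n * t) + q n * sin (th n * t))) => n t.
  by apply: cvgD; apply: cvgM; first [exact: cvg_cst|exact: continuous_cosM|exact: continuous_sinM].
have cF : continuous F.
  apply: (@continuous_sum_ord _ N (fun n t => p n * cos (frq (n, b) * t) + q n * sin (frq (n, b) * t))) => n t.
  by apply: cvgD; apply: cvgM; first [exact: cvg_cst|exact: continuous_cosM|exact: continuous_sinM].
have LF : L2r 0 T F by exact: continuous_L2r.
have LG : L2r 0 T G by exact: continuous_L2r.
have GN : nrm 0 T G ^+ 2 <= 2 * (K%:R * T0) * S.
  apply: le_trans (nrm_trig_periodic vp0 thB 0 N p q (isT : (0 < K)%N)).
  rewrite add0r ler_pXn2r ?nnegrE ?nrm_ge0 // nrmS //.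
  by apply: continuous_L2r => //; exact: lt_le_trans KT.
have s2 : \sum_(n < N) ((n.+1%:R : R)^-1) ^+ 2 <= 2.
  case: N @S @F @G S0 cG cF LF LG GN => [|N] *; first by rewrite big_ord0.
  have := @sum_inv_sq_tail R 1 N.+1 isT.
  rewrite !big_ord_recl /= !invr1 expr0n expr1n add0r => hh.
  by rewrite -[X in _ <= X]/(1 + 1 : R) lerD2l.
have l1 (X : nat -> R) : (forall n, X n ^+ 2 <= p n ^+ 2 + q n ^+ 2) ->
    \sum_(n < N) `|X n| * `|(n.+1%:R : R)^-1| <= Num.sqrt S * Num.sqrt 2.
  by move=> HX; apply: sum_norm_le => //; apply: ler_sum => n _; exact: HX.
have lp := l1 p (fun n => _); have {}lp := lp (fun n => _).
have Hp : \sum_(n < N) `|p n| * `|(n.+1%:R : R)^-1| <= Num.sqrt S * Num.sqrt 2.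
  by apply: l1 => n; rewrite lerDl sqr_ge0.
have Hq : \sum_(n < N) `|q n| * `|(n.+1%:R : R)^-1| <= Num.sqrt S * Num.sqrt 2.
  by apply: l1 => n; rewrite lerDr sqr_ge0.
have c0 : 0 <= 2 * A * (Num.sqrt S * Num.sqrt 2).
  by apply: mulr_ge0; [exact: mulr_ge0|rewrite mulr_ge0 ?sqrtr_ge0].
have err t : 0 < t < T -> `|F t - G t| <= 2 * A * (Num.sqrt S * Num.sqrt 2).
  move=> /andP[t0 tT]; rewrite /F /G -sumrB; apply: le_trans (ler_norm_sum _ _ _) _.
  apply: (@le_trans _ _ (\sum_(n < N) A * (`|p n| * `|(n.+1%:R : R)^-1| + `|q n| * `|(n.+1%:R : R)^-1|))).
    apply: ler_sum => n _.
    have -> : p n * cos (frq (n : nat, b) * t) + q n * sin (frq (n : nat, b) * t) -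
        (p n * cos (th n * t) + q n * sin (th n * t)) =
        p n * (cos (frq (n : nat, b) * t) - cos (th n * t)) +
        q n * (sin (frq (n : nat, b) * t) - sin (th n * t)) by ring.
    have d : `|frq (n : nat, b) * t - th n * t| <= A * `|(n.+1%:R : R)^-1|.
      have /andP[e0 eK] := excess_bound vp0 k00 n.
      rewrite fth -mulrBl addrAC subrr add0r normrM (gtr0_norm t0) (gtr0_norm e0).
      rewrite ger0_norm ?invr_ge0 //.
      have -> : A / n.+1%:R = h ^+ 2 / vp / n.+1%:R * T by rewrite /A; ring.
      by apply: ler_pM; rewrite ?(ltW e0) ?(ltW t0) ?(ltW tT).
    apply: le_trans (ler_normD _ _) _; rewrite !normrM mulrDr.
    have e1 (x y c : R) : `|y| <= A * c -> `|x| * `|y| <= A * (`|x| * c).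
      by move=> hy; rewrite mulrCA ler_wpM2l.
    by apply: lerD; apply: e1; apply: le_trans d; [exact: cos_lip|exact: sin_lip].
  rewrite -mulr_sumr big_split /=.
  have -> : 2 * A * (Num.sqrt S * Num.sqrt 2) = A * (Num.sqrt S * Num.sqrt 2 + Num.sqrt S * Num.sqrt 2) by ring.
  by rewrite ler_wpM2l // lerD.
have FN : nrm 0 T F <= nrm 0 T G + 2 * A * (Num.sqrt S * Num.sqrt 2) * Num.sqrt T.
  have := nrm_bounded T1 c0 (L2rB LF LG) err; rewrite subr0 => e1.
  apply: le_trans (lerD (lexx _) e1).
  apply: le_trans (nrmD LG (L2rB LF LG)).
  by rewrite le_eqVlt; apply/orP; left; apply/eqP/eq_nrm => t _; ring.
have FN2 : nrm 0 T F ^+ 2 <= (nrm 0 T G + 2 * A * (Num.sqrt S * Num.sqrt 2) * Num.sqrt T) ^+ 2.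
  rewrite ler_pXn2r ?nnegrE ?nrm_ge0 // addr_ge0 ?nrm_ge0 //.
  by apply: mulr_ge0 => //; rewrite sqrtr_ge0.
apply: le_trans FN2 _.
have Eq : (2 * A * (Num.sqrt S * Num.sqrt 2) * Num.sqrt T) ^+ 2 = 8 * (A ^+ 2 * T * S).
  have e (x y z v : R) : (2 * x * (y * z) * v) ^+ 2 = 4 * (x ^+ 2 * v ^+ 2 * y ^+ 2) * z ^+ 2 by ring.
  by rewrite e !sqr_sqrtr // ; move: (A ^+ 2 * T * S) => u; ring.
move: Eq GN; set e := 2 * A * _ * _; set g := nrm 0 T G => Eq GN.
have := sqr_ge0 (g - e).
have -> : C * S = 2 * (2 * (K%:R * T0) * S) + 2 * (8 * (A ^+ 2 * T * S)) + S by rewrite /C; ring.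
rewrite -Eq; move: (2 * (K%:R * T0) * S) GN => u GN; lra.
Qed.

Lemma mode_sum_upper : exists2 C : R, 0 < C & forall N P Q,
  nrm 0 T (mode_sum P Q N) ^+ 2 <= C * energy_sum P Q N.
Proof.
have [C1 C10 H1] := branch_upper true; have [C2 C20 H2] := branch_upper false.
exists (2 * C1 + 2 * C2) => [|N P Q]; first by lra.
have h1 := H1 N (fun n => P (n, true)) (fun n => Q (n, true)).
have h2 := H2 N (fun n => P (n, false)) (fun n => Q (n, false)).
move: h1 h2; set f := fun t => _; set g := fun t => _ => h1 h2.
have Lf : L2r 0 T f.
  by apply: L2r_sum => n; apply: L2rD; apply: L2rZ; [exact: L2r_cos|exact: L2r_sin].
have Lg : L2r 0 T g.
  by apply: L2r_sum => n; apply: L2rD; apply: L2rZ; [exact: L2r_cos|exact: L2r_sin].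
rewrite (@eq_nrm _ _ _ _ (fun t => f t + g t)); last first.
  by move=> t _; rewrite /mode_sum big_split.
have h : nrm 0 T (fun t => f t + g t) ^+ 2 <= (nrm 0 T f + nrm 0 T g) ^+ 2.
  by rewrite ler_pXn2r ?nnegrE ?addr_ge0 ?nrm_ge0 // nrmD.
apply: le_trans h _.
rewrite /energy_sum big_split /= /amp_sq.
move: h1 h2; set u := \sum_(n < N) _; set v := \sum_(n < N) _ => h1 h2.
have u0 : 0 <= u by apply: sumr_ge0 => n _; rewrite addr_ge0 ?sqr_ge0.
have v0 : 0 <= v by apply: sumr_ge0 => n _; rewrite addr_ge0 ?sqr_ge0.
have := mulr_ge0 (ltW C10) v0; have := mulr_ge0 (ltW C20) u0.
have := sqr_ge0 (nrm 0 T f - nrm 0 T g); lra.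
Qed.

Definition truncate_below (N : nat) P (i : nat * bool) : R := if (i.1 < N)%N then 0 else P i.

Lemma mode_sum_truncate P Q N M t : (N <= M)%N ->
  mode_sum (truncate_below N P) (truncate_below N Q) M t = mode_sum P Q M t - mode_sum P Q N t.
Proof.
move=> /subnK <-; elim: (M - N)%N => [|m ih].
  rewrite add0n subrr /mode_sum big1 // => n _.
  by rewrite /mode /truncate_below /= ltn_ord !mul0r !addr0.
rewrite addSn /mode_sum big_ord_recr /= -/(mode_sum _ _ _ _) ih [in RHS]big_ord_recr /=.
rewrite -/(mode_sum P Q (m + N) t) -/(mode_sum P Q N t) {1 2}/mode /truncate_below /=.
by rewrite ltnNge leq_addl /= /mode addrAC.
Qed.

Lemma energy_sum_truncate P Q N M : (N <= M)%N ->
  energy_sum (truncate_below N P) (truncate_below N Q) M = energy_sum P Q M - energy_sum P Q N.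
Proof.
move=> /subnK <-; elim: (M - N)%N => [|m ih].
  rewrite add0n subrr /energy_sum big1 // => n _.
  by rewrite /amp_sq /truncate_below /= ltn_ord expr0n !addr0.
rewrite addSn /energy_sum big_ord_recr /= -/(energy_sum _ _ _) ih [in RHS]big_ord_recr /=.
rewrite -/(energy_sum P Q (m + N)) -/(energy_sum P Q N) {1 2}/amp_sq /truncate_below /=.
by rewrite ltnNge leq_addl /= /amp_sq addrAC.
Qed.

Lemma energy_tail P Q E : (forall N, energy_sum P Q N <= E) ->
  forall e, 0 < e -> exists N0, forall N M, (N0 <= N)%N -> (N <= M)%N ->
    energy_sum P Q M - energy_sum P Q N <= e.
Proof.
move=> HE e e0.
have nd : nondecreasing_seq (energy_sum P Q) by move=> N M; exact: energy_sum_nd.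
have ub : has_ubound (range (energy_sum P Q)) by exists E => _ [n _ <-]; exact: HE.
have cv := nondecreasing_is_cvgn nd ub.
have le_lim M := nondecreasing_cvgn_le nd cv M.
have /cvgrPdist_le /(_ e e0) [N0 _ H] := cv.
exists N0 => N M N0N NM; have := H N N0N => /=.
have := le_lim M; rewrite ler_norml => h1 /andP[_ h2]; lra.
Qed.

(** The tails of the series have small energy, and by Fatou a bound on the
    partial sums passes to their pointwise limits. *)
Lemma mode_series_upper : exists2 C : R, 0 < C & forall P Q E (y : R -> R),
  (forall N, energy_sum P Q N <= E) ->
  (forall t, 0 < t < T -> mode_sum P Q N t @[N --> \oo] --> y t) ->
  [/\ L2r 0 T y, ip 0 T y y <= C * E &
    forall e, 0 < e -> exists N0, forall N, (N0 <= N)%N ->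
      nrm 0 T (fun t => y t - mode_sum P Q N t) ^+ 2 <= e].
Proof.
have [C C0 HC] := mode_sum_upper; exists C => // P Q E y HE yl.
have [Ly yE] : L2r 0 T y /\ ip 0 T y y <= C * E.
  apply: (@L2r_cvg _ _ _ _ _ (mode_sum P Q)) => //.
    by move=> n; exact: L2r_mode_sum.
  move=> n; rewrite -sqr_nrm; apply: le_trans (HC _ _ _) _.
  by rewrite ler_wpM2l // ltW.
split=> // e e0; have [N0 H0] := energy_tail HE (divr_gt0 e0 C0).
exists N0 => N N0N; rewrite sqr_nrm.
have [_ //] : L2r 0 T (fun t => y t - mode_sum P Q N t) /\
   ip 0 T (fun t => y t - mode_sum P Q N t) (fun t => y t - mode_sum P Q N t) <= e.
apply: (@L2r_cvg _ _ _ _ _ (fun M t => mode_sum P Q (M + N) t - mode_sum P Q N t)).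
- by move=> M; apply: L2rB; exact: L2r_mode_sum.
- move=> t tT; apply: cvgB; last exact: cvg_cst.
  by have := yl t tT; rewrite -(cvg_shiftn N).
- move=> M; rewrite -sqr_nrm (@eq_nrm _ _ _ _
    (mode_sum (truncate_below N P) (truncate_below N Q) (M + N))); last first.
    by move=> t _; rewrite mode_sum_truncate ?leq_addl.
  apply: le_trans (HC _ _ _) _; rewrite energy_sum_truncate ?leq_addl //.
  by rewrite mulrC -ler_pdivlMr // H0 ?leq_addl.
Qed.

Hypothesis freq_injective : injective frq.
Hypothesis long_time : 2 * T0 < T.

(** Moving the origin of time to the middle of the interval rotates the two
    amplitudes of each mode and preserves the sum of their squares. *)
Lemma mode_sum_lower : exists2 C : R, 0 < C & forall N P Q,
  weak_sum P Q N <= C * nrm 0 T (mode_sum P Q N) ^+ 2.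
Proof.
have lT : T0 < T / 2 by rewrite ltr_pdivlMr // mulrC.
have [C C0 HC] := freq_observable vp0 k00 freq_injective lT.
exists C => // N P Q.
pose c := T / 2.
pose P' i := P i * cos (frq i * c) + Q i * sin (frq i * c).
pose Q' i := Q i * cos (frq i * c) - P i * sin (frq i * c).
have h := HC (mode_seq N) P' Q' (uniq_mode_seq N) (fun i _ => isT).
have -> : weak_sum P Q N = coef_sq (@freq_weight R) (mode_seq N) P' Q'.
  rewrite /coef_sq sum_mode_seq; apply: eq_bigr => n _.
  have e i : P' i ^+ 2 + Q' i ^+ 2 = amp_sq P Q i.
    have := cos2Dsin2 (frq i * c); rewrite /P' /Q' /amp_sq => cs.
    have -> : (P i * cos (frq i * c) + Q i * sin (frq i * c)) ^+ 2 +
      (Q i * cos (frq i * c) - P i * sin (frq i * c)) ^+ 2 =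
      (P i ^+ 2 + Q i ^+ 2) * (cos (frq i * c) ^+ 2 + sin (frq i * c) ^+ 2) by ring.
    by rewrite cs mulr1.
  by rewrite !e /freq_weight /= mulrDr.
suff -> : nrm 0 T (mode_sum P Q N) = nrm (- (T / 2)) (T / 2) (trig_sum frq (mode_seq N) P' Q') by [].
have -> : nrm (- (T / 2)) (T / 2) (trig_sum frq (mode_seq N) P' Q') =
    nrm (- (T / 2)) (T / 2) (fun t => mode_sum P Q N (t + c)).
  apply: eq_nrm => t _; rewrite mode_sumE /trig_sum; apply: eq_bigr => i _.
  by rewrite /P' /Q' mulrDr cosD sinD; ring.
rewrite nrm_shift.
- by rewrite /c addNr -splitr.
- have T2 : 0 < T / 2 by rewrite divr_gt0.
  by rewrite gtrN.
- by rewrite mode_sumE; exact: continuous_trig_sum.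
Qed.

(** Finite sums approach [y] in the norm, and their weighted coefficients
    increase. *)
Lemma mode_series_lower : exists2 C : R, 0 < C & forall P Q E (y : R -> R),
  (forall N, energy_sum P Q N <= E) ->
  (forall t, 0 < t < T -> mode_sum P Q N t @[N --> \oo] --> y t) ->
  forall K, weak_sum P Q K <= C * ip 0 T y y.
Proof.
have [C C0 HC] := mode_sum_lower; have [C1 _ H1] := mode_series_upper.
exists (2 * C) => [|P Q E y HE yl K]; first by rewrite mulr_gt0.
have [Ly _ yN] := H1 P Q E y HE yl.
apply/ler_addgt0Pr => e e0.
have e2 : 0 < e / (2 * C) by rewrite divr_gt0 // mulr_gt0.
have [N0 H0] := yN _ e2.
pose N := maxn N0 K.
have hN := H0 N (leq_maxl _ _).
have wK : weak_sum P Q K <= weak_sum P Q N.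
  rewrite /weak_sum -(subnK (leq_maxr N0 K : (K <= N)%N)); elim: (N - K)%N => // m ih.
  rewrite addSn; apply: le_trans ih _; rewrite big_ord_recr /= lerDl.
  by rewrite mulr_ge0 ?invr_ge0 ?exprn_ge0 // !addr_ge0 ?sqr_ge0.
apply: le_trans wK (le_trans (HC _ _ _) _).
have LS : L2r 0 T (mode_sum P Q N) by exact: L2r_mode_sum.
have h : nrm 0 T (mode_sum P Q N) <= nrm 0 T y + nrm 0 T (fun t => y t - mode_sum P Q N t).
  apply: le_trans (nrmB Ly (L2rB Ly LS)).
  by rewrite le_eqVlt; apply/orP; left; apply/eqP/eq_nrm => t _; ring.
have h2 : nrm 0 T (mode_sum P Q N) ^+ 2 <=
    (nrm 0 T y + nrm 0 T (fun t => y t - mode_sum P Q N t)) ^+ 2.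
  by rewrite ler_pXn2r ?nnegrE ?addr_ge0 ?nrm_ge0.
have h3 : nrm 0 T (mode_sum P Q N) ^+ 2 <= 2 * ip 0 T y y + 2 * (e / (2 * C)).
  apply: le_trans h2 _; move: hN; rewrite -sqr_nrm.
  have := sqr_ge0 (nrm 0 T y - nrm 0 T (fun t => y t - mode_sum P Q N t)); lra.
apply: le_trans (ler_wpM2l (ltW C0) h3) _.
by rewrite le_eqVlt; apply/orP; left; apply/eqP; field; rewrite gt_eqF.
Qed.

End ModeSeries.

(** * Weak derivatives on the unit interval *)

Section WeakDerivative.
Variable R : realType.
Local Notation mu := (@lebesgue_measure R).
Implicit Types (a b x y : R) (f g h : R -> R).

Lemma Rintegral_split a x y f : a <= x -> x <= y ->
  mu.-integrable `]a, y[ (EFin \o f) ->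
  \int[mu]_(t in `]a, y[) f t = \int[mu]_(t in `]a, x[) f t + \int[mu]_(t in `]x, y[) f t.
Proof.
move=> ax; rewrite le_eqVlt => /predU1P[<- If|xy If].
  by rewrite [X in _ + X](_ : _ = 0) ?addr0 // set_itv_ge ?Rintegral_set0 // bnd_simp ltxx.
have := @Rintegral_itvB R f (BRight a) (BLeft y) x If; rewrite !bnd_simp => /(_ ax xy) <-.
rewrite (@Rintegral_itv_bndo_bndc R (BRight a) x f); first by rewrite [RHS]addrC subrK.
by apply: integrableS If => //; apply: subset_itvl; rewrite bnd_simp ltW.
Qed.

Lemma integrable_sub a b x y f : a <= x -> y <= b ->
  mu.-integrable `]a, b[ (EFin \o f) -> mu.-integrable `]x, y[ (EFin \o f).
Proof. by move=> ax yb; apply: integrableS => //; exact: sub_itvoo. Qed.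

Lemma Rintegral_norm_le x y c f h : x <= y ->
  mu.-integrable `]x, y[ (EFin \o f) -> measurable_fun `]x, y[ h ->
  (forall t, x < t < y -> `|h t| <= c) -> 0 <= c ->
  mu.-integrable `]x, y[ (EFin \o (fun t => f t * h t)) /\
  `|\int[mu]_(t in `]x, y[) (f t * h t)| <= c * \int[mu]_(t in `]x, y[) `|f t|.
Proof.
move=> xy If mh hc c0.
have mf : measurable_fun `]x, y[ f by have := measurable_int mu If => /measurable_EFinP.
have Iaf : mu.-integrable `]x, y[ (EFin \o (fun t => `|f t|)) by exact: integrable_norm.
have Icf : mu.-integrable `]x, y[ (fun t => (c * `|f t|)%:E).
  by apply: eq_integrable (integrableZl _ c Iaf) => // t _; rewrite EFinM.
have Ifh : mu.-integrable `]x, y[ (EFin \o (fun t => f t * h t)).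
  apply: le_integrable Icf => //.
    by apply/measurable_EFinP; exact: measurable_funM.
  move=> t; rewrite /= in_itv /= => /hc htc.
  by rewrite lee_fin normrM [leRHS]ger0_norm ?mulr_ge0 // mulrC ler_wpM2r.
split=> //; apply: le_trans (le_normr_Rintegral _ Ifh) _ => //.
rewrite -RintegralZl //; apply: le_Rintegral => //.
  exact: integrable_norm.
by move=> t; rewrite /= in_itv /= => /hc htc; rewrite normrM mulrC ler_wpM2r.
Qed.

(** The counterpart of [is_weak_deriv] for the real and imaginary parts. *)
Definition wderiv f g : Prop :=
  L2r 0 1 g /\ forall x, 0 <= x <= 1 -> f x = f 0 + \int[mu]_(t in `]0, x[) g t.

Lemma wderiv_integrable f g : wderiv f g -> mu.-integrable `]0, 1[ (EFin \o g).
Proof. by move=> [Lg _]; have [] := L1_le_nrm ltr01 Lg. Qed.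

Lemma wderiv_increment f g x y : wderiv f g -> 0 <= x -> x <= y -> y <= 1 ->
  f y - f x = \int[mu]_(t in `]x, y[) g t.
Proof.
move=> H x0 xy y1; have Ig := wderiv_integrable H; have [_ fE] := H.
rewrite (fE y) ?(le_trans x0) ?y1 // (fE x) ?x0 ?(le_trans xy) //.
rewrite (Rintegral_split x0 xy); first ring.
by apply: integrable_sub Ig.
Qed.

Lemma wderiv_L2r f g : wderiv f g -> L2r 0 1 f.
Proof.
move=> H; have Ig := wderiv_integrable H.
pose g0 := g \_ `]0, 1[.
have sub01 : `]0, 1[ `<=` (`[0, 1] : set R) by exact: subset_itv_oo_cc.
have Ig0 : mu.-integrable `[0, 1] (EFin \o g0).
  rewrite -restrict_EFin; apply/integrable_restrict => //=.
  by rewrite setIidr.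
have Iio (x y : R) (b c : bool) : 0 <= x -> y <= 1 ->
    mu.-integrable [set` Interval (BSide b x) (BSide c y)] (EFin \o g0).
  move=> x0 y1; apply: integrableS Ig0 => // t /=.
  rewrite !in_itv /= => /andP[h1 h2]; apply/andP; split.
    by apply: le_trans x0 _; move: h1; case: b => //= /ltW.
  by apply: le_trans y1; move: h2; case: c => //= /ltW.
have fE x : 0 <= x <= 1 -> f x = f 0 + \int[mu]_(t in `[0, x]) g0 t.
  move=> /andP[x0 x1]; have [_ ->] := H; last by rewrite x0.
  congr (_ + _); transitivity (\int[mu]_(t in `]0, x[) g0 t).
    apply: eq_Rintegral => t; rewrite inE /= in_itv /= => /andP[t0 tx].
    by rewrite /g0 patchE mem_set //= in_itv /= t0 (lt_le_trans tx).
  rewrite Rintegral_itv_obnd_cbnd; last exact: Iio.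
  by rewrite Rintegral_itv_bndo_bndc //; exact: Iio.
have cF := parameterized_integral_continuous ler01 Ig0.
have mF : measurable_fun (`[0, 1] : set R) (fun x => \int[mu]_(t in `[0, x]) g0 t).
  by apply: subspace_continuous_measurable_fun => //; exact: cF.
have mf : measurable_fun (`]0, 1[ : set R) f.
  apply: (@eq_measurable_fun _ _ _ _ _ (fun x => f 0 + \int[mu]_(t in `[0, x]) g0 t)).
    by move=> x; rewrite inE /= in_itv /= => /andP[x0 x1]; rewrite (fE x) // (ltW x0) (ltW x1).
  by apply: measurable_funD => //; apply: measurable_funS mF.
apply: (@L2r_bounded _ _ _ (`|f 0| + \int[mu]_(t in `]0, 1[) `|g t|)) => //.
move=> x /andP[x0 x1]; have [_ ->] := H; last by rewrite (ltW x0) (ltW x1).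
apply: le_trans (ler_normD _ _) _; rewrite lerD2l.
have Igx : mu.-integrable `]0, x[ (EFin \o g) by apply: integrable_sub Ig => //; exact: ltW.
apply: le_trans (le_normr_Rintegral _ Igx) _ => //.
rewrite (@Rintegral_split 0 x 1) //; [|exact: ltW|exact: ltW|exact: integrable_norm].
by rewrite lerDl; apply: Rintegral_ge0 => t _.
Qed.

(** Integration by parts by bounding the defect on [[x, y]] by a multiple of
    [(y - x) * \int_x^y |g|], whose sums over fine partitions vanish. *)
Lemma wderiv_by_parts f g h dh L : wderiv f g -> (forall x, is_derive x 1 h (dh x)) ->
  continuous dh -> (forall x, `|dh x| <= L) ->
  ip 0 1 g h = f 1 * h 1 - f 0 * h 0 - ip 0 1 f dh.
Proof.
move=> H dhh cdh dhL.
have L0 : 0 <= L := le_trans (normr_ge0 _) (dhL 0).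
have Ig := wderiv_integrable H; have Lf := wderiv_L2r H; have [Lg _] := H.
have ch : continuous h.
  by move=> x; apply/differentiable_continuous/derivable1_diffP; have := dhh x => -[].
have Lh : L2r 0 1 h by exact: continuous_L2r.
have Ldh : L2r 0 1 dh by exact: continuous_L2r.
have Igh := L2r_prod Lg Lh; have Ifd := L2r_prod Lf Ldh.
have hlip x y : `|h y - h x| <= L * `|y - x|.
  by apply: (@lipschitz_of_deriv _ h dh) => // z _.
pose Ga x := \int[mu]_(t in `]0, x[) `|g t|.
pose Psi x := f x * h x - \int[mu]_(t in `]0, x[) (g t * h t) - \int[mu]_(t in `]0, x[) (f t * dh t).
have key x y : 0 <= x -> x <= y -> y <= 1 -> `|Psi y - Psi x| <= 2 * L * (y - x) * (Ga y - Ga x).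
  move=> x0 xy y1.
  have Ag : mu.-integrable `]0, 1[ (EFin \o (fun t => `|g t|)) by exact: integrable_norm.
  have I0 := @integrable_sub 0 1 0 y.
  have Ix := @integrable_sub 0 1 x y.
  have EG : Ga y - Ga x = \int[mu]_(t in `]x, y[) `|g t|.
    rewrite /Ga (@Rintegral_split 0 x y (fun t => `|g t|)) //; first by rewrite addrAC subrr add0r.
    exact: I0.
  have dfE s : x < s < y -> `|f x - f s| <= Ga y - Ga x.
    move=> /andP[xs sy]; rewrite distrC EG.
    rewrite (wderiv_increment H x0 (ltW xs)) ?(le_trans (ltW sy)) //.
    have Igs : mu.-integrable `]x, s[ (EFin \o g).
      by apply: integrable_sub Ig => //; rewrite (le_trans (ltW sy)).
    apply: le_trans (le_normr_Rintegral _ Igs) _ => //.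
    rewrite (@Rintegral_split x s y) ?(ltW xs) ?(ltW sy) //; last exact: Ix.
    by rewrite lerDl; apply: Rintegral_ge0.
  have yx0 : 0 <= y - x by rewrite subr_ge0.
  have mh : measurable_fun `]x, y[ (fun t => h y - h t).
    apply: measurable_funB => //; apply: (@measurable_funS _ _ _ _ setT) => //.
    exact: continuous_measurable_fun.
  have Igx : mu.-integrable `]x, y[ (EFin \o g) by exact: Ix.
  have [e|nxy] := eqVneq x y.
    by rewrite e !subrr !mulr0 normr0.
  have xy' : x < y by rewrite lt_neqAle nxy.
  have hyb t : x < t < y -> `|h y - h t| <= L * (y - x).
    move=> /andP[xt ty]; apply: le_trans (hlip _ _) _.
    by rewrite ler_wpM2l // ger0_norm ?subr_ge0 ?(ltW ty) // lerD2l lerN2 ltW.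
  have [J1 B1] := Rintegral_norm_le xy Igx mh hyb (mulr_ge0 L0 yx0).
  have G0 : 0 <= Ga y - Ga x by rewrite EG; apply: Rintegral_ge0.
  have mdf : measurable_fun `]x, y[ (fun t => (f x - f t) * dh t).
    apply: measurable_funM.
      apply: measurable_funB => //; have [mf _] := Lf.
      by apply: measurable_funS mf => //; exact: sub_itvoo.
    by apply: (@measurable_funS _ _ _ _ setT) => //; exact: continuous_measurable_fun.
  have dfb t : x < t < y -> `|(f x - f t) * dh t| <= (Ga y - Ga x) * L.
    by move=> txy; rewrite normrM; apply: ler_pM => //; exact: dfE.
  have I1 : mu.-integrable `]x, y[ (EFin \o (fun=> 1 : R)) by exact: integrable_cst_itv.
  have [J2 B2] := Rintegral_norm_le xy I1 mdf dfb (mulr_ge0 G0 L0).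
  have E1 : \int[mu]_(t in `]x, y[) `|1 : R| = y - x.
    by rewrite Rintegral_cst //= lebesgue_measure_itv /= lte_fin xy' normr1 mul1r.
  have Sg : \int[mu]_(t in `]x, y[) (g t * (h y - h t)) =
      h y * (f y - f x) - \int[mu]_(t in `]x, y[) (g t * h t).
    rewrite (wderiv_increment H x0 xy y1) -RintegralZl //.
    rewrite -RintegralB //; last exact: Ix.
      by apply: eq_Rintegral => t _; ring.
    by apply: eq_integrable (integrableZl _ (h y) Igx) => // t _; rewrite EFinM.
  have Ed : \int[mu]_(t in `]x, y[) dh t = h y - h x.
    by apply: (@Rintegral_FTC _ (x - 1)) => //; rewrite ltrBlDr ltrDl.
  have Idh : mu.-integrable `]x, y[ (EFin \o dh).
    by apply: Ix => //; have [] := L1_le_nrm ltr01 Ldh.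
  have Sf : \int[mu]_(t in `]x, y[) (1 * ((f x - f t) * dh t)) =
      f x * (h y - h x) - \int[mu]_(t in `]x, y[) (f t * dh t).
    rewrite -Ed -RintegralZl // -RintegralB //; last exact: Ix.
      by apply: eq_Rintegral => t _; ring.
    by apply: eq_integrable (integrableZl _ (f x) Idh) => // t _; rewrite EFinM.
  have -> : Psi y - Psi x = \int[mu]_(t in `]x, y[) (g t * (h y - h t)) +
      \int[mu]_(t in `]x, y[) (1 * ((f x - f t) * dh t)).
    rewrite Sg Sf /Psi.
    rewrite (@Rintegral_split 0 x y (fun t => g t * h t)) //; last exact: I0.
    rewrite (@Rintegral_split 0 x y (fun t => f t * dh t)) //; last exact: I0.
    ring.
  rewrite E1 in B2; rewrite -EG in B1.
  apply: le_trans (ler_normD _ _) _.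
  have -> : 2 * L * (y - x) * (Ga y - Ga x) =
    L * (y - x) * (Ga y - Ga x) + (Ga y - Ga x) * L * (y - x) by ring.
  exact: lerD.
have part (N : nat) : `|Psi 1 - Psi 0| <= 0 + (2 * L * Ga 1) / N.+1%:R.
  have N0 : 0 < N.+1%:R :> R by rewrite ltr0n.
  have step (n : nat) : (n <= N.+1)%N ->
      `|Psi (n%:R / N.+1%:R) - Psi 0| <= 2 * L / N.+1%:R * (Ga (n%:R / N.+1%:R) - Ga 0).
    elim: n => [_|n ih nN]; first by rewrite mul0r !subrr normr0 mulr0.
    have h0 : 0 <= n%:R / N.+1%:R :> R by rewrite divr_ge0.
    have h1 : n%:R / N.+1%:R <= n.+1%:R / N.+1%:R :> R by rewrite ler_pM2r ?invr_gt0 // ler_nat.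
    have h2 : n.+1%:R / N.+1%:R <= 1 :> R by rewrite ler_pdivrMr // mul1r ler_nat.
    have := key _ _ h0 h1 h2.
    have -> : n.+1%:R / N.+1%:R - n%:R / N.+1%:R = N.+1%:R^-1 :> R.
      by rewrite -mulrBl -natrB // subSnn mul1r.
    move=> k1; have := ih (ltnW nN) => k2.
    have -> : Psi (n.+1%:R / N.+1%:R) - Psi 0 =
      (Psi (n.+1%:R / N.+1%:R) - Psi (n%:R / N.+1%:R)) + (Psi (n%:R / N.+1%:R) - Psi 0) by ring.
    apply: le_trans (ler_normD _ _) (le_trans (lerD k1 k2) _).
    by rewrite le_eqVlt; apply/orP; left; apply/eqP; ring.
  have := step N.+1 (leqnn _); rewrite divff ?gt_eqF // add0r.
  have -> : Ga 0 = 0 by rewrite /Ga set_itv_ge ?Rintegral_set0 // bnd_simp ltxx.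
  by rewrite subr0 mulrAC.
have := le_add_harmonic part; rewrite normr_le0 subr_eq0 => /eqP.
have J0 (k : R -> R) : \int[mu]_(t in `]0, 0[) k t = 0.
  by rewrite set_itv_ge ?Rintegral_set0 // bnd_simp ltxx.
by rewrite /Psi !J0 !subr0 /ip => <-; ring.
Qed.

End WeakDerivative.

(** * The sum of the inverse squares *)

Section InverseSquares.
Variable R : realType.
Implicit Types (x : R) (n N k : nat).

Lemma cot_le x : 0 < x -> x < pi / 2 -> (sin x ^+ 2)^-1 <= 1 + (x ^+ 2)^-1.
Proof.
move=> x0 x2; have pi0 := pi_gt0 R.
have s0 : 0 < sin x by apply: sin_gt0_pihalf; rewrite x0.
have c0 : 0 < cos x by apply: cos_gt0_pihalf; rewrite x2 andbT; lra.
have h : x * cos x <= sin x.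
  have d (z : R) : is_derive z 1 (fun t : R => sin t - t * cos t) (z * sin z).
    by apply: is_derive_eq; rewrite /GRing.scale /=; ring.
  have [c /andP[c0' cx] E] := MVT_everywhere x0 d.
  move: E; rewrite sin0 mul0r !subr0 => E.
  have sc : 0 <= sin c by apply: sin_ge0_pi; apply/andP; split; lra.
  by rewrite -subr_ge0 E !mulr_ge0 // ltW.
have -> : 1 + (x ^+ 2)^-1 = (x ^+ 2 + 1) / x ^+ 2 by field; rewrite gt_eqF.
have x2' : 0 < x ^+ 2 by rewrite exprn_gt0.
have s2' : 0 < sin x ^+ 2 by rewrite exprn_gt0.
rewrite -[leLHS]mul1r ler_pdivrMr // mulrAC ler_pdivlMr // mul1r.
have : (x * cos x) ^+ 2 <= sin x ^+ 2.
  by rewrite ler_pXn2r ?nnegrE ?(ltW s0) // mulr_ge0 // ltW.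
rewrite exprMn cos2sin2; lra.
Qed.

Lemma double_angle x : sin x != 0 -> cos x != 0 ->
  (sin x ^+ 2)^-1 + (sin (pi / 2 - x) ^+ 2)^-1 = 4 * (sin (2 * x) ^+ 2)^-1.
Proof.
move=> s0 c0.
have -> : sin (pi / 2 - x) = cos x.
  by rewrite sinB sin_pihalf cos_pihalf mul0r mul1r subr0.
have -> : 2 * x = x + x by ring.
have -> : sin (x + x) = 2 * (sin x * cos x) by rewrite sinD; ring.
have cs : cos x ^+ 2 = 1 - sin x ^+ 2 by rewrite cos2sin2.
have -> : (sin x ^+ 2)^-1 + (cos x ^+ 2)^-1 =
   (sin x ^+ 2 + cos x ^+ 2) / (sin x * cos x) ^+ 2.
  by field; rewrite s0 c0.
by rewrite addrC cos2Dsin2; field; rewrite s0 c0.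
Qed.

Definition dyadic_angle (k j : nat) : R := (2 * j + 1)%:R * pi / (2 ^ (k + 2))%:R.

Lemma dyadic_angle_itv k j : (j < 2 ^ k)%N -> 0 < dyadic_angle k j < pi / 2.
Proof.
move=> jk; have pi0 := pi_gt0 R.
have d0 : 0 < (2 ^ (k + 2))%:R :> R by rewrite ltr0n expn_gt0.
rewrite /dyadic_angle divr_gt0 ?mulr_gt0 ?ltr0n ?addn1 //=.
rewrite ltr_pdivrMr // mulrC mulrAC -mulrA ltr_pM2l //.
rewrite ltr_pdivlMr // -natrM ltr_nat expnD -[(2 ^ 2)%N]/(2 * 2)%N.
  by move: (2 ^ k)%N jk => m; lia.
by rewrite expn_gt0.
Qed.

(** Halving the angles doubles their number and quadruples the sum. *)
Lemma sum_dyadic k : \sum_(j < 2 ^ k) (sin (dyadic_angle k j) ^+ 2)^-1 = 2 * 4 ^+ k :> R.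
Proof.
elim: k => [|k ih].
  rewrite expn0 big_ord1 /dyadic_angle expr0 mulr1 muln0 add0n mul1r -[(2 ^ (0 + 2))%N]/4%N.
  have := @double_angle (pi / 4).
  have -> : pi / 2 - pi / 4 = pi / 4 :> R by field.
  have -> : 2 * (pi / 4) = pi / 2 :> R by field.
  have pi0 := pi_gt0 R.
  have s0 : 0 < sin (pi / 4 : R) by apply: sin_gt0_pihalf; apply/andP; split; lra.
  have c0 : 0 < cos (pi / 4 : R) by apply: cos_gt0_pihalf; apply/andP; split; lra.
  rewrite !gt_eqF // => /(_ isT isT); rewrite sin_pihalf expr1n invr1 => h; lra.
have -> : (2 ^ k.+1 = 2 ^ k + 2 ^ k)%N by rewrite expnS mul2n addnn.
rewrite big_split_ord /= [X in _ + X](reindex_inj rev_ord_inj) /= -big_split /=.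
have -> : 2 * 4 ^+ k.+1 = 4 * (2 * 4 ^+ k) :> R by rewrite exprS; ring.
rewrite -ih mulr_sumr; apply: eq_bigr => j _.
have jk := ltn_ord j; have /andP[a0 a2] := dyadic_angle_itv jk.
have dS : (2 ^ (k.+1 + 2))%:R = 2 * (2 ^ (k + 2))%:R :> R by rewrite addSn expnS natrM.
have d0 : (2 ^ (k + 2))%:R != 0 :> R by rewrite pnatr_eq0 -lt0n expn_gt0.
have e1 : dyadic_angle k.+1 j = dyadic_angle k j / 2.
  by rewrite /dyadic_angle dS; field.
have e2 : dyadic_angle k.+1 (2 ^ k + (2 ^ k - j.+1)) = pi / 2 - dyadic_angle k j / 2.
  have -> : dyadic_angle k.+1 (2 ^ k + (2 ^ k - j.+1)) =
     ((2 ^ (k + 2))%:R - (2 * j + 1)%:R) * pi / (2 * (2 ^ (k + 2))%:R).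
    rewrite /dyadic_angle dS -natrB; last first.
      by rewrite expnD -[(2 ^ 2)%N]/4%N; lia.
    by congr (_%:R * _ / _); rewrite expnD -[(2 ^ 2)%N]/4%N; lia.
  by rewrite /dyadic_angle; field.
rewrite e1 e2 double_angle.
- by congr (4 * (sin _ ^+ 2)^-1); field.
- by rewrite gt_eqF // sin_gt0_pihalf //; apply/andP; split; lra.
- by rewrite gt_eqF // cos_gt0_pihalf //; apply/andP; split; lra.
Qed.

(** In [sum_dyadic], replacing the inverse squared sines by the inverse
    squared angles costs at most [1] in each of the [2 ^ k] terms, against a
    total of order [4 ^ k]. *)
Lemma odd_inverse_squares k :
  pi ^+ 2 / 8 - pi ^+ 2 / 16 / 2 ^+ k <= \sum_(j < 2 ^ k) ((2 * j + 1)%:R ^+ 2)^-1 :> R.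
Proof.
have pi0 := pi_gt0 R.
have h : 2 * 4 ^+ k <= \sum_(j < 2 ^ k) (1 + ((dyadic_angle k j) ^+ 2)^-1) :> R.
  rewrite -sum_dyadic; apply: ler_sum => j _.
  by have /andP[a0 a2] := dyadic_angle_itv (ltn_ord j); exact: cot_le.
move: h; rewrite big_split /= sumr_const card_ord.
have p4 : (4 : R) ^+ k = 2 ^+ k * 2 ^+ k by rewrite -exprMn; congr (_ ^+ _); ring.
have -> : \sum_(j < 2 ^ k) ((dyadic_angle k j) ^+ 2)^-1 =
    16 * 4 ^+ k / pi ^+ 2 * \sum_(j < 2 ^ k) ((2 * j + 1)%:R ^+ 2)^-1 :> R.
  rewrite mulr_sumr; apply: eq_bigr => j _.
  have E (u p t : R) : u != 0 -> p != 0 -> t != 0 ->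
      ((u * p / (t * 2 ^+ 2)) ^+ 2)^-1 = 16 * (t * t) / p ^+ 2 * (u ^+ 2)^-1.
    by move=> u0 p0 t0; field; rewrite u0 p0 t0.
  by rewrite /dyadic_angle natrX exprD p4 E // ?expf_neq0 ?pnatr_eq0 ?addn1 ?gt_eqF.
set S := \sum_(j < _) _ => h.
have t0 : 0 < (2 : R) ^+ k by rewrite exprn_gt0.
have p2 : 0 < pi ^+ 2 :> R by rewrite exprn_gt0.
rewrite natrX p4 in h.
have -> : pi ^+ 2 / 8 - pi ^+ 2 / 16 / 2 ^+ k =
   (2 * (2 ^+ k * 2 ^+ k) - 2 ^+ k) * (pi ^+ 2 / (16 * (2 ^+ k * 2 ^+ k))) :> R.
  by field; rewrite gt_eqF.
rewrite -ler_pdivlMr; last by rewrite divr_gt0 // !mulr_gt0.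
have -> : S / (pi ^+ 2 / (16 * (2 ^+ k * 2 ^+ k))) = 16 * (2 ^+ k * 2 ^+ k) / pi ^+ 2 * S.
  have E (p t v : R) : p != 0 -> t != 0 -> v / (p / (16 * t)) = 16 * t / p * v.
    by move=> p0 t1; field; rewrite p0 t1.
  by rewrite E // gt_eqF // mulr_gt0.
by move: (16 * _ / _ * S) h => u h; lra.
Qed.

Definition inverse_squares N : R := \sum_(n < N) (n.+1%:R ^+ 2)^-1.

Lemma inverse_squares_double N : inverse_squares (2 * N) =
  \sum_(j < N) ((2 * j + 1)%:R ^+ 2)^-1 + inverse_squares N / 4.
Proof.
elim: N => [|N ih]; first by rewrite /inverse_squares muln0 !big_ord0 mul0r addr0.
rewrite mulnS addnC addn2 /inverse_squares !big_ord_recr /= -/(inverse_squares _).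
rewrite -/(inverse_squares _) ih addn1.
have -> : (2 * N).+2%:R = 2 * N.+1%:R :> R by rewrite -natrM mulnS addnC addn2.
have n0 : N.+1%:R != 0 :> R by rewrite pnatr_eq0.
have n1 : (2 * N).+1%:R != 0 :> R by rewrite pnatr_eq0.
have E (u v a b : R) : u != 0 -> v != 0 ->
    a + b / 4 + (u ^+ 2)^-1 + ((2 * v) ^+ 2)^-1 = a + (u ^+ 2)^-1 + (b + (v ^+ 2)^-1) / 4.
  by move=> u0 v0; field; rewrite u0 v0.
exact: E.
Qed.

Lemma inverse_squares_lower e : 0 < e -> exists N, forall n, (N <= n)%N ->
  pi ^+ 2 / 6 - e <= inverse_squares n.
Proof.
move=> e0.
have nd : nondecreasing_seq inverse_squares.
  move=> n m /subnK <-; elim: (m - n)%N => // k ih; rewrite addSn.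
  by apply: le_trans ih _; rewrite /inverse_squares big_ord_recr /= lerDl invr_ge0 exprn_ge0.
have ub : has_ubound (range inverse_squares).
  exists 2 => _ [n _ <-]; case: n => [|n]; first by rewrite /inverse_squares big_ord0.
  have := @sum_inv_sq_tail R 1 n.+1 isT.
  rewrite /inverse_squares !big_ord_recl /= !invr1 expr0n expr1n add0r invr1 => h.
  rewrite -[X in _ <= X]/(1 + 1 : R) lerD2l; apply: le_trans h.
  by apply: ler_sum => i _; rewrite exprVn.
have cv := nondecreasing_is_cvgn nd ub.
have le_lim M := nondecreasing_cvgn_le nd cv M.
set S := limn inverse_squares in le_lim.
have close d : 0 < d -> exists N, forall n, (N <= n)%N -> S - d <= inverse_squares n.
  move=> d0; have /cvgrPdist_le /(_ d d0) [N _ H] := cv; exists N => n Nn.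
  by have := H n Nn => /=; rewrite ler_norml => /andP[_]; rewrite -/S; lra.
suff hS : pi ^+ 2 / 6 <= S.
  by have [N HN] := close e e0; exists N => n /HN; lra.
suff H (M : nat) : pi ^+ 2 / 6 <= S + (pi ^+ 2 / 12) / M.+1%:R by exact: le_add_harmonic H.
have Sq : pi ^+ 2 / 8 <= 3 / 4 * S + pi ^+ 2 / 16 / M.+1%:R.
  apply/ler_addgt0Pr => d d0; have [N HN] := close d d0.
  pose k := maxn N M.
  have kk : (k < 2 ^ k)%N by exact: ltn_expl.
  have h1 := HN (2 ^ k)%N (leq_trans (leq_maxl N M) (ltnW kk)).
  have h2 := le_lim (2 * 2 ^ k)%N; have h3 := odd_inverse_squares k.
  rewrite inverse_squares_double in h2.
  have h5 := le_lim (2 ^ k)%N.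
  have h4 : pi ^+ 2 / 16 / 2 ^+ k <= pi ^+ 2 / 16 / M.+1%:R :> R.
    rewrite ler_wpM2l ?divr_ge0 ?sqr_ge0 // lef_pV2 ?posrE ?exprn_gt0 ?ltr0n //.
    by rewrite -natrX ler_nat (leq_trans _ kk) // ltnS leq_maxr.
  move: (inverse_squares _) h1 h5 h2 => s h1 h5 h2.
  move: h2 h3 h4; move: (\sum_(j < _) _) (pi ^+ 2 / 16 / 2 ^+ k) (pi ^+ 2 / 16 / M.+1%:R).
  move: (pi ^+ 2 / 8) => p o u v h2 h3 h4; lra.
have -> : pi ^+ 2 / 12 / M.+1%:R = 4 / 3 * (pi ^+ 2 / 16 / M.+1%:R) :> R.
  have E (p m : R) : m != 0 -> p / 12 / m = 4 / 3 * (p / 16 / m) by move=> m0; field.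
  by rewrite E // pnatr_eq0.
have -> : pi ^+ 2 / 6 = 4 / 3 * (pi ^+ 2 / 8) :> R by field.
by move: (pi ^+ 2 / 8) (pi ^+ 2 / 16 / _) Sq => u v Sq; lra.
Qed.

End InverseSquares.

(** * Boundary values as cosine series *)

Section TrigBasis.
Variable R : realType.
Local Notation mu := (@lebesgue_measure R).
Implicit Types (x : R) (f g : R -> R) (n N : nat).

Definition bfreq n : R := n.+1%:R * pi.

Lemma bfreq_gt0 n : 0 < bfreq n.
Proof. by rewrite mulr_gt0 ?pi_gt0. Qed.

Lemma sin_bfreq n : sin (bfreq n) = 0.
Proof. exact: sin_natpi. Qed.

Lemma cos_bfreq n : cos (bfreq n) = (-1) ^+ n.+1.
Proof.
rewrite /bfreq; elim: n => [|n IH]; first by rewrite mul1r cospi expr1.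
by rewrite -(natr1 n.+1) mulrDl mul1r cosDpi IH (exprS _ n.+1) mulN1r.
Qed.

Lemma integral_cos_zero (w : R) : sin w = 0 ->
  ip 0 1 (fun x => cos (w * x)) (fun=> 1) = (w == 0)%:R.
Proof.
move=> sw; rewrite /ip; under eq_Rintegral do rewrite mulr1.
have [->|w0] := eqVneq w 0; last first.
  by rewrite Rintegral_cos // mulr1 mulr0 sin0 sw subr0 mul0r.
under eq_Rintegral do rewrite mul0r cos0.
by rewrite Rintegral_cst //= lebesgue_measure_itv /= lte_fin ltr01 mul1r -EFinD /= subr0.
Qed.

Lemma L2r_cst a b c : L2r a b (fun=> c : R).
Proof. by apply: (@L2r_bounded _ a b `|c|) => //; exact: measurable_cst. Qed.

Lemma L2r_basis_sin n : L2r 0 1 (trig_basis sin n : R -> R).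
Proof. exact: L2r_sin. Qed.

Lemma L2r_basis_cos n : L2r 0 1 (trig_basis cos n : R -> R).
Proof. exact: L2r_cos. Qed.

Lemma bfreq_eq i j : (bfreq i - bfreq j == 0) = (i == j).
Proof.
rewrite subr_eq0 /bfreq; apply/eqP/eqP => [|-> //].
by move/(mulIf (lt0r_neq0 (pi_gt0 R)))/eqP; rewrite eqr_nat eqSS => /eqP.
Qed.

Lemma basis_orthogonal (c : R) (trig : R -> R) i j :
  (forall x y, trig x * trig y = 2^-1 * cos (x - y) + 2^-1 * c * cos (x + y)) ->
  ip 0 1 (trig_basis trig i) (trig_basis trig j) = if i == j then 2^-1 else 0.
Proof.
move=> trigM; rewrite /ip /trig_basis; under eq_Rintegral do
  rewrite trigM -mulrBl -mulrDl -[_ + _]mulr1.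
rewrite -/(ip 0 1 (fun x => 2^-1 * cos ((bfreq i - bfreq j) * x) +
   2^-1 * c * cos ((bfreq i + bfreq j) * x)) (fun=> 1)).
have Lc v : L2r 0 1 (fun x => cos (v * x)) by exact: L2r_cos.
rewrite ipDl ?ipZl //; try by [exact: L2rZ | exact: L2r_cst].
rewrite !integral_cos_zero ?sinB ?sinD ?sin_bfreq ?mul0r ?mulr0 ?subr0 ?addr0 //.
rewrite bfreq_eq [_ + _ == 0]gt_eqF ?addr_gt0 ?bfreq_gt0 // mulr0 addr0.
by case: (i == j); rewrite ?mulr1 ?mulr0.
Qed.

Lemma basis_sin_orthogonal i j :
  ip 0 1 (trig_basis sin i) (trig_basis sin j) = if i == j then 2^-1 else 0 :> R.
Proof.
by apply: (@basis_orthogonal (-1)) => x y; rewrite cosB cosD; field.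
Qed.

Lemma basis_cos_orthogonal i j :
  ip 0 1 (trig_basis cos i) (trig_basis cos j) = if i == j then 2^-1 else 0 :> R.
Proof.
by apply: (@basis_orthogonal 1) => x y; rewrite cosB cosD; field.
Qed.

Lemma wderiv_id : wderiv (fun x : R => x) (fun=> 1).
Proof.
split=> [|x /andP[x0 _]]; first exact: L2r_cst.
rewrite add0r Rintegral_cst //= lebesgue_measure_itv /= lte_fin mul1r.
by case: ltP => [_|/(conj x0)/andP/le_anti<-] //=; rewrite subr0.
Qed.

Lemma by_parts_sin f g n : wderiv f g ->
  ip 0 1 g (trig_basis sin n) = - bfreq n * ip 0 1 f (trig_basis cos n).
Proof.
move=> fg.
have d (z : R) : is_derive z 1 (fun x => sin (bfreq n * x)) (bfreq n * cos (bfreq n * z)).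
  by apply: is_derive_eq; rewrite ?scaler0 ?add0r ?addr0 /GRing.scale /= ?mulr1; ring.
rewrite (wderiv_by_parts fg d (L := bfreq n)).
- rewrite !mulr1 sin_bfreq (mulr0 (bfreq n)) sin0 !mulr0 subrr sub0r mulNr ipZr //.
    exact: L2r_cos.
  exact: wderiv_L2r fg.
- by move=> z; apply: cvgM; [exact: cvg_cst | exact: continuous_cosM].
- move=> z; rewrite normrM (gtr0_norm (bfreq_gt0 n)) ler_piMr ?(ltW (bfreq_gt0 n)) //.
  by rewrite ler_norml cos_geN1 cos_le1.
Qed.

Lemma by_parts_cos f g n : wderiv f g -> ip 0 1 g (trig_basis cos n) =
  (-1) ^+ n.+1 * f 1 - f 0 + bfreq n * ip 0 1 f (trig_basis sin n).
Proof.
move=> fg.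
have d (z : R) : is_derive z 1 (fun x => cos (bfreq n * x)) (- bfreq n * sin (bfreq n * z)).
  by apply: is_derive_eq; rewrite ?scaler0 ?add0r ?addr0 /GRing.scale /= ?mulr1; ring.
rewrite (wderiv_by_parts fg d (L := bfreq n)).
- rewrite !mulr1 cos_bfreq (mulr0 (bfreq n)) cos0 mulr1 ipZr ?mulNr ?opprK 1?mulrC //.
    exact: L2r_sin.
  exact: wderiv_L2r fg.
- by move=> z; apply: cvgM; [exact: cvg_cst | exact: continuous_sinM].
- move=> z; rewrite normrM normrN (gtr0_norm (bfreq_gt0 n)) ler_piMr ?(ltW (bfreq_gt0 n)) //.
  by rewrite ler_norml sin_geN1 sin_le1.
Qed.

Definition sawtooth_sum N x : R :=
  \sum_(n < N) 2 * (-1) ^+ n / bfreq n * trig_basis sin n x.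

Lemma L2r_sawtooth N : L2r 0 1 (sawtooth_sum N).
Proof. by apply: L2r_sum => n; apply: L2rZ; exact: L2r_sin. Qed.

Lemma ip_id_sin n : ip 0 1 (fun x : R => x) (trig_basis sin n) = (-1) ^+ n / bfreq n.
Proof.
have /= := by_parts_cos n wderiv_id.
rewrite ipC integral_cos_zero ?sin_bfreq // gt_eqF ?bfreq_gt0 //.
rewrite mulr1 subr0 exprS mulN1r => /eqP; rewrite eq_sym addrC subr_eq0 => /eqP <-.
by rewrite mulrC mulKf // gt_eqF ?bfreq_gt0.
Qed.

Lemma ip_id_id : ip 0 1 (fun x : R => x) (fun x : R => x) = 3^-1.
Proof.
have d (z : R) : is_derive z 1 (fun x : R => 3^-1 * (x * (x * x))) (z * z).
  by apply: is_derive_eq; rewrite ?scaler0 ?addr0 /GRing.scale /= ?mulr1; field.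
rewrite /ip (@Rintegral_FTC _ (-1) 0 1 _ _ _ _ _ (fun z _ => d z)) ?ltrN10 ?ltr01 //.
- by rewrite !mulr1 !mul0r mulr0 subr0.
- by move=> z; apply: cvgM; exact: cvg_id.
Qed.

(** By orthogonality the squared distance from [x] to its truncated sine
    series is [1/3] minus the sum of the [2 / (n pi)^2]: convergence amounts
    to the value of the sum of the inverse squares. *)
Lemma sawtooth_cvg (e : R) : 0 < e -> exists N0, forall N, (N0 <= N)%N ->
  nrm 0 1 (fun x => x - sawtooth_sum N x) <= e.
Proof.
move=> e0.
have pi0 := pi_gt0 R.
have e1 : 0 < pi ^+ 2 / 2 * e ^+ 2 by rewrite mulr_gt0 ?divr_gt0 ?exprn_gt0.
have [N0 hN0] := inverse_squares_lower e1.
exists N0 => N NN.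
have Lid := wderiv_L2r wderiv_id.
rewrite -(@ler_pXn2r _ 2) ?nnegrE ?nrm_ge0 ?(ltW e0) // sqr_nrm.
rewrite ip_sqrB ?ip_id_id //; last exact: L2r_sawtooth.
have S n : L2r 0 1 (fun x => 2 * (-1) ^+ n / bfreq n * trig_basis sin n x).
  by apply: L2rZ; exact: L2r_sin.
have E : ip 0 1 (fun x => x) (sawtooth_sum N) = 2 / pi ^+ 2 * inverse_squares R N.
  rewrite /sawtooth_sum (ip_sumr _ (fun n : 'I_N => S n)) // /inverse_squares mulr_sumr.
  apply: eq_bigr => n _; rewrite ipZr ?ip_id_sin //; last exact: L2r_sin.
  have : ((-1) ^+ n : R) * (-1) ^+ n = 1 by rewrite -expr2 sqrr_sign.
  move: ((-1) ^+ n) => v vv; rewrite mulrACA -!mulrA (mulrA v v) vv mul1r.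
  by rewrite -invfM -expr2 /bfreq exprMn [_ * pi ^+ 2]mulrC invfM.
have -> : ip 0 1 (sawtooth_sum N) (sawtooth_sum N) = 2 / pi ^+ 2 * inverse_squares R N.
  rewrite -E {1 3}/sawtooth_sum ip_suml // ?(ip_sumr _ (fun n : 'I_N => S n)) //; last first.
    exact: L2r_sawtooth.
  apply: eq_bigr => n _; rewrite !ipZl ?ipZr //; try by [exact: L2r_sin| exact: L2r_sawtooth].
  congr (_ * _); rewrite ip_id_sin /sawtooth_sum ip_sumr //; last exact: L2r_sin.
  rewrite (bigD1 n) //= big1 ?addr0 => [|m mn].
    rewrite ipZr ?basis_sin_orthogonal ?eqxx; try exact: L2r_sin.
    by rewrite -!mulrA mulrCA (mulrCA 2) divff // mulr1.
  rewrite ipZr ?basis_sin_orthogonal; try exact: L2r_sin.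
  by rewrite eq_sym (inj_eq val_inj) (negbTE mn) mulr0.
rewrite E; have := hN0 N NN; move: (inverse_squares R N) => v hv.
have rest (p u : R) : 0 < p -> p ^+ 2 / 6 - p ^+ 2 / 2 * e ^+ 2 <= u ->
    3^-1 - 2 * (2 / p ^+ 2 * u) + 2 / p ^+ 2 * u <= e ^+ 2.
  move=> p0 hu; have p20 : 0 < p ^+ 2 by exact: exprn_gt0.
  move: (p ^+ 2) p20 hu => q q0 hu.
  have -> : 3^-1 - 2 * (2 / q * u) + 2 / q * u = (q / 6 - u) * (2 / q) by field; exact: lt0r_neq0.
  have -> : e ^+ 2 = (q / 2 * e ^+ 2) * (2 / q) by field; exact: lt0r_neq0.
  by rewrite ler_wpM2r ?divr_ge0 ?(ltW q0) //; lra.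
exact: rest.
Qed.

(** As [w] has zero mean, [w 1] is the integral of [x * g x]. Expanding [x] in
    sines and integrating each term back by parts gives the series; it
    converges because the sine series of [x] converges in the mean. *)
Lemma boundary_value_series (w g : R -> R) : wderiv w g -> ip 0 1 w (fun=> 1) = 0 ->
  \sum_(n < N) 2 * (-1) ^+ n.+1 * ip 0 1 w (trig_basis cos n) @[N --> \oo] --> w 1.
Proof.
move=> wg w0.
have Lg : L2r 0 1 g by case: wg.
have id1 : ip 0 1 g (fun x => x) = w 1.
  rewrite (@wderiv_by_parts _ w g (fun x => x) (fun=> 1) 1) // ?w0 ?mulr1 ?mulr0 ?subr0 //.
  - by move=> z; exact: cvg_cst.
  - by move=> _; rewrite normr1.
have idS N : ip 0 1 g (sawtooth_sum N) =
   \sum_(n < N) 2 * (-1) ^+ n.+1 * ip 0 1 w (trig_basis cos n).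
  rewrite /sawtooth_sum (@ip_sumr _ _ _ (fun n : 'I_N => fun x => _)) //; last first.
    by move=> n; apply: L2rZ; exact: L2r_sin.
  apply: eq_bigr => n _; rewrite ipZr //; last exact: L2r_sin.
  by rewrite (by_parts_sin n wg) exprS; field; rewrite gt_eqF ?bfreq_gt0.
have Lid := wderiv_L2r wderiv_id.
apply/cvgrPdist_le => e e0.
have [N0 hN0] := sawtooth_cvg (divr_gt0 e0 (ltr_pwDr ltr01 (nrm_ge0 0 1 g))).
exists N0 => // N /= NN.
rewrite -idS -id1 -ipBr //; last exact: L2r_sawtooth.
apply: le_trans (normr_ip Lg (L2rB Lid (L2r_sawtooth N))) _.
apply: le_trans (ler_wpM2l (nrm_ge0 0 1 g) (hN0 N NN)) _.
have n1 := ltr_pwDr ltr01 (nrm_ge0 0 1 g).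
rewrite mulrCA ler_piMr ?(ltW e0) // ler_pdivrMr // mul1r.
by rewrite ler_wpDr // .
Qed.

End TrigBasis.

(** * Modal amplitudes *)

Section ModalAmplitudes.
Variable R : realType.
Variables (vp : R) (k0 : nat).
Hypothesis vp0 : 0 < vp.
Hypothesis k00 : (0 < k0)%N.
Implicit Types (n : nat) (i : nat * bool) (A B : nat -> R).

Definition branch_sign (b : bool) : R := if b then 1 else -1.

Definition shear_coef A B n : R := bfreq R n * A n + B n.

(** The combination of a sine coefficient [A] of the displacement and a cosine
    coefficient [B] of the rotation that oscillates at the single frequency
    [freq vp k0 i]. The normalization, with the sign of [cos (n pi x)] at [x =
    1], is the one for which the two branches add up to a term of the boundary
    value. *)
Definition cos_amp A B i : R :=
  (-1) ^+ i.1.+1 * (freq vp k0 i * shear_coef A B i.1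
    + branch_sign i.2 * (wave_num vp i.1 ^+ 2 / (2 * half_gap vp k0)) * B i.1)
  / disp_root vp k0 i.1.

(** The amplitude in quadrature with [cos_amp], computed from the velocities. *)
Definition sin_amp A B i : R :=
  (-1) ^+ i.1.+1 * (bfreq R i.1 * A i.1
    + branch_sign i.2 * (freq vp k0 i / (2 * half_gap vp k0)) * B i.1)
  / disp_root vp k0 i.1.

Lemma freqE i : freq vp k0 i = disp_root vp k0 i.1 + branch_sign i.2 * half_gap vp k0.
Proof. by rewrite /freq /branch_sign; case: i.2; rewrite ?mul1r ?mulN1r. Qed.

Lemma sqr_freq i : freq vp k0 i ^+ 2 =
  2 * branch_sign i.2 * half_gap vp k0 * freq vp k0 i + wave_num vp i.1 ^+ 2.
Proof.
rewrite freqE; have := sqr_disp_root vp k0 i.1.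
have : branch_sign i.2 ^+ 2 = 1 by rewrite /branch_sign; case: i.2; rewrite ?sqrrN expr1n.
move: (branch_sign _) (disp_root _ _ _) (half_gap _ _) (wave_num _ _) => s d g w ss dd.
by ring: ss dd.
Qed.

Lemma cos_amp_rate A B i : cos_amp A B i = freq vp k0 i * sin_amp A B i.
Proof.
have g0 := half_gap_gt0 vp0 k00; have [_ gs] := disp_root_gt vp0 k00 i.1.
have := sqr_freq i; rewrite /cos_amp /sin_amp /shear_coef.
have : branch_sign i.2 ^+ 2 = 1 by rewrite /branch_sign; case: i.2; rewrite ?sqrrN expr1n.
move: (branch_sign _) (disp_root _ _ _) (half_gap _ _) (wave_num _ _) (freq _ _ _) g0 gs
  => s d g w f g0 gd ss ff.
have -> : w ^+ 2 = f ^+ 2 - 2 * s * g * f by rewrite ff addrAC subrr add0r.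
have s1 : s * (s * f) = f by rewrite mulrA -expr2 ss mul1r.
field: ss; apply/andP; split; apply: lt0r_neq0 => //; exact: lt_trans gd.
Qed.

(** The two sequences are the accelerations prescribed by the system. As in
    [cos_amp_rate], the identity is the quadratic equation [sqr_freq] of the
    frequency. *)
Lemma sin_amp_rate (c : R) A B i : wave_num vp i.1 ^+ 2 = c * bfreq R i.1 ^+ 2 ->
  sin_amp (fun n => - c * bfreq R n * shear_coef A B n)
    (fun n => - (wave_num vp n ^+ 2 * B n + (2 * half_gap vp k0) ^+ 2 * shear_coef A B n)) i
  = - freq vp k0 i * cos_amp A B i.
Proof.
have g0 := half_gap_gt0 vp0 k00; have [_ gs] := disp_root_gt vp0 k00 i.1.
have := sqr_freq i; rewrite /cos_amp /sin_amp.
have : branch_sign i.2 ^+ 2 = 1 by rewrite /branch_sign; case: i.2; rewrite ?sqrrN expr1n.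
move: (shear_coef A B i.1) (branch_sign _) (disp_root _ _ _) (half_gap _ _) (wave_num _ _)
  (freq _ _ _) g0 gs => C s d g w f g0 gd ss ff wc.
have -> : bfreq R i.1 * (- c * bfreq R i.1 * C) = - w ^+ 2 * C by rewrite wc; ring.
have -> : w ^+ 2 = f ^+ 2 - 2 * s * g * f by rewrite ff addrAC subrr add0r.
field: ss; apply/andP; split; apply: lt0r_neq0 => //; exact: lt_trans gd.
Qed.

Lemma cos_amp_sum A B n : cos_amp A B (n, true) + cos_amp A B (n, false) =
  2 * (-1) ^+ n.+1 * shear_coef A B n.
Proof.
have [_ gs] := disp_root_gt vp0 k00 n; have g0 := half_gap_gt0 vp0 k00.
rewrite /cos_amp !freqE /=.
move: (shear_coef A B n) (disp_root _ _ _) (half_gap _ _) g0 gs => C d g g0 gd.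
by field; apply/andP; split; apply: lt0r_neq0 => //; exact: lt_trans gd.
Qed.

Lemma sqr_comb_le (L c d x y : R) : `|c| <= L -> `|d| <= L ->
  (c * x + d * y) ^+ 2 <= 2 * L ^+ 2 * (x ^+ 2 + y ^+ 2).
Proof.
move=> cL dL.
have le2 (u v : R) : `|u| <= L -> (u * v) ^+ 2 <= L ^+ 2 * v ^+ 2.
  move=> uL; rewrite exprMn ler_wpM2r ?sqr_ge0 // -(real_normK (num_real u)).
  by rewrite lerXn2r ?nnegrE ?(le_trans _ uL).
have := le2 c x cL; have := le2 d y dL; have := sqr_ge0 (c * x - d * y); lra.
Qed.

Lemma freq_le i : freq vp k0 i <= 2 * disp_root vp k0 i.1.
Proof.
have [_ gs] := disp_root_gt vp0 k00 i.1; have g0 := half_gap_gt0 vp0 k00.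
by rewrite freqE /branch_sign; case: i.2; lra.
Qed.

Lemma norm_sign_mul n (x : R) : `|(-1) ^+ n * x| = `|x|.
Proof. by rewrite normrM normr_sign mul1r. Qed.

Lemma norm_branch_mul b (x : R) : `|branch_sign b * x| = `|x|.
Proof. by case: b; rewrite /branch_sign ?mul1r // mulN1r normrN. Qed.

(** The change of variables is bounded uniformly in [n] once [B] is measured
    by [n * B], that is, by the derivative of the rotation. *)
Lemma amp_sq_upper : exists2 K : R, 0 < K & forall A B A1 B1 i,
  amp_sq (cos_amp A B) (sin_amp A1 B1) i <= K * (shear_coef A B i.1 ^+ 2
    + (bfreq R i.1 * B i.1) ^+ 2 + (A1 i.1 ^+ 2 + B1 i.1 ^+ 2)).
Proof.
have g0 := half_gap_gt0 vp0 k00; have pi0 := pi_gt0 R.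
have [g gE] : exists g, g = half_gap vp k0 by exists (half_gap vp k0).
rewrite -gE in g0.
pose L : R := 2 + vp / (2 * g * pi) + pi / vp + g^-1.
have e1 : 0 < vp / (2 * g * pi) by rewrite divr_gt0 ?mulr_gt0.
have e2 : 0 < pi / vp by rewrite divr_gt0.
have e3 : 0 < g^-1 by rewrite invr_gt0.
exists (2 * L ^+ 2); first by rewrite mulr_gt0 ?exprn_gt0 // /L; lra.
move=> A B A1 B1 [n b] /=.
have [ws gs] := disp_root_gt vp0 k00 n; have fle := freq_le (n, b); have f0 := freq_gt0 vp0 k00 (n, b).
have w0 := wave_num_gt0 vp0 n; have m0 := bfreq_gt0 R n.
rewrite -gE in gs; rewrite /= in fle.
have s0 : 0 < disp_root vp k0 n by exact: lt_trans gs.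
rewrite mulrDr; apply: lerD.
  have -> : cos_amp A B (n, b) = (-1) ^+ n.+1 * (freq vp k0 (n, b) / disp_root vp k0 n) * shear_coef A B n
    + (-1) ^+ n.+1 * (branch_sign b * (wave_num vp n ^+ 2 / (2 * g * disp_root vp k0 n * bfreq R n)))
      * (bfreq R n * B n).
    rewrite /cos_amp -?gE /=; move: (bfreq R n) m0 => m m0.
    move: (shear_coef _ _ _) => C.
    move: g0 s0 m0; clear; move: g (disp_root _ _ _) (freq _ _ _) (wave_num _ _) => h d f w h0 d0 m0.
    by field; rewrite !lt0r_neq0.
  apply: sqr_comb_le; rewrite norm_sign_mul ?norm_branch_mul ger0_norm.
  - by apply: (@le_trans _ _ 2); [rewrite ler_pdivrMr | rewrite /L; lra].
  - by rewrite divr_ge0 // ltW.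
  - apply: (@le_trans _ _ (vp / (2 * g * pi))); last by rewrite /L; lra.
    have -> : vp / (2 * g * pi) = wave_num vp n ^+ 2 / (2 * g * wave_num vp n * bfreq R n).
      rewrite /wave_num /bfreq; move: g0 vp0 (ltr0Sn R n) pi0; clear; move: g vp (n.+1%:R) (pi : R) => h v x p h0 v0 x0 p0.
      by field; rewrite !lt0r_neq0.
    rewrite ler_pM2l ?exprn_gt0 // lef_pV2 ?posrE ?mulr_gt0 // ler_pM2r // ler_pM2l ?mulr_gt0 //.
    exact: ltW.
  - by rewrite divr_ge0 ?sqr_ge0 // ltW // !mulr_gt0.
have -> : sin_amp A1 B1 (n, b) = (-1) ^+ n.+1 * (bfreq R n / disp_root vp k0 n) * A1 n
    + (-1) ^+ n.+1 * (branch_sign b * (freq vp k0 (n, b) / (2 * g * disp_root vp k0 n))) * B1 n.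
  rewrite /sin_amp -?gE /=; move: (bfreq R n) m0 => m m0.
  move: g0 s0 m0; clear; move: g (disp_root _ _ _) (freq _ _ _) => h d f h0 d0 m0.
  by field; rewrite !lt0r_neq0.
apply: sqr_comb_le; rewrite norm_sign_mul ?norm_branch_mul ger0_norm.
- apply: (@le_trans _ _ (pi / vp)); last by rewrite /L; lra.
  have -> : pi / vp = bfreq R n / wave_num vp n.
    by rewrite /wave_num /bfreq invfM mulrACA divff ?mul1r // pnatr_eq0.
  by rewrite ler_pM2l // lef_pV2 ?posrE // ltW.
- by rewrite divr_ge0 // ltW.
- apply: (@le_trans _ _ g^-1); last by rewrite /L; lra.
  rewrite ler_pdivrMr ?mulr_gt0 //; apply: le_trans fle _.
  have -> // : g^-1 * (2 * g * disp_root vp k0 n) = 2 * disp_root vp k0 n.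
  by move: g0; clear; move: g => h h0; field; exact: lt0r_neq0.
- by rewrite divr_ge0 ?(ltW f0) // ltW // !mulr_gt0.
Qed.

(** In the inverse change of variables the displacements gain a factor [1/n]
    over the velocities: this is the difference between the weights of the two
    dual norms. *)
Lemma coef_sq_upper : exists2 K : R, 0 < K & forall A B A1 B1 n,
  (n.+1%:R ^+ 2)^-1 * (A n ^+ 2 + B n ^+ 2) + (n.+1%:R ^+ 4)^-1 * (A1 n ^+ 2 + B1 n ^+ 2)
  <= K * ((n.+1%:R ^+ 4)^-1 *
    (amp_sq (cos_amp A B) (sin_amp A1 B1) (n, true) + amp_sq (cos_amp A B) (sin_amp A1 B1) (n, false))).
Proof.
have g0 := half_gap_gt0 vp0 k00; have pi0 := pi_gt0 R.
have [g gE] : exists g, g = half_gap vp k0 by exists (half_gap vp k0).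
rewrite -gE in g0.
pose L := vp + g; have L0 : 0 < L by rewrite addr_gt0.
pose b := 2 * g * L / vp ^+ 2.
have b0 : 0 < b by rewrite divr_gt0 ?exprn_gt0 // !mulr_gt0.
pose K := 1 + 6 * b ^+ 2 + 2 * g ^+ 2 + 2 * L ^+ 2.
have K1 : 1 + 6 * b ^+ 2 <= K by rewrite /K -addrA lerDl addr_ge0 // mulr_ge0 ?sqr_ge0.
have K2 : 2 * g ^+ 2 + 2 * L ^+ 2 <= K.
  by rewrite /K -addrA lerDr addr_ge0 // mulr_ge0 ?sqr_ge0.
exists K; first by rewrite (lt_le_trans _ K1) // ltr_pwDl // mulr_ge0 ?sqr_ge0.
move=> A B A1 B1 n.
have n0 : 0 < n.+1%:R :> R by rewrite ltr0n.
have n1 : 1 <= n.+1%:R :> R by rewrite ler1n.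
have [ws gs] := disp_root_gt vp0 k00 n; have s0 : 0 < disp_root vp k0 n by exact: lt_trans (wave_num_gt0 vp0 n) ws.
have w0 := wave_num_gt0 vp0 n; have m0 := bfreq_gt0 R n.
have sw := sqr_disp_root vp k0 n; have sle := disp_root_le vp0 k00 n.
rewrite -gE in gs sw sle.
have wL : wave_num vp n + g <= L * n.+1%:R.
  by rewrite /L mulrDl /wave_num (mulrC vp) lerD2l ler_peMr // ltW.
have fb c : `|freq vp k0 (n, c)| <= 2 * L * n.+1%:R.
  by rewrite gtr0_norm ?freq_gt0 //; have /= := freq_le (n, c); lra.
have mn : n.+1%:R <= bfreq R n.
  by rewrite ler_peMr ?(ltW n0) //; have := pi_ge2 R; lra.
set X := cos_amp A B; set Y := sin_amp A1 B1.
set C := shear_coef A B n.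
have ss : ((-1) ^+ n.+1 : R) ^+ 2 = 1 by rewrite sqrr_sign.
have EC : C = (-1) ^+ n.+1 * (2^-1 * X (n, true) + 2^-1 * X (n, false)).
  by rewrite -mulrDr cos_amp_sum -/C; move: ((-1) ^+ n.+1) ss => s ss; field: ss.
have EB : B n = (-1) ^+ n.+1 * (g / wave_num vp n ^+ 2 * freq vp k0 (n, false) * X (n, true)
    + - (g / wave_num vp n ^+ 2 * freq vp k0 (n, true)) * X (n, false)).
  rewrite /X /cos_amp -?gE -/C !freqE /= -?gE.
  move: ((-1) ^+ n.+1) ss => s ss.
  move: sw s0 w0 g0; clear -ss; move: (disp_root _ _ _) (wave_num _ _) g => d w h sw d0 w0 h0.
  by field: ss; rewrite !lt0r_neq0.
have EB1 : B1 n = (-1) ^+ n.+1 * (g * Y (n, true) + - g * Y (n, false)).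
  rewrite /Y /sin_amp -?gE !freqE /= -?gE; move: ((-1) ^+ n.+1) ss => s ss.
  move: s0 g0; clear -ss; move: (disp_root _ _ _) g => d h d0 h0.
  by field: ss; rewrite !lt0r_neq0.
have EA1 : A1 n = (-1) ^+ n.+1 * (freq vp k0 (n, false) / (2 * bfreq R n) * Y (n, true)
    + freq vp k0 (n, true) / (2 * bfreq R n) * Y (n, false)).
  rewrite /Y /sin_amp -?gE !freqE /= -?gE; move: ((-1) ^+ n.+1) ss => s ss.
  move: s0 g0 m0; clear -ss; move: (bfreq R n) (disp_root _ _ _) g => m d h d0 h0 m0.
  by field: ss; rewrite !lt0r_neq0.
have EA : A n = (C - B n) / bfreq R n by rewrite /C /shear_coef; move: (bfreq R n) m0 => m m0; field; exact: lt0r_neq0.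
have bnd (z x y c d M : R) : z = (-1) ^+ n.+1 * (c * x + d * y) -> `|c| <= M -> `|d| <= M ->
    z ^+ 2 <= 2 * M ^+ 2 * (x ^+ 2 + y ^+ 2).
  by move=> -> hc hd; rewrite exprMn ss mul1r; exact: sqr_comb_le.
have h2 : `|2^-1 : R| <= 2^-1 by rewrite gtr0_norm.
have hC := bnd _ _ _ _ _ _ EC h2 h2.
have cB c : `|g / wave_num vp n ^+ 2 * freq vp k0 (n, c)| <= b / n.+1%:R.
  have w2 : 0 < g / wave_num vp n ^+ 2 by rewrite divr_gt0 ?exprn_gt0.
  rewrite normrM (gtr0_norm w2); apply: le_trans (ler_wpM2l (ltW w2) (fb c)) _.
  rewrite /b /wave_num; move: n0 vp0; clear; move: (n.+1%:R) vp => x v x0 v0.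
  by rewrite le_eqVlt; apply/orP; left; apply/eqP; field; rewrite !lt0r_neq0.
have hB : B n ^+ 2 <= 2 * (b / n.+1%:R) ^+ 2 * (X (n, true) ^+ 2 + X (n, false) ^+ 2).
  by apply: bnd EB _ _; rewrite ?normrN.
have hB1 : B1 n ^+ 2 <= 2 * g ^+ 2 * (Y (n, true) ^+ 2 + Y (n, false) ^+ 2).
  by apply: bnd EB1 _ _; rewrite ?normrN gtr0_norm.
have cA c : `|freq vp k0 (n, c) / (2 * bfreq R n)| <= L.
  rewrite normrM (@gtr0_norm _ (_^-1)) ?invr_gt0 ?mulr_gt0 // ler_pdivrMr ?mulr_gt0 //.
  apply: le_trans (fb c) _; rewrite mulrCA mulrA ler_wpM2l // mulr_ge0 // ltW //.
have hA1 : A1 n ^+ 2 <= 2 * L ^+ 2 * (Y (n, true) ^+ 2 + Y (n, false) ^+ 2).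
  exact: bnd EA1 _ _.
set p := X (n, true) ^+ 2 + X (n, false) ^+ 2 in hB hC *.
set q := Y (n, true) ^+ 2 + Y (n, false) ^+ 2 in hA1 hB1 *.
have p0 : 0 <= p by rewrite addr_ge0 ?sqr_ge0.
have q0 : 0 <= q by rewrite addr_ge0 ?sqr_ge0.
have -> : amp_sq X Y (n, true) + amp_sq X Y (n, false) = p + q by rewrite /amp_sq /p /q; ring.
have i2 : 0 < (n.+1%:R ^+ 2)^-1 :> R by rewrite invr_gt0 exprn_gt0.
have E4 : (n.+1%:R ^+ 4)^-1 = (n.+1%:R ^+ 2)^-1 * (n.+1%:R ^+ 2)^-1 :> R by rewrite -invfM -exprD.
have hB' : B n ^+ 2 <= (n.+1%:R ^+ 2)^-1 * (2 * b ^+ 2 * p).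
  by apply: le_trans hB _; rewrite exprMn exprVn; move: (_ ^-1) => u; lra.
have u1 : (n.+1%:R ^+ 2)^-1 <= 1 :> R by rewrite invf_le1 ?exprn_gt0 // exprn_ege1.
have hA : A n ^+ 2 <= (n.+1%:R ^+ 2)^-1 * ((1 + 4 * b ^+ 2) * p).
  rewrite EA exprMn exprVn mulrC.
  have hm : (bfreq R n ^+ 2)^-1 <= (n.+1%:R ^+ 2)^-1.
    rewrite lef_pV2 ?posrE; [|exact: exprn_gt0|exact: exprn_gt0].
    by rewrite lerXn2r ?nnegrE // ltW.
  apply: ler_pM hm _; rewrite ?invr_ge0 ?sqr_ge0 //.
  have hb : B n ^+ 2 <= 2 * b ^+ 2 * p.
    by apply: le_trans hB' _; rewrite ler_piMl // mulr_ge0 // mulr_ge0 // sqr_ge0.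
  by have := sqr_ge0 (C + B n); lra.
rewrite E4; move: (_ ^-1) i2 u1 hA hB' => u u0 u1 hA hB'.
have h1 : u * (A n ^+ 2 + B n ^+ 2) <= u * (u * (K * p)).
  rewrite ler_wpM2l ?(ltW u0) //.
  apply: le_trans (lerD hA hB') _; rewrite -mulrDr ler_wpM2l ?(ltW u0) //.
  by apply: le_trans (ler_wpM2r p0 K1); lra.
have h3 : u * u * (A1 n ^+ 2 + B1 n ^+ 2) <= u * u * (K * q).
  rewrite ler_wpM2l ?mulr_ge0 ?(ltW u0) //.
  by apply: le_trans (ler_wpM2r q0 K2); lra.
lra.
Qed.

End ModalAmplitudes.

Local Open Scope complex_scope.

(** * Real and imaginary parts *)

Section ComplexParts.
Variable R : realType.
Local Notation mu := (@lebesgue_measure R).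
Implicit Types (a b x : R) (p : bool) (f g : R -> R[i]) (n N : nat).

Definition cpart p (z : R[i]) : R := if p then complex.Re z else complex.Im z.

Definition fpart p f : R -> R := fun x => cpart p (f x).

Lemma cpartD p (y z : R[i]) : cpart p (y + z) = cpart p y + cpart p z.
Proof. by case: p; case: y; case: z. Qed.

Lemma cpartB p (y z : R[i]) : cpart p (y - z) = cpart p y - cpart p z.
Proof. by case: p; case: y; case: z. Qed.

Lemma cpart0 p : cpart p 0 = 0.
Proof. by case: p. Qed.

Lemma cpartZ p (c : R) (z : R[i]) : cpart p (c%:C * z) = c * cpart p z.
Proof. by case: p; case: z => x y /=; rewrite mul0r ?subr0 ?addr0. Qed.

Lemma cpart_sum p N (F : nat -> R[i]) :
  cpart p (\sum_(0 <= n < N) F n) = \sum_(n < N) cpart p (F n).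
Proof.
rewrite big_mkord; elim: N => [|N IH]; first by rewrite !big_ord0 cpart0.
by rewrite !big_ord_recr /= cpartD IH.
Qed.

Lemma sqr_normc (z : R[i]) : Normc.normc z ^+ 2 = cpart true z ^+ 2 + cpart false z ^+ 2.
Proof. by case: z => x y /=; rewrite sqr_sqrtr // addr_ge0 ?sqr_ge0. Qed.

Definition cnorm_sq a b f : R :=
  ip a b (fpart true f) (fpart true f) + ip a b (fpart false f) (fpart false f).

Lemma cnorm_sq_ge0 a b f : 0 <= cnorm_sq a b f.
Proof. by rewrite addr_ge0 ?ip_ge0. Qed.

Lemma ip_le_cnorm_sq a b f p : ip a b (fpart p f) (fpart p f) <= cnorm_sq a b f.
Proof. by case: p; rewrite /cnorm_sq ?lerDl ?lerDr ip_ge0. Qed.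

Lemma measurable_sq a b (h : R -> R) : measurable_fun `]a, b[ h ->
  measurable_fun `]a, b[ (fun x => (h x ^+ 2)%:E).
Proof. by move=> mh; apply/measurable_EFinP; exact: measurable_funX. Qed.

Lemma l2sqE a b f : (forall p, L2r a b (fpart p f)) ->
  l2sq a b f = (cnorm_sq a b f)%:E.
Proof.
move=> Lf; rewrite /l2sq /cnorm_sq.
have [mr ir] := Lf true; have [mi ii] := Lf false.
under eq_integral do rewrite sqr_normc EFinD.
have ge p : (0 <= \int[mu]_(x in `]a, b[) ((fpart p f x ^+ 2)%:E))%E.
  by apply: integral_ge0 => x _; rewrite lee_fin sqr_ge0.
rewrite ge0_integralD //=.
- rewrite EFinD; congr (_ + _)%E; rewrite /ip /Rintegral fineK //.
  + exact: integrable_fin_num.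
  + exact: integrable_fin_num.
- by move=> x _; rewrite lee_fin sqr_ge0.
- exact: measurable_sq.
- by move=> x _; rewrite lee_fin sqr_ge0.
- exact: measurable_sq.
Qed.

Lemma L2P a b f : L2 a b f <-> forall p, L2r a b (fpart p f).
Proof.
split=> [[mr mi fin] p|Lf]; last first.
  split; [exact: (Lf true).1 | exact: (Lf false).1 | by rewrite l2sqE // ltry].
have mp : measurable_fun `]a, b[ (fpart p f) by case: p.
split=> //; apply/integrableP; split; first exact: measurable_sq.
apply: le_lt_trans fin; apply: ge0_le_integral => //.
- by apply/measurableT_comp => //; exact: measurable_sq.
- rewrite (_ : (fun x => _) = fun x => (fpart true f x ^+ 2 + fpart false f x ^+ 2)%:E).
    by apply/measurable_EFinP; apply: measurable_funD; exact: measurable_funX.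
  by apply/funext => x; rewrite sqr_normc.
- move=> x _ /=; rewrite lee_fin ger0_norm ?sqr_ge0 // sqr_normc /fpart.
  by case: p {mp}; rewrite ?lerDl ?lerDr sqr_ge0.
Qed.

Lemma is_weak_derivP f g : is_weak_deriv f g <-> forall p, wderiv (fpart p f) (fpart p g).
Proof.
split=> [[Lg fE] p|W].
  split=> [|x x01]; first by have /L2P := Lg; apply.
  by rewrite /fpart (fE x x01) cpartD; congr (_ + _); case: p.
split=> [|x x01]; first by apply/L2P => p; have [] := W p.
have h p : cpart p (f x) = cpart p (f 0 + cintegral 0 x g).
  by have [_ /(_ x x01)] := W p; rewrite /fpart cpartD => ->; congr (_ + _); case: p.
by have := (h true, h false); case: (f x) => u v; case: (_ + _) => u' v' /= [-> ->].
Qed.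

Lemma wderivB (f g f' g' : R -> R) : wderiv f g -> wderiv f' g' ->
  wderiv (fun x => f x - f' x) (fun x => g x - g' x).
Proof.
move=> W W'; have [Lg fE] := W; have [Lg' fE'] := W'; split; first exact: L2rB.
move=> x x01; rewrite (fE x x01) (fE' x x01) RintegralB //; first by ring.
- by apply: integrable_sub (wderiv_integrable W) => //; case/andP: x01.
- by apply: integrable_sub (wderiv_integrable W') => //; case/andP: x01.
Qed.

Lemma wderivD (f g f' g' : R -> R) : wderiv f g -> wderiv f' g' ->
  wderiv (fun x => f x + f' x) (fun x => g x + g' x).
Proof.
move=> W W'; have [Lg fE] := W; have [Lg' fE'] := W'; split; first exact: L2rD.
move=> x x01; rewrite (fE x x01) (fE' x x01) RintegralD //; first by ring.
- by apply: integrable_sub (wderiv_integrable W) => //; case/andP: x01.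
- by apply: integrable_sub (wderiv_integrable W') => //; case/andP: x01.
Qed.

Lemma wderivZ (c : R) (f g : R -> R) : wderiv f g ->
  wderiv (fun x => c * f x) (fun x => c * g x).
Proof.
move=> W; have [Lg fE] := W; split; first exact: L2rZ.
move=> x x01; rewrite (fE x x01) mulrDr RintegralZl //.
by apply: integrable_sub (wderiv_integrable W) => //; case/andP: x01.
Qed.

Lemma fpartB p f g : fpart p (f - g) = (fun x => fpart p f x - fpart p g x).
Proof. by apply/funext => x; rewrite /fpart cpartB. Qed.

Lemma fpartD p f g : fpart p (fun x => f x + g x) = (fun x => fpart p f x + fpart p g x).
Proof. by apply/funext => x; rewrite /fpart cpartD. Qed.

Lemma fpartZ p (c : R) f : fpart p (fun x => c%:C * f x) = (fun x => c * fpart p f x).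
Proof. by apply/funext => x; rewrite /fpart cpartZ. Qed.

(** The selection condition can always be met, by a weak derivative in [H1]
    when there is one and by any weak derivative otherwise. *)
Lemma weak_derivP f : H1 f -> is_weak_deriv f (weak_deriv f) /\ (H2 f -> H1 (weak_deriv f)).
Proof.
move=> [g fg]; rewrite /weak_deriv; case: xgetP => [_ -> [] // | none]; exfalso.
have [f2|nf2] := pselect (H2 f); last by apply: (none g).
by case: f2 => h fh H1h; apply: (none h).
Qed.

Lemma H1B f g : H1 f -> H1 g -> H1 (f - g).
Proof.
move=> [f' /is_weak_derivP ff] [g' /is_weak_derivP gg]; exists (f' - g').
by apply/is_weak_derivP => p; rewrite !fpartB; exact: wderivB.
Qed.

Lemma H1D f g : H1 f -> H1 g -> H1 (fun x => f x + g x).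
Proof.
move=> [f' /is_weak_derivP ff] [g' /is_weak_derivP gg]; exists (fun x => f' x + g' x).
by apply/is_weak_derivP => p; rewrite !fpartD; exact: wderivD.
Qed.

Lemma H1Z (c : R) f : H1 f -> H1 (fun x => c%:C * f x).
Proof.
move=> [f' /is_weak_derivP ff]; exists (fun x => c%:C * f' x).
by apply/is_weak_derivP => p; rewrite !fpartZ; exact: wderivZ.
Qed.

Lemma L2B a b f g : L2 a b f -> L2 a b g -> L2 a b (f - g).
Proof. by move=> /L2P Lf /L2P Lg; apply/L2P => p; rewrite fpartB; exact: L2rB. Qed.

Lemma L2Z a b (c : R) f : L2 a b f -> L2 a b (fun x => c%:C * f x).
Proof. by move=> /L2P Lf; apply/L2P => p; rewrite fpartZ; exact: L2rZ. Qed.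

Lemma H1_L2 f : H1 f -> L2 0 1 f.
Proof. by move=> [g /is_weak_derivP W]; apply/L2P => p; exact: wderiv_L2r (W p). Qed.

Lemma H1_weak_deriv_L2 f : H1 f -> L2 0 1 (weak_deriv f).
Proof. by move=> /weak_derivP[[]]. Qed.

End ComplexParts.

(** * Fourier coefficients of a state *)

Section States.
Variable R : realType.
Variables rho1 rho2 k1 k2 : R.
Hypothesis rho10 : 0 < rho1.
Hypothesis rho20 : 0 < rho2.
Hypothesis k10 : 0 < k1.
Hypothesis k20 : 0 < k2.
Local Notation mu := (@lebesgue_measure R).
Implicit Types (p : bool) (n N : nat) (U V : state R).

(** A linear space of states on which the energy controls all the coefficients
    of positive index. *)
Definition finite_energy U : Prop :=
  [/\ H1_0 (st_phi U), L2 0 1 (st_phi1 U), H1 (st_psi U) & L2 0 1 (st_psi1 U)].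

Lemma energy_space_finite U : energy_space U -> finite_energy U.
Proof. by case=> ? ? [? _] ?; split. Qed.

Lemma finite_energyB U V : finite_energy U -> finite_energy V -> finite_energy (U - V).
Proof.
move=> [[h1 h2 h3] h4 h5 h6] [[g1 g2 g3] g4 g5 g6]; split.
- split; [exact: (H1B h1 g1) | | ].
  + by rewrite [LHS](_ : _ = st_phi U 0 - st_phi V 0) // h2 g2 subrr.
  + by rewrite [LHS](_ : _ = st_phi U 1 - st_phi V 1) // h3 g3 subrr.
- exact: (L2B h4 g4).
- exact: (H1B h5 g5).
- exact: (L2B h6 g6).
Qed.

Lemma finite_energyZ (c : R) U : finite_energy U -> finite_energy (c%:C *: U).
Proof.
move=> [[h1 h2 h3] h4 h5 h6]; split.
- split; [exact: (H1Z c h1) | | ].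
  + by rewrite [LHS](_ : _ = c%:C * st_phi U 0) // h2 mulr0.
  + by rewrite [LHS](_ : _ = c%:C * st_phi U 1) // h3 mulr0.
- exact: (L2Z c h4).
- exact: (H1Z c h5).
- exact: (L2Z c h6).
Qed.

Lemma A2_domain_finite U : A2_domain U -> finite_energy U.
Proof. by move=> [[_ h1] [_ [h2 _]] [h3 _ _] _ [h4 _]]; split=> //; exact: H1_L2. Qed.

Lemma H1_shear U : A2_domain U -> H1 (shear U).
Proof.
move=> [[h1 [h2 _ _]] [_ [h3 _]] _ _ _]; apply: H1D => //.
by have [_] := weak_derivP h2; apply.
Qed.

Lemma A2_finite U : A2_domain U -> finite_energy (A2 rho1 rho2 k1 k2 U).
Proof.
move=> D; have H1s := H1_shear D; move: D => [_ _ h3 [h4 _ _] [h5 _]]; split=> //.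
  by apply: (L2Z (k1 / rho1)); exact: H1_weak_deriv_L2.
apply: (L2B (L2Z (k2 / rho2) (H1_weak_deriv_L2 h4)) (L2Z (k1 / rho2) (H1_L2 H1s))).
Qed.

Lemma L2_shear U : finite_energy U -> L2 0 1 (shear U).
Proof.
move=> [[h1 _ _] _ h3 _]; apply/L2P => p; rewrite /shear fpartD; apply: L2rD.
  by have /L2P := H1_weak_deriv_L2 h1; apply.
by have /L2P := H1_L2 h3; apply.
Qed.

Definition energy U : R :=
  rho1 * cnorm_sq 0 1 (st_phi1 U) + rho2 * cnorm_sq 0 1 (st_psi1 U)
  + k1 * cnorm_sq 0 1 (shear U) + k2 * cnorm_sq 0 1 (weak_deriv (st_psi U)).

Lemma energy_sqE U : finite_energy U -> energy_sq rho1 rho2 k1 k2 U = (energy U)%:E.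
Proof.
move=> fU; have [h1 h2 h3 h4] := fU; rewrite /energy_sq /energy !EFinD !EFinM !l2sqE //.
- by apply/L2P; exact: H1_weak_deriv_L2.
- by apply/L2P; exact: L2_shear.
- exact/L2P.
- exact/L2P.
Qed.

Definition sin_coef p (f : R -> R[i]) n : R := ip 0 1 (fpart p f) (trig_basis sin n).
Definition cos_coef p (f : R -> R[i]) n : R := ip 0 1 (fpart p f) (trig_basis cos n).

Lemma sin_coefB p f g n : L2 0 1 f -> L2 0 1 g ->
  sin_coef p (f - g) n = sin_coef p f n - sin_coef p g n.
Proof. by move=> /L2P Lf /L2P Lg; rewrite /sin_coef fpartB ipBl //; exact: L2r_sin. Qed.

Lemma cos_coefB p f g n : L2 0 1 f -> L2 0 1 g ->
  cos_coef p (f - g) n = cos_coef p f n - cos_coef p g n.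
Proof. by move=> /L2P Lf /L2P Lg; rewrite /cos_coef fpartB ipBl //; exact: L2r_cos. Qed.

Lemma sin_coefZ p (c : R) f n : L2 0 1 f ->
  sin_coef p (fun x => c%:C * f x) n = c * sin_coef p f n.
Proof. by move=> /L2P Lf; rewrite /sin_coef fpartZ ipZl //; exact: L2r_sin. Qed.

Lemma cos_coefZ p (c : R) f n : L2 0 1 f ->
  cos_coef p (fun x => c%:C * f x) n = c * cos_coef p f n.
Proof. by move=> /L2P Lf; rewrite /cos_coef fpartZ ipZl //; exact: L2r_cos. Qed.

Lemma sin_coef_weak_deriv p f n : H1 f ->
  sin_coef p (weak_deriv f) n = - bfreq R n * cos_coef p f n.
Proof. by move=> /weak_derivP[/is_weak_derivP W _]; exact: by_parts_sin. Qed.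

Lemma cos_coef_weak_deriv p f n : H1_0 f ->
  cos_coef p (weak_deriv f) n = bfreq R n * sin_coef p f n.
Proof.
move=> [/weak_derivP[/is_weak_derivP W _] f0 f1]; rewrite /cos_coef (by_parts_cos n (W p)).
by rewrite /fpart f0 f1 cpart0 mulr0 subr0 add0r.
Qed.

Lemma cos_coef_shear p U n : finite_energy U ->
  cos_coef p (shear U) n = shear_coef (sin_coef p (st_phi U)) (cos_coef p (st_psi U)) n.
Proof.
move=> [h1 _ h3 _]; rewrite /shear_coef -cos_coef_weak_deriv // /cos_coef /shear fpartD.
rewrite ipDl //; last exact: L2r_cos.
- by have /L2P := H1_weak_deriv_L2 (let: And3 h _ _ := h1 in h); apply.
- by have /L2P := H1_L2 h3; apply.
Qed.

Lemma sin_coef_bessel p f N : L2 0 1 f -> \sum_(n < N) sin_coef p f n ^+ 2 <= cnorm_sq 0 1 f.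
Proof.
move=> /L2P Lf; apply: le_trans (ip_le_cnorm_sq _ _ _ p).
apply: (@le_trans _ _ (2^-1 * ip 0 1 (fpart p f) (fpart p f))).
  by apply: bessel => //; [exact: L2r_basis_sin | exact: basis_sin_orthogonal].
by rewrite ler_piMl ?ip_ge0 //; lra.
Qed.

Lemma cos_coef_bessel p f N : L2 0 1 f -> \sum_(n < N) cos_coef p f n ^+ 2 <= cnorm_sq 0 1 f.
Proof.
move=> /L2P Lf; apply: le_trans (ip_le_cnorm_sq _ _ _ p).
apply: (@le_trans _ _ (2^-1 * ip 0 1 (fpart p f) (fpart p f))).
  by apply: bessel => //; [exact: L2r_basis_cos | exact: basis_cos_orthogonal].
by rewrite ler_piMl ?ip_ge0 //; lra.
Qed.

(** The shear has zero mean, since the displacement vanishes at both ends and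
    the rotation has zero mean. *)
Lemma boundary_shear p U : A2_domain U ->
  \sum_(n < N) 2 * (-1) ^+ n.+1 *
     shear_coef (sin_coef p (st_phi U)) (cos_coef p (st_psi U)) n @[N --> \oo]
    --> cpart p (shear U 1).
Proof.
move=> D; have fU := A2_domain_finite D.
have [/is_weak_derivP W _] := weak_derivP (H1_shear D).
have [[_ [h1 f0 f1]] [_ [h2 m0]] _ _ _] := D.
have z : ip 0 1 (fpart p (shear U)) (fun=> 1) = 0.
  have [/is_weak_derivP Wf _] := weak_derivP h1; have [Lf /(_ 1)] := Wf p.
  rewrite lexx ler01 {1 2}/fpart f0 f1 cpart0 add0r => /(_ isT) E1.
  have /L2P Lpsi := H1_L2 h2.
  rewrite /shear fpartD ipDl //; last exact: L2r_cst.
  rewrite {1}/ip; under eq_Rintegral do rewrite mulr1.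
  rewrite -E1 add0r /ip; under eq_Rintegral do rewrite mulr1.
  by move: m0; rewrite /cintegral; case=> m1 m2; case: (p).
have := boundary_value_series (W p) z.
by under eq_cvg do under eq_bigr do rewrite -/(cos_coef _ _ _) cos_coef_shear //.
Qed.

End States.

(** * Rotations on a half line *)

Section Rotation.
Variable R : realType.
Implicit Types (t h e : R) (x y l : R -> R).

(** One-sided at the left end point of the half line. *)
Definition has_rate x t (l : R) : Prop := forall e, 0 < e -> exists2 d, 0 < d &
  forall h, h != 0 -> `|h| < d -> 0 <= t + h -> `|h^-1 * (x (t + h) - x t) - l| <= e.

Lemma is_derive_epsdelta (f : R -> R) t (l : R) :
  (forall e, 0 < e -> exists2 d, 0 < d &
     forall h, h != 0 -> `|h| < d -> `|h^-1 * (f (t + h) - f t) - l| <= e) ->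
  is_derive t 1 f l.
Proof.
move=> fl.
have H : h^-1 *: ((f \o shift t) (h *: (1 : R)) - f t) @[h --> 0^'] --> l.
  apply/cvgrPdist_le => e e0; have [d d0 hd] := fl e e0.
  exists d => // h /=; rewrite sub0r normrN => hd' h0.
  by have := hd h h0 hd'; rewrite distrC /GRing.scale /= mulr1 [h + t]addrC.
by split; [apply/cvg_ex; exists l | exact: cvg_lim H].
Qed.

(** Continued to the left of [0] along its tangent, [x] is differentiable on
    the whole line, where the mean value theorem applies. *)
Lemma extend_has_rate x l : (forall t, 0 <= t -> has_rate x t (l t)) ->
  exists2 X : R -> R, (forall t, 0 <= t -> X t = x t) &
    forall t, is_derive t 1 X (l (Num.max t 0)).
Proof.
move=> xl; exists (fun t => x (Num.max t 0) + Num.min t 0 * l 0).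
  by move=> t t0; rewrite max_l // min_r // mul0r addr0.
move=> t; apply: is_derive_epsdelta => e e0.
have neg s : s <= 0 -> x (Num.max s 0) + Num.min s 0 * l 0 = x 0 + s * l 0.
  by move=> s0; rewrite max_r // min_l.
have [t0|t0] := ltP t 0.
  exists (- t); first by rewrite oppr_gt0.
  move=> h h0 ht; have th : t + h <= 0 by have := ler_norm h; lra.
  rewrite !neg // ?(ltW t0) //.
  by rewrite (_ : _ - _ = 0) ?normr0 ?(ltW e0) //; field.
have [d d0 hd] := xl t t0 e e0.
exists (if t == 0 then d else Num.min d t).
  by have [//|tn] := eqVneq t 0; rewrite lt_min d0 lt_def tn.
move=> h h0 hh; have hd' : `|h| < d.
  by move: hh; case: eqP => // _; rewrite lt_min => /andP[].
rewrite mul0r addr0.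
have [th|th] := leP 0 (t + h).
  by rewrite mul0r addr0; exact: hd.
have tE : t = 0.
  apply/eqP; move: hh; case: eqP => // _; rewrite lt_min => /andP[_ ht].
  by have := ler_norm (- h); rewrite normrN; lra.
move: th; rewrite tE !add0r => th.
by rewrite (_ : _ - _ = 0) ?normr0 ?(ltW e0) //; field.
Qed.

(** Rotating back by the angle [w * t] produces functions with zero
    derivative. *)
Lemma rotation_solution (w : R) x y :
  (forall t, 0 <= t -> has_rate x t (w * y t)) ->
  (forall t, 0 <= t -> has_rate y t (- w * x t)) ->
  forall t, 0 <= t -> x t = x 0 * cos (w * t) + y 0 * sin (w * t).
Proof.
move=> /extend_has_rate[X Xx dX] /extend_has_rate[Y Yy dY] t t0.
have dc (z : R) : is_derive z 1 (fun s => cos (w * s)) (- w * sin (w * z)).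
  by apply: is_derive_eq; rewrite ?scaler0 ?add0r ?addr0 /GRing.scale /= ?mulr1; ring.
have ds (z : R) : is_derive z 1 (fun s => sin (w * s)) (w * cos (w * z)).
  by apply: is_derive_eq; rewrite ?scaler0 ?add0r ?addr0 /GRing.scale /= ?mulr1; ring.
move: t0; rewrite le_eqVlt => /predU1P[<-|t0]; first by rewrite mulr0 cos0 sin0 mulr1 mulr0 addr0.
pose m (z : R) := Num.max z 0.
have du (z : R) : is_derive z 1 (fun s => X s * cos (w * s) - Y s * sin (w * s))
    ((w * y (m z)) * cos (w * z) - w * X z * sin (w * z)
     + (w * x (m z) * sin (w * z) - w * Y z * cos (w * z))).
  have := dX z; have := dY z => dYz dXz.
  by apply: is_derive_eq; rewrite /GRing.scale /= -/(m z); ring.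
have dv (z : R) : is_derive z 1 (fun s => X s * sin (w * s) + Y s * cos (w * s))
    ((w * y (m z)) * sin (w * z) + w * X z * cos (w * z)
     - (w * x (m z) * cos (w * z) + w * Y z * sin (w * z))).
  have := dX z; have := dY z => dYz dXz.
  by apply: is_derive_eq; rewrite /GRing.scale /= -/(m z); ring.
have mE z : 0 < z -> [/\ m z = z, X z = x z & Y z = y z].
  by move=> z0; rewrite /m max_l ?Xx ?Yy // ltW.
have [c /andP[c0 _]] := MVT_everywhere t0 du; have [-> -> ->] := mE c c0.
rewrite [X in _ = X * _](_ : _ = 0) ?mul0r; last by ring.
have [c' /andP[c0' _]] := MVT_everywhere t0 dv; have [-> -> ->] := mE c' c0'.
rewrite [X in _ = X * _ -> _](_ : _ = 0) ?mul0r; last by ring.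
rewrite !mulr0 cos0 sin0 !mulr1 !mulr0 subr0 add0r !Xx ?Yy ?(ltW t0) //.
move=> /subr0_eq hv /subr0_eq hu; rewrite -hu -hv.
have := cos2Dsin2 (w * t); move: (cos _) (sin _) => a b ab.
by rewrite -[LHS]mulr1 -ab; ring.
Qed.

End Rotation.

(** * Modal amplitudes along a solution *)

Section ModalDynamics.
Variable R : realType.
Variables rho1 rho2 k1 k2 : R.
Hypothesis rho10 : 0 < rho1.
Hypothesis rho20 : 0 < rho2.
Hypothesis k10 : 0 < k1.
Hypothesis k20 : 0 < k2.
Variables (vp : R) (k0 : nat).
Hypothesis vp0 : 0 < vp.
Hypothesis k00 : (0 < k0)%N.
Hypothesis equal_speeds : k2 / rho2 = k1 / rho1.
Hypothesis vp_speed : vp ^+ 2 = k1 / rho1 * pi ^+ 2.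
Hypothesis vp_gap : (k0%:R * vp) ^+ 2 = k1 / rho2.
Implicit Types (p : bool) (n N : nat) (i : nat * bool) (U V : state R) (Phi : R -> state R).

Local Notation en := (energy rho1 rho2 k1 k2).
Local Notation energy_sq := (energy_sq rho1 rho2 k1 k2).
Local Notation A2 := (A2 rho1 rho2 k1 k2).

Definition state_cos p U : nat * bool -> R :=
  cos_amp vp k0 (sin_coef p (st_phi U)) (cos_coef p (st_psi U)).
Definition state_sin p U : nat * bool -> R :=
  sin_amp vp k0 (sin_coef p (st_phi1 U)) (cos_coef p (st_psi1 U)).

Lemma cos_amp_sub (A B A' B' A'' B'' : nat -> R) i :
  A i.1 = A' i.1 - A'' i.1 -> B i.1 = B' i.1 - B'' i.1 ->
  cos_amp vp k0 A B i = cos_amp vp k0 A' B' i - cos_amp vp k0 A'' B'' i.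
Proof. by rewrite /cos_amp /shear_coef => -> ->; ring. Qed.

Lemma sin_amp_sub (A B A' B' A'' B'' : nat -> R) i :
  A i.1 = A' i.1 - A'' i.1 -> B i.1 = B' i.1 - B'' i.1 ->
  sin_amp vp k0 A B i = sin_amp vp k0 A' B' i - sin_amp vp k0 A'' B'' i.
Proof. by rewrite /sin_amp => -> ->; ring. Qed.

Lemma cos_amp_scale (c : R) (A B A' B' : nat -> R) i :
  A i.1 = c * A' i.1 -> B i.1 = c * B' i.1 ->
  cos_amp vp k0 A B i = c * cos_amp vp k0 A' B' i.
Proof. by rewrite /cos_amp /shear_coef => -> ->; ring. Qed.

Lemma sin_amp_scale (c : R) (A B A' B' : nat -> R) i :
  A i.1 = c * A' i.1 -> B i.1 = c * B' i.1 ->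
  sin_amp vp k0 A B i = c * sin_amp vp k0 A' B' i.
Proof. by rewrite /sin_amp => -> ->; ring. Qed.

Lemma state_ampB p U V i : finite_energy U -> finite_energy V ->
  state_cos p (U - V) i = state_cos p U i - state_cos p V i /\
  state_sin p (U - V) i = state_sin p U i - state_sin p V i.
Proof.
move=> [[a1 _ _] a2 a3 a4] [[b1 _ _] b2 b3 b4].
split; [apply: cos_amp_sub | apply: sin_amp_sub].
- exact: (sin_coefB p i.1 (H1_L2 a1) (H1_L2 b1)).
- exact: (cos_coefB p i.1 (H1_L2 a3) (H1_L2 b3)).
- exact: (sin_coefB p i.1 a2 b2).
- exact: (cos_coefB p i.1 a4 b4).
Qed.

Lemma state_ampZ p (c : R) U i : finite_energy U ->
  state_cos p (c%:C *: U) i = c * state_cos p U i /\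
  state_sin p (c%:C *: U) i = c * state_sin p U i.
Proof.
move=> [[a1 _ _] a2 a3 a4].
split; [apply: cos_amp_scale | apply: sin_amp_scale].
- exact: (sin_coefZ p c i.1 (H1_L2 a1)).
- exact: (cos_coefZ p c i.1 (H1_L2 a3)).
- exact: (sin_coefZ p c i.1 a2).
- exact: (cos_coefZ p c i.1 a4).
Qed.

Lemma wave_num_bfreq n : wave_num vp n ^+ 2 = k1 / rho1 * bfreq R n ^+ 2.
Proof. by rewrite /wave_num /bfreq !exprMn vp_speed; ring. Qed.

Lemma state_cos_A2 p U i : state_cos p (A2 U) i = freq vp k0 i * state_sin p U i.
Proof. exact: cos_amp_rate. Qed.

Lemma state_sin_A2 p U i : A2_domain U ->
  state_sin p (A2 U) i = - freq vp k0 i * state_cos p U i.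
Proof.
move=> D; have fU := A2_domain_finite D; have H1s := H1_shear D.
rewrite /state_cos -(sin_amp_rate vp0 k00 _ _ (wave_num_bfreq i.1)).
move: D => [_ [_ [h2 _]] _ h3 _].
rewrite -[RHS]mul1r; apply: sin_amp_scale; rewrite mul1r.
  rewrite [LHS](_ : _ = sin_coef p (fun x => (k1 / rho1)%:C * weak_deriv (shear U) x) i.1) //.
  rewrite sin_coefZ ?sin_coef_weak_deriv ?cos_coef_shear //; first by ring.
  exact: H1_weak_deriv_L2.
have L1 : L2 0 1 (weak_deriv (weak_deriv (st_psi U))).
  by apply: H1_weak_deriv_L2; case: h3.
have L2s := H1_L2 H1s.
rewrite [LHS](_ : _ = cos_coef p ((fun x => (k2 / rho2)%:C * weak_deriv (weak_deriv (st_psi U)) x)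
  - (fun x => (k1 / rho2)%:C * shear U x)) i.1) //.
rewrite cos_coefB ?cos_coefZ //; try exact: L2Z.
rewrite cos_coef_weak_deriv // sin_coef_weak_deriv // cos_coef_shear // equal_speeds wave_num_bfreq.
have -> : (2 * half_gap vp k0) ^+ 2 = k1 / rho2 by rewrite -vp_gap /half_gap; field.
by ring.
Qed.

(** Bessel's inequality for each of the four functions whose norms make up the
    energy. *)
Lemma energy_sum_le_energy : exists2 K : R, 0 < K & forall p U N, finite_energy U ->
  energy_sum (state_cos p U) (state_sin p U) N <= K * en U.
Proof.
have [K K0 hK] := amp_sq_upper vp0 k00.
pose J := k1^-1 + k2^-1 + rho1^-1 + rho2^-1.
exists (2 * K * J); first by rewrite !mulr_gt0 ?addr_gt0 ?invr_gt0.
move=> p U N fU.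
have [h1 h2 h3 h4] := fU.
pose A := sin_coef p (st_phi U); pose B := cos_coef p (st_psi U).
pose A1 := sin_coef p (st_phi1 U); pose B1 := cos_coef p (st_psi1 U).
have cC := cos_coef_bessel p N (L2_shear fU).
have cB := sin_coef_bessel p N (H1_weak_deriv_L2 h3).
have cA1 := sin_coef_bessel p N h2.
have cB1 := cos_coef_bessel p N h4.
apply: (@le_trans _ _ (\sum_(n < N) 2 * K * (shear_coef A B n ^+ 2
    + (bfreq R n * B n) ^+ 2 + (A1 n ^+ 2 + B1 n ^+ 2)))).
  apply: ler_sum => n _; have := lerD (hK A B A1 B1 (n : nat, true)) (hK A B A1 B1 (n : nat, false)).
  by rewrite /= -/A -/B; move: (amp_sq _ _ _) (amp_sq _ _ _) => u v; lra.
rewrite -mulr_sumr -[leRHS]mulrA ler_wpM2l ?mulr_ge0 ?(ltW K0) //.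
rewrite !big_split /=.
have {}cC : \sum_(n < N) shear_coef A B n ^+ 2 <= cnorm_sq 0 1 (shear U).
  by apply: le_trans cC; rewrite le_eqVlt; apply/orP; left; apply/eqP/eq_bigr => n _;
     rewrite cos_coef_shear.
have {}cB : \sum_(n < N) (bfreq R n * B n) ^+ 2 <= cnorm_sq 0 1 (weak_deriv (st_psi U)).
  apply: le_trans cB; rewrite le_eqVlt; apply/orP; left; apply/eqP/eq_bigr => n _.
  by rewrite sin_coef_weak_deriv // mulNr sqrrN.
apply: (@le_trans _ _ (cnorm_sq 0 1 (shear U) + cnorm_sq 0 1 (weak_deriv (st_psi U))
   + (cnorm_sq 0 1 (st_phi1 U) + cnorm_sq 0 1 (st_psi1 U)))).
  by rewrite !lerD.
have := cnorm_sq_ge0 0 1 (shear U); have := cnorm_sq_ge0 0 1 (weak_deriv (st_psi U)).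
have := cnorm_sq_ge0 0 1 (st_phi1 U); have := cnorm_sq_ge0 0 1 (st_psi1 U).
rewrite /energy.
move: (cnorm_sq _ _ _) (cnorm_sq _ _ _) (cnorm_sq _ _ _) (cnorm_sq _ _ _) => z4 z3 z2 z1 z40 z30 z20 z10.
set E := rho1 * _ + _ + _ + _.
have part (r z : R) : 0 < r -> r * z <= E -> z <= r^-1 * E.
  by move=> r0 rz; rewrite mulrC ler_pdivlMr // mulrC.
have q1 : 0 <= rho1 * z2 by rewrite mulr_ge0 // ltW.
have q2 : 0 <= rho2 * z1 by rewrite mulr_ge0 // ltW.
have q3 : 0 <= k1 * z4 by rewrite mulr_ge0 // ltW.
have q4 : 0 <= k2 * z3 by rewrite mulr_ge0 // ltW.
have w1 : z2 <= rho1^-1 * E by apply: part => //; rewrite /E; lra.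
have w2 : z1 <= rho2^-1 * E by apply: part => //; rewrite /E; lra.
have w3 : z4 <= k1^-1 * E by apply: part => //; rewrite /E; lra.
have w4 : z3 <= k2^-1 * E by apply: part => //; rewrite /E; lra.
rewrite /J !mulrDl; lra.
Qed.

Lemma amp_sq_le_energy_sum (P Q : nat * bool -> R) i : amp_sq P Q i <= energy_sum P Q i.1.+1.
Proof.
have ge j : 0 <= amp_sq P Q j by rewrite addr_ge0 ?sqr_ge0.
rewrite /energy_sum big_ord_recr /= -[leLHS]add0r; apply: lerD.
  by apply: sumr_ge0 => n _; rewrite addr_ge0.
by case: i => n [] /=; rewrite ?lerDl ?lerDr.
Qed.

Lemma ereal_cvg0_near (S : Type) (F : set_system S) (f : S -> \bar R) (e : R) : Filter F ->
  f @ F --> 0%E -> 0 < e -> \forall s \near F, (f s < e%:E)%E.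
Proof.
by move=> FF f0 e0; apply: (f0 [set z | (z < e%:E)%E]); apply: open_ereal_lt'; rewrite lte_fin.
Qed.

(** Amplitudes are linear and bounded by the energy norm, so the convergence
    of the difference quotients in that norm passes to them. *)
Lemma classical_amp_rate Phi p i t : classical_solution rho1 rho2 k1 k2 Phi -> 0 <= t ->
  has_rate (fun s => state_cos p (Phi s) i) t (freq vp k0 i * state_sin p (Phi t) i) /\
  has_rate (fun s => state_sin p (Phi s) i) t (- freq vp k0 i * state_cos p (Phi t) i).
Proof.
move=> [D dPhi _] t0; have [K K0 hK] := energy_sum_le_energy.
have Dt := D t t0; have ft := A2_domain_finite Dt.
have key e : 0 < e -> exists2 d, 0 < d & forall h, h != 0 -> `|h| < d -> 0 <= t + h ->
   `|h^-1 * (state_cos p (Phi (t + h)) i - state_cos p (Phi t) i) - freq vp k0 i * state_sin p (Phi t) i| <= e /\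
   `|h^-1 * (state_sin p (Phi (t + h)) i - state_sin p (Phi t) i) - - freq vp k0 i * state_cos p (Phi t) i| <= e.
  move=> e0; have e1 : 0 < e ^+ 2 / K by rewrite divr_gt0 ?exprn_gt0.
  have [d d0 hd] := ereal_cvg0_near _ (dPhi t t0) e1.
  exists d => // h h0 hh th.
  have fth := A2_domain_finite (D _ th).
  have fW := finite_energyB (finite_energyZ h^-1 (finite_energyB fth ft)) (A2_finite rho1 rho2 k1 k2 Dt).
  have := hd h; rewrite /ball_ /= sub0r normrN => /(_ hh h0 th).
  rewrite energy_sqE // lte_fin ltr_pdivlMr // mulrC => small.
  have := le_trans (amp_sq_le_energy_sum _ _ i) (le_trans (hK p _ i.1.+1 fW) (ltW small)).
  have f1 := finite_energyZ h^-1 (finite_energyB fth ft); have f2 := A2_finite rho1 rho2 k1 k2 Dt.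
  have [E1 E2] := state_ampB p i f1 f2.
  have [E3 E4] := state_ampZ p h^-1 i (finite_energyB fth ft).
  have [E5 E6] := state_ampB p i fth ft.
  rewrite /amp_sq E1 E2 E3 E4 E5 E6 state_cos_A2 state_sin_A2 //.
  set u := _ - freq vp k0 i * _; set v := _ - _ * _ => uv.
  have n2 (z : R) : z ^+ 2 <= e ^+ 2 -> `|z| <= e.
    by move=> hz; rewrite -(@ler_pXn2r _ 2) ?nnegrE ?(ltW e0) // real_normK ?num_real.
  by split; apply: n2; apply: le_trans uv; rewrite ?lerDl ?lerDr sqr_ge0.
by split=> e /key[d d0 hd]; exists d => // h h0 hh th; have [] := hd h h0 hh th.
Qed.

Lemma classical_trace_series Phi p t : classical_solution rho1 rho2 k1 k2 Phi -> 0 <= t ->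
  mode_sum vp k0 (state_cos p (Phi 0)) (state_sin p (Phi 0)) N t @[N --> \oo]
    --> cpart p (shear (Phi t) 1).
Proof.
move=> cPhi t0; have [D _ _] := cPhi.
have E i : state_cos p (Phi t) i = mode vp k0 (state_cos p (Phi 0)) (state_sin p (Phi 0)) i t.
  apply: (@rotation_solution _ (freq vp k0 i) (fun s => state_cos p (Phi s) i)
    (fun s => state_sin p (Phi s) i) _ _ t t0) => s s0; by have [] := classical_amp_rate p i cPhi s0.
rewrite (_ : (fun N => _) = fun N => \sum_(n < N) 2 * (-1) ^+ n.+1 *
   shear_coef (sin_coef p (st_phi (Phi t))) (cos_coef p (st_psi (Phi t))) n).
  exact: boundary_shear (D t t0).
by apply/funext => N; apply: eq_bigr => n _; rewrite -!E (cos_amp_sum vp0 k00).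
Qed.

End ModalDynamics.

(** * The dual norms in terms of Fourier coefficients *)

Section DualNorm.
Variable R : realType.
Local Notation mu := (@lebesgue_measure R).
Implicit Types (f g : R -> R) (n N : nat).

Lemma le_of_small (A B M : R) : 0 <= M -> (forall e, 0 < e -> A <= B + M * e) -> A <= B.
Proof.
move=> M0 H; rewrite leNgt; apply/negP => BA.
have e0 : 0 < (A - B) / (2 * (M + 1)) by rewrite divr_gt0 ?subr_gt0 ?mulr_gt0 ?ltr_wpDl.
have := H _ e0; have -> : M * ((A - B) / (2 * (M + 1))) = (M / (M + 1)) * ((A - B) / 2).
  by field; apply: lt0r_neq0; rewrite ltr_wpDl.
have : M / (M + 1) <= 1 by rewrite ler_pdivrMr ?ltr_wpDl // mul1r lerDl.
have d0 : 0 < (A - B) / 2 by rewrite divr_gt0 ?subr_gt0.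
by move=> /(ler_wpM2r (ltW d0)); lra.
Qed.

(** On truncations of [f] the pairing is a finite sum, and the weights pass to
    the coefficients of [g] in the Cauchy-Schwarz inequality. *)
Lemma dual_pairing a b g f (e : nat -> R -> R) (c w : nat -> R) D :
  L2r a b g -> L2r a b f -> (forall n, L2r a b (e n)) ->
  (forall N, \sum_(n < N) c n ^+ 2 <= 1) ->
  (forall eps, 0 < eps -> exists N,
     nrm a b (fun x => f x - \sum_(n < N) c n * (w n * e n x)) <= eps) ->
  (forall N, \sum_(n < N) (w n * ip a b g (e n)) ^+ 2 <= D) ->
  ip a b g f ^+ 2 <= D.
Proof.
move=> Lg Lf Le c1 fS gD.
have D0 : 0 <= D by apply: le_trans (gD 0); rewrite big_ord0.
suff H : `|ip a b g f| <= Num.sqrt D.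
  by rewrite -(real_normK (num_real _)) -(sqr_sqrtr D0) lerXn2r ?nnegrE ?sqrtr_ge0.
apply: (le_of_small (nrm_ge0 a b g)) => eps eps0.
have [N hN] := fS eps eps0.
pose S x := \sum_(n < N) c n * (w n * e n x).
have Lt n : L2r a b (fun x => c n * (w n * e n x)) by do 2 apply: L2rZ.
have LS : L2r a b S by apply: L2r_sum => n.
have -> : ip a b g f = ip a b g S + ip a b g (fun x => f x - S x).
  by rewrite ipBr // addrCA subrr addr0.
apply: le_trans (ler_normD _ _) _; apply: lerD; last first.
  by apply: le_trans (normr_ip Lg (L2rB Lf LS)) _; rewrite ler_wpM2l ?nrm_ge0.
rewrite -sqrtr_sqr ler_wsqrtr //.
rewrite /S (ip_sumr _ (fun n : 'I_N => Lt n)) //.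
have E n : ip a b g (fun x => c n * (w n * e n x)) = c n * (w n * ip a b g (e n)).
  by rewrite ipZr ?ipZr //; exact: L2rZ.
rewrite (eq_bigr _ (fun (n : 'I_N) _ => E n)).
apply: le_trans (sum_cauchy_schwarz _ (fun n : 'I_N => c n) _) _.
apply: le_trans (ler_pM _ _ (c1 N) (gD N)) _; last by rewrite mul1r.
  by apply: sumr_ge0 => n _; exact: sqr_ge0.
by apply: sumr_ge0 => n _; exact: sqr_ge0.
Qed.

(** The factor [8] accounts for the four pairings between real and imaginary
    parts. *)
Lemma V_dual_le (trig : R -> R) (s : nat) (g : R -> R[i]) D :
  (forall n, L2r 0 1 (trig_basis trig n)) -> L2 0 1 g ->
  (forall p N, \sum_(n < N) ((n.+1%:R ^+ s)^-1 * ip 0 1 (fpart p g) (trig_basis trig n)) ^+ 2 <= D) ->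
  (V_dual_sq trig s%:R g <= (8 * D)%:E)%E.
Proof.
move=> Lt /L2P Lg gD; apply: ge_ereal_sup => _ [alpha [f [[/L2P Lf _ fS] a1 ->]]].
have pair p q : ip 0 1 (fpart p g) (fpart q f) ^+ 2 <= D.
  apply: (@dual_pairing 0 1 _ _ (trig_basis trig) (fun n => cpart q (alpha n))
    (fun n => (n.+1%:R ^+ s)^-1)) => //.
    move=> N; rewrite -lee_fin; apply: le_trans a1.
    apply: (@le_trans _ _ (\sum_(0 <= n < N) ((Normc.normc (alpha n)) ^+ 2)%:E)%E).
      rewrite sumEFin lee_fin big_mkord; apply: ler_sum => n _.
      by rewrite sqr_normc; case: q; rewrite ?lerDl ?lerDr sqr_ge0.
    by apply: nneseries_lim_ge => n _ _; rewrite lee_fin sqr_normc addr_ge0 ?sqr_ge0.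
  move=> eps eps0; have e20 : 0 < eps ^+ 2 by rewrite exprn_gt0.
  have [N _ /(_ N (leqnn N)) /= hN] := ereal_cvg0_near _ fS e20.
  exists N.
  have E r : fpart r (fun x => f x - V_partial_sum trig s%:R alpha N x) =
     fun x => fpart r f x - \sum_(n < N) cpart r (alpha n) * ((n.+1%:R ^+ s)^-1 * trig_basis trig n x).
    apply/funext => x; rewrite /fpart cpartB /V_partial_sum cpart_sum; congr (_ - _).
    by apply: eq_bigr => n _; rewrite mulrC cpartZ powR_mulrn // mulrC; congr (_ * _); rewrite mulrC.
  have LS r : L2r 0 1 (fpart r (fun x => f x - V_partial_sum trig s%:R alpha N x)).
    by rewrite E; apply: L2rB => //; apply: L2r_sum => n; do 2 apply: L2rZ.
  move: hN; rewrite l2sqE // lte_fin => hN.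
  rewrite -(@ler_pXn2r _ 2) ?nnegrE ?nrm_ge0 ?(ltW eps0) // sqr_nrm.
  by apply: le_trans (ltW hN); rewrite -E; exact: ip_le_cnorm_sq.
rewrite lee_fin sqr_normc /cintegral /cpart /=.
have I p q : mu.-integrable `]0, 1[ (fun x => (fpart p g x * fpart q f x)%:E) by exact: L2r_prod.
have -> : \int[mu]_(x in `]0, 1[) complex.Re (g x * conjc (f x)) =
    ip 0 1 (fpart true g) (fpart true f) + ip 0 1 (fpart false g) (fpart false f).
  rewrite /ip -RintegralD //; try exact: I.
  by apply: eq_Rintegral => x _; rewrite /fpart /=; case: (g x) => u v; case: (f x) => u' v' /=; ring.
have -> : \int[mu]_(x in `]0, 1[) complex.Im (g x * conjc (f x)) =
    ip 0 1 (fpart false g) (fpart true f) - ip 0 1 (fpart true g) (fpart false f).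
  rewrite /ip -RintegralB //; try exact: I.
  by apply: eq_Rintegral => x _; rewrite /fpart /=; case: (g x) => u v; case: (f x) => u' v' /=; ring.
have := pair true true; have := pair true false; have := pair false true; have := pair false false.
move: (ip _ _ _ _) (ip _ _ _ _) (ip _ _ _ _) (ip _ _ _ _) => z1 z2 z3 z4 h1 h2 h3 h4.
have := sqr_ge0 (z1 - z4); have := sqr_ge0 (z1 + z4); have := sqr_ge0 (z2 + z3).
have := sqr_ge0 (z2 - z3); have := sqr_ge0 (z1 - z2); have := sqr_ge0 (z1 + z2).
have := sqr_ge0 (z3 - z4); have := sqr_ge0 (z3 + z4); have := sqr_ge0 (z1 - z3).
have := sqr_ge0 (z1 + z3); have := sqr_ge0 (z2 - z4); have := sqr_ge0 (z2 + z4).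
lra.
Qed.

End DualNorm.

(** * The two inequalities *)

Section Observability.
Variable R : realType.
Variables rho1 rho2 k1 k2 : R.
Hypothesis rho10 : 0 < rho1.
Hypothesis rho20 : 0 < rho2.
Hypothesis k10 : 0 < k1.
Hypothesis k20 : 0 < k2.
Variables (vp : R) (k0 : nat) (T : R).
Hypothesis vp0 : 0 < vp.
Hypothesis k00 : (0 < k0)%N.
Hypothesis equal_speeds : k2 / rho2 = k1 / rho1.
Hypothesis vp_speed : vp ^+ 2 = k1 / rho1 * pi ^+ 2.
Hypothesis vp_gap : (k0%:R * vp) ^+ 2 = k1 / rho2.
Hypothesis T_gt0 : 0 < T.
Implicit Types (p : bool) (n N : nat) (i : nat * bool) (U V : state R) (Phi : R -> state R).
Implicit Types (P Q : nat * bool -> R).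

Local Notation en := (energy rho1 rho2 k1 k2).
Local Notation classical := (classical_solution rho1 rho2 k1 k2).
Local Notation approx := (approximates rho1 rho2 k1 k2).
Local Notation sol := (solution rho1 rho2 k1 k2).
Local Notation scos := (state_cos vp k0).
Local Notation ssin := (state_sin vp k0).
Local Notation trace := (boundary_trace rho1 rho2 k1 k2 T).

Definition stress p Phi t : R := cpart p (shear (Phi t) 1).

Lemma amp_sq_sub P Q P1 Q1 P2 Q2 i :
  (P i - P1 i) ^+ 2 = P2 i ^+ 2 -> (Q i - Q1 i) ^+ 2 = Q2 i ^+ 2 ->
  amp_sq P Q i <= 2 * (amp_sq P1 Q1 i + amp_sq P2 Q2 i).
Proof.
rewrite /amp_sq => <- <-.
have := sqr_ge0 (P i - 2 * P1 i); have := sqr_ge0 (Q i - 2 * Q1 i); lra.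
Qed.

Lemma energy_sum_sub P Q P1 Q1 P2 Q2 N :
  (forall i, (P i - P1 i) ^+ 2 = P2 i ^+ 2) -> (forall i, (Q i - Q1 i) ^+ 2 = Q2 i ^+ 2) ->
  energy_sum P Q N <= 2 * (energy_sum P1 Q1 N + energy_sum P2 Q2 N).
Proof.
move=> hP hQ; rewrite -big_split mulr_sumr; apply: ler_sum => n _ /=.
have h b := amp_sq_sub (hP (n : nat, b)) (hQ (n : nat, b)).
by have := h true; have := h false; lra.
Qed.

Lemma weak_sum_sub P Q P1 Q1 P2 Q2 N :
  (forall i, (P i - P1 i) ^+ 2 = P2 i ^+ 2) -> (forall i, (Q i - Q1 i) ^+ 2 = Q2 i ^+ 2) ->
  weak_sum P Q N <= 2 * (weak_sum P1 Q1 N + energy_sum P2 Q2 N).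
Proof.
move=> hP hQ; rewrite -big_split mulr_sumr; apply: ler_sum => n _ /=.
have h b := amp_sq_sub (hP (n : nat, b)) (hQ (n : nat, b)).
have w0 : 0 <= (n.+1%:R ^+ 4)^-1 :> R by rewrite invr_ge0 exprn_ge0.
have w1 : (n.+1%:R ^+ 4)^-1 <= 1 :> R by rewrite invf_le1 ?exprn_gt0 ?exprn_ege1 // ler1n.
have e0 : 0 <= amp_sq P2 Q2 (n : nat, true) + amp_sq P2 Q2 (n : nat, false).
  by rewrite !addr_ge0 ?sqr_ge0.
have /(ler_wpM2l w0) := lerD (h true) (h false).
by have := ler_wpM2r e0 w1; move: (_ ^-1) => w; lra.
Qed.

Lemma ip_le_approx (y z : R -> R) : L2r 0 T y -> L2r 0 T z ->
  ip 0 T y y <= 2 * (ip 0 T z z + ip 0 T (fun t => z t - y t) (fun t => z t - y t)).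
Proof.
move=> Ly Lz; have Ld := L2rB Lz Ly.
rewrite (@eq_ip _ _ _ y (fun t => z t - (z t - y t)) y (fun t => z t - (z t - y t))) //; first last.
- by move=> t _; rewrite subKr.
- by move=> t _; rewrite subKr.
rewrite (ip_sqrB Lz Ld); have := ip_ge0 0 T (fun t => z t + (z t - y t)).
by rewrite (ip_sqrD Lz Ld); lra.
Qed.

Lemma initial_finite Phi : classical Phi -> finite_energy (Phi 0).
Proof. by move=> [D _ _]; apply: A2_domain_finite; exact: D. Qed.

Lemma approx_initial Phin Phi : sol Phi -> approx Phin Phi -> forall e, 0 < e ->
  exists N, forall n, (N <= n)%N -> en (Phin n 0 - Phi 0) <= e.
Proof.
move=> [fPhi _] [cl cv] e e0.
have [N _ hN] := ereal_cvg0_near _ (cv 0 (lexx 0)) e0.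
exists N => n Nn; have := hN n Nn; rewrite /= energy_sqE ?lte_fin; first exact: ltW.
apply: finite_energyB; first exact: initial_finite (cl n).
by apply: energy_space_finite; exact: fPhi.
Qed.

Lemma stress_upper : exists2 C : R, 0 < C & forall p Phi, classical Phi ->
  L2r 0 T (stress p Phi) /\ forall E, (forall N, energy_sum (scos p (Phi 0)) (ssin p (Phi 0)) N <= E) ->
    ip 0 T (stress p Phi) (stress p Phi) <= C * E.
Proof.
have [C C0 hC] := mode_series_upper vp0 k00 T_gt0.
have [K K0 hK] := energy_sum_le_energy rho10 rho20 k10 k20 vp0 k00.
exists C => // p Phi cl; have cv t : 0 < t < T -> mode_sum vp k0 (scos p (Phi 0)) (ssin p (Phi 0)) N t
    @[N --> \oo] --> stress p Phi t.
  by move=> /andP[t0 _]; apply: classical_trace_series cl _ => //; exact: ltW.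
split=> [|E hE]; last by have [] := hC _ _ E _ hE cv.
by have [] := hC _ _ _ _ (fun N => hK p _ N (initial_finite cl)) cv.
Qed.

(** The energies of the two differences are added at the level of the modal
    amplitudes, which are linear, because [weak_deriv] is additive only almost
    everywhere. *)
Lemma stress_upper_sub : exists2 C : R, 0 < C & forall p Phi Psi, classical Phi -> classical Psi ->
  forall U, finite_energy U ->
    ip 0 T (fun t => stress p Phi t - stress p Psi t) (fun t => stress p Phi t - stress p Psi t)
    <= C * (en (Phi 0 - U) + en (Psi 0 - U)).
Proof.
have [C C0 hC] := mode_series_upper vp0 k00 T_gt0.
have [K K0 hK] := energy_sum_le_energy rho10 rho20 k10 k20 vp0 k00.
exists (C * (2 * K)); first by rewrite !mulr_gt0.
move=> p Phi Psi cl cl' U fU.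
have f1 := initial_finite cl; have f2 := initial_finite cl'.
have cv t : 0 < t < T -> mode_sum vp k0 (fun i => scos p (Phi 0) i - scos p (Psi 0) i)
    (fun i => ssin p (Phi 0) i - ssin p (Psi 0) i) N t @[N --> \oo] --> stress p Phi t - stress p Psi t.
  move=> /andP[/ltW t0 _]; rewrite (_ : (fun N => _) = fun N =>
    mode_sum vp k0 (scos p (Phi 0)) (ssin p (Phi 0)) N t
    - mode_sum vp k0 (scos p (Psi 0)) (ssin p (Psi 0)) N t); last first.
    by apply/funext => N; rewrite mode_sumB.
  by apply: cvgB; [apply: classical_trace_series cl _ | apply: classical_trace_series cl' _].
rewrite -mulrA; have [|_ + _] := hC _ _ (2 * K * (en (Phi 0 - U) + en (Psi 0 - U))) _ _ cv; last by [].
move=> N; have hs i : scos p (Phi 0) i - scos p (Psi 0) i - scos p (Phi 0 - U) i = - scos p (Psi 0 - U) i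
    /\ ssin p (Phi 0) i - ssin p (Psi 0) i - ssin p (Phi 0 - U) i = - ssin p (Psi 0 - U) i.
  have [-> ->] := state_ampB vp k0 p i f1 fU; have [-> ->] := state_ampB vp k0 p i f2 fU.
  by split; ring.
apply: (@le_trans _ _ (2 * (energy_sum (scos p (Phi 0 - U)) (ssin p (Phi 0 - U)) N
   + energy_sum (scos p (Psi 0 - U)) (ssin p (Psi 0 - U)) N))).
  by apply: energy_sum_sub => i; have [h1 h2] := hs i; rewrite ?h1 ?h2 sqrrN.
rewrite -mulrA ler_wpM2l // mulrDr; apply: lerD; apply: hK; exact: finite_energyB.
Qed.

(** Initial data that converge in energy have boundary stresses that form a
    Cauchy sequence. *)
Lemma trace_exists Phi : sol Phi -> exists y, trace Phi y.
Proof.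
move=> solPhi; have [fPhi [Phin ap]] := solPhi; have [cl _] := ap.
have fP : finite_energy (Phi 0) by apply: energy_space_finite; exact: fPhi.
have [C C0 hC] := stress_upper_sub; have [C' _ hC'] := stress_upper.
have L p n : L2r 0 T (stress p (Phin n)) by have [] := hC' p _ (cl n).
have lim p : exists y, L2r 0 T y /\ forall e, 0 < e -> exists N, forall n, (N <= n)%N ->
    nrm 0 T (fun t => stress p (Phin n) t - y t) <= e.
  apply: (L2r_complete T_gt0 (L p)) => e e0.
  have e1 : 0 < e ^+ 2 / (2 * C) by rewrite divr_gt0 ?exprn_gt0 ?mulr_gt0.
  have [N hN] := approx_initial solPhi ap e1.
  exists N => n m Nn Nm.
  rewrite -(@ler_pXn2r _ 2) ?nnegrE ?nrm_ge0 ?(ltW e0) // sqr_nrm.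
  apply: le_trans (hC p _ _ (cl n) (cl m) _ fP) _.
  apply: le_trans (ler_wpM2l (ltW C0) (lerD (hN n Nn) (hN m Nm))) _.
  by rewrite le_eqVlt; apply/orP; left; apply/eqP; field; exact: lt0r_neq0.
have [yr [Lr hr]] := lim true; have [yi [Li hi]] := lim false.
pose y t : R[i] := yr t +i* yi t.
have yE p : fpart p y = if p then yr else yi by apply/funext => t; rewrite /fpart /y; case: p.
have Ly : L2 0 T y by apply/L2P => -[]; rewrite yE.
exists y; split=> //; exists Phin => //.
have /L2P Ly' := Ly.
have dE p n : fpart p (fun t => shear (Phin n t) 1 - y t) = fun t => stress p (Phin n) t - fpart p y t.
  by apply/funext => t; rewrite /fpart cpartB.
have Ld p n : L2r 0 T (fpart p (fun t => shear (Phin n t) 1 - y t)) by rewrite dE; exact: L2rB.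
under eq_cvg do rewrite l2sqE //.
apply: cvg_EFin; first by near=> n.
apply/cvgrPdist_le => e e0.
have e2 : 0 < Num.sqrt (e / 2) by rewrite sqrtr_gt0 divr_gt0.
have [N1 h1] := hr _ e2; have [N2 h2] := hi _ e2.
exists (maxn N1 N2) => // n /=; rewrite geq_max => /andP[n1 n2].
rewrite sub0r normrN ger0_norm ?cnorm_sq_ge0 // /cnorm_sq !dE !yE -!sqr_nrm.
have sq (z : R) : 0 <= z -> z <= Num.sqrt (e / 2) -> z ^+ 2 <= e / 2.
  move=> z0 hz; rewrite -[leRHS]sqr_sqrtr ?divr_ge0 ?(ltW e0) //.
  by rewrite lerXn2r ?nnegrE ?sqrtr_ge0.
have := sq _ (nrm_ge0 _ _ _) (h1 n n1); have := sq _ (nrm_ge0 _ _ _) (h2 n n2); lra.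
Unshelve. all: by end_near. Qed.

Lemma trace_approx Phi y : sol Phi -> trace Phi y -> exists2 Phin : nat -> R -> state R,
  (forall n, classical (Phin n)) & forall e, 0 < e -> exists n, en (Phin n 0 - Phi 0) <= e /\
    forall p, ip 0 T (fun t => stress p (Phin n) t - fpart p y t)
                     (fun t => stress p (Phin n) t - fpart p y t) <= e.
Proof.
move=> solPhi [/L2P Ly [Phin ap cv]]; have [cl _] := ap; exists Phin => // e e0.
have [C' _ hC'] := stress_upper.
have [N1 h1] := approx_initial solPhi ap e0.
have [N2 _ h2] := ereal_cvg0_near _ cv e0.
exists (maxn N1 N2); split=> [|p]; first by apply: h1; exact: leq_maxl.
have := h2 (maxn N1 N2) (leq_maxr _ _) => /=.
have dE q n : fpart q (fun t => shear (Phin n t) 1 - y t) = fun t => stress q (Phin n) t - fpart q y t.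
  by apply/funext => t; rewrite /fpart cpartB.
rewrite l2sqE; last by move=> q; rewrite dE; apply: L2rB => //; have [] := hC' q _ (cl (maxn N1 N2)).
rewrite lte_fin => /ltW; apply: le_trans; rewrite -dE; exact: ip_le_cnorm_sq.
Qed.

Lemma trace_upper : exists2 C : R, 0 < C & forall Phi y, sol Phi -> trace Phi y ->
  (l2sq 0 T y <= C%:E * energy_sq rho1 rho2 k1 k2 (Phi 0%R))%E.
Proof.
have [C C0 hC] := stress_upper.
have [K K0 hK] := energy_sum_le_energy rho10 rho20 k10 k20 vp0 k00.
exists (8 * C * K); first by rewrite !mulr_gt0.
move=> Phi y solPhi tr; have [fPhi _] := solPhi; have [/L2P Ly _] := tr.
have fP : finite_energy (Phi 0) by apply: energy_space_finite; exact: fPhi.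
rewrite l2sqE // energy_sqE // -EFinM lee_fin.
suff H p : ip 0 T (fpart p y) (fpart p y) <= 4 * C * K * en (Phi 0).
  by rewrite /cnorm_sq; have := H true; have := H false; lra.
apply: (@le_of_small _ _ _ (4 * C * K + 2)) => [|e e0]; first by rewrite addr_ge0 // ltW ?mulr_gt0.
have [Phin cl /(_ e e0)[n [hn hy]]] := trace_approx solPhi tr.
have [Ln un] := hC p _ (cl n); have fn := initial_finite (cl n).
apply: le_trans (ip_le_approx (Ly p) Ln) _.
have : ip 0 T (stress p (Phin n)) (stress p (Phin n)) <= C * (2 * (K * en (Phi 0) + K * e)).
  apply: un => N; apply: le_trans (energy_sum_sub (P1 := scos p (Phi 0)) (Q1 := ssin p (Phi 0))
      (P2 := scos p (Phin n 0 - Phi 0)) (Q2 := ssin p (Phin n 0 - Phi 0)) N _ _) _.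
  - by move=> i; have [-> _] := state_ampB vp k0 p i fn fP.
  - by move=> i; have [_ ->] := state_ampB vp k0 p i fn fP.
  rewrite ler_wpM2l // lerD ?hK //; apply: le_trans (hK p _ N (finite_energyB fn fP)) _.
  by rewrite ler_wpM2l // ltW.
have := hy p; lra.
Qed.

Hypothesis freq_injective : injective (freq vp k0).
Hypothesis long_time : 2 * (2 * pi / vp) < T.

(** A finite weighted sum of amplitudes is continuous for the energy norm, so
    the estimate passes from the approximating solutions to the limit. *)
Lemma trace_lower : exists2 C : R, 0 < C & forall Phi y, sol Phi -> trace Phi y ->
  forall p N, weak_sum (scos p (Phi 0)) (ssin p (Phi 0)) N <= C * cnorm_sq 0 T y.
Proof.
have [C C0 hC] := mode_series_lower vp0 k00 T_gt0 freq_injective long_time.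
have [C' _ hC'] := stress_upper.
have [K K0 hK] := energy_sum_le_energy rho10 rho20 k10 k20 vp0 k00.
exists (4 * C); first by rewrite mulr_gt0.
move=> Phi y solPhi tr p N; have [fPhi _] := solPhi; have [/L2P Ly _] := tr.
have fP : finite_energy (Phi 0) by apply: energy_space_finite; exact: fPhi.
apply: (@le_trans _ _ (4 * C * ip 0 T (fpart p y) (fpart p y))); last first.
  by rewrite ler_wpM2l ?ip_le_cnorm_sq // ltW // mulr_gt0.
apply: (@le_of_small _ _ _ (4 * C + 2 * K)) => [|e e0].
  by rewrite ltW // addr_gt0 ?mulr_gt0.
have [Phin cl /(_ e e0)[n [hn hy]]] := trace_approx solPhi tr.
have [Ln _] := hC' p _ (cl n); have fn := initial_finite (cl n).
have cv t : 0 < t < T -> mode_sum vp k0 (scos p (Phin n 0)) (ssin p (Phin n 0)) M t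
    @[M --> \oo] --> stress p (Phin n) t.
  by move=> /andP[t0 _]; apply: classical_trace_series (cl n) _ => //; exact: ltW.
have low := hC _ _ _ _ (fun M => hK p _ M fn) cv N.
apply: le_trans (weak_sum_sub (P1 := scos p (Phin n 0)) (Q1 := ssin p (Phin n 0))
      (P2 := scos p (Phin n 0 - Phi 0)) (Q2 := ssin p (Phin n 0 - Phi 0)) N _ _) _.
- by move=> i; have [-> _] := state_ampB vp k0 p i fn fP; rewrite -sqrrN opprB.
- by move=> i; have [_ ->] := state_ampB vp k0 p i fn fP; rewrite -sqrrN opprB.
have hE : energy_sum (scos p (Phin n 0 - Phi 0)) (ssin p (Phin n 0 - Phi 0)) N <= K * e.
  apply: le_trans (hK p _ N (finite_energyB fn fP)) _.
  by rewrite ler_wpM2l // ltW.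
have hS : ip 0 T (stress p (Phin n)) (stress p (Phin n)) <= 2 * (ip 0 T (fpart p y) (fpart p y) + e).
  apply: le_trans (ip_le_approx Ln (Ly p)) _; rewrite ler_wpM2l // lerD2l.
  apply: le_trans (hy p); rewrite le_eqVlt; apply/orP; left; apply/eqP.
  by rewrite (ip_sqrB (Ly p) Ln) (ip_sqrB Ln (Ly p)) (ipC _ _ (fpart p y)); ring.
have := ler_wpM2l (ltW C0) hS; lra.
Qed.

Lemma weak_sq_upper : exists2 C : R, 0 < C & forall U D, finite_energy U ->
  (forall p N, weak_sum (scos p U) (ssin p U) N <= D) -> (weak_sq U <= (C * D)%:E)%E.
Proof.
have [K K0 hK] := coef_sq_upper vp0 k00.
exists (32 * K); first by rewrite mulr_gt0.
move=> U D [[h1 _ _] h2 h3 h4] hD.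
have bnd p N : \sum_(n < N) ((n.+1%:R ^+ 2)^-1 * (sin_coef p (st_phi U) n ^+ 2 + cos_coef p (st_psi U) n ^+ 2)
   + (n.+1%:R ^+ 4)^-1 * (sin_coef p (st_phi1 U) n ^+ 2 + cos_coef p (st_psi1 U) n ^+ 2)) <= K * D.
  apply: le_trans (ler_wpM2l (ltW K0) (hD p N)); rewrite /weak_sum mulr_sumr.
  by apply: ler_sum => n _; exact: hK.
have D4 : (32 * K * D)%:E = ((8 * (K * D))%:E + (8 * (K * D))%:E + (8 * (K * D))%:E + (8 * (K * D))%:E)%E.
  by rewrite -!EFinD; congr _%:E; ring.
have w2 n : 0 <= (n.+1%:R ^+ 2)^-1 :> R by rewrite invr_ge0 sqr_ge0.
have w4 n : 0 <= (n.+1%:R ^+ 4)^-1 :> R by rewrite invr_ge0 exprn_ge0.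
have e1 n (z : R) : ((n.+1%:R ^+ 1)^-1 * z) ^+ 2 = (n.+1%:R ^+ 2)^-1 * z ^+ 2.
  by rewrite expr1 exprMn exprVn.
have e2 n (z : R) : ((n.+1%:R ^+ 2)^-1 * z) ^+ 2 = (n.+1%:R ^+ 4)^-1 * z ^+ 2.
  by rewrite exprMn exprVn -exprM.
have four (u v x y z w : R) : 0 <= u -> 0 <= v ->
    let S := u * (x ^+ 2 + y ^+ 2) + v * (z ^+ 2 + w ^+ 2) in
    [/\ u * x ^+ 2 <= S, v * z ^+ 2 <= S, u * y ^+ 2 <= S & v * w ^+ 2 <= S].
  move=> u0 v0; have := mulr_ge0 u0 (sqr_ge0 x); have := mulr_ge0 u0 (sqr_ge0 y).
  have := mulr_ge0 v0 (sqr_ge0 z); have := mulr_ge0 v0 (sqr_ge0 w) => a1 a2 a3 a4 /=.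
  by rewrite !mulrDr; split; lra.
have cmp p n := four _ _ (sin_coef p (st_phi U) n) (cos_coef p (st_psi U) n)
  (sin_coef p (st_phi1 U) n) (cos_coef p (st_psi1 U) n) (w2 n) (w4 n).
rewrite D4 /weak_sq; apply: leeD; [apply: leeD; [apply: leeD|]|].
- apply: (@V_dual_le _ _ 1) => [n||p N]; [exact: L2r_basis_sin | exact: H1_L2 |].
  by apply: le_trans (bnd p N); apply: ler_sum => n _; rewrite e1; have [] := cmp p n.
- apply: (@V_dual_le _ _ 2) => [n||p N]; [exact: L2r_basis_sin | by [] |].
  by apply: le_trans (bnd p N); apply: ler_sum => n _; rewrite e2; have [] := cmp p n.
- apply: (@V_dual_le _ _ 1) => [n||p N]; [exact: L2r_basis_cos | exact: H1_L2 |].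
  by apply: le_trans (bnd p N); apply: ler_sum => n _; rewrite e1; have [] := cmp p n.
- apply: (@V_dual_le _ _ 2) => [n||p N]; [exact: L2r_basis_cos | by [] |].
  by apply: le_trans (bnd p N); apply: ler_sum => n _; rewrite e2; have [] := cmp p n.
Qed.

End Observability.

(** With equal speeds the two factors of the resonance condition coincide, and
    only the ratio of the stiffnesses survives. *)
Lemma nonresonance (R : realType) (k0 : nat) (r c : R) : 0 < r ->
  c = (k0%:R * pi) ^+ 2 * r ->
  (forall m1 m2 : int, (m1, m2) != (0, 0) ->
     c != (r * m1%:~R ^+ 2 - r * m2%:~R ^+ 2) * (r * m1%:~R ^+ 2 - r * m2%:~R ^+ 2) * pi ^+ 2
       / ((r + r) * (m1%:~R ^+ 2 + m2%:~R ^+ 2))) ->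
  forall n m, ((n.+1%:R : R) ^+ 2 - m.+1%:R ^+ 2) ^+ 2 !=
     2 * k0%:R ^+ 2 * (n.+1%:R ^+ 2 + m.+1%:R ^+ 2).
Proof.
move=> r0 cE res n m; apply/eqP => E.
have /eqP := res n.+1 m.+1 isT; apply; rewrite cE -!pmulrn.
have n0 : 0 < n.+1%:R :> R by rewrite ltr0n.
have m0 : 0 < m.+1%:R :> R by rewrite ltr0n.
move: E; move: (n.+1%:R : R) (m.+1%:R : R) n0 m0 => x y x0 y0 E.
have s0 : x ^+ 2 + y ^+ 2 != 0 by rewrite lt0r_neq0 // addr_gt0 ?exprn_gt0.
have r0' := lt0r_neq0 r0.
rewrite (_ : (_ - _) * (_ - _) = r ^+ 2 * (x ^+ 2 - y ^+ 2) ^+ 2); last by ring.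
rewrite E; move: (pi : R) => p.
have r2 : r + r != 0 by rewrite lt0r_neq0 // addr_gt0.
by field; rewrite s0 r2.
Qed.

Theorem theorem3p11 (R : realType) (rho1 rho2 k1 k2 T : R) (k0 : nat)
  (hrho1 : 0 < rho1) (hrho2 : 0 < rho2) (hk1 : 0 < k1) (hk2 : 0 < k2)
  (hspeed : rho1 / k1 = rho2 / k2)
  (hk0 : (0 < k0)%N) (hcoef : Num.sqrt (k1 / k2) = k0%:R * pi)
  (hres : forall m1 m2 : int, (m1, m2) != (0, 0) ->
     k1 / rho2 !=
       (k2 * m1%:~R ^+ 2 / rho2 - k1 * m2%:~R ^+ 2 / rho1)
       * (k1 * m1%:~R ^+ 2 / rho1 - k2 * m2%:~R ^+ 2 / rho2) * pi ^+ 2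
       / ((k1 / rho1 + k2 / rho2) * (m1%:~R ^+ 2 + m2%:~R ^+ 2)))
  (hT : 4 * Num.sqrt (rho1 / k1) < T) :
  exists c3 : R,
    [/\ 0 < c3,
        forall Phi : R -> state R, solution rho1 rho2 k1 k2 Phi ->
          (exists y, boundary_trace rho1 rho2 k1 k2 T Phi y) /\
          (forall y, boundary_trace rho1 rho2 k1 k2 T Phi y ->
             (l2sq 0 T y <= c3%:E * energy_sq rho1 rho2 k1 k2 (Phi 0%R))%E) &
        exists c4 : R,
          0 < c4 < c3 /\
          forall (Phi : R -> state R) y, solution rho1 rho2 k1 k2 Phi ->
            boundary_trace rho1 rho2 k1 k2 T Phi y ->
            (c4%:E * weak_sq (Phi 0%R) <= l2sq 0 T y)%E].
Proof.
have r0 : 0 < k1 / rho1 by rewrite divr_gt0.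
have speeds : k2 / rho2 = k1 / rho1.
  by rewrite -[k2 / rho2]invf_div -hspeed invf_div.
set a := Num.sqrt (rho1 / k1) in hT.
have a0 : 0 < a by rewrite sqrtr_gt0 divr_gt0.
have a2 : a ^+ 2 = rho1 / k1 by rewrite sqr_sqrtr // divr_ge0 // ltW.
have pi0 := pi_gt0 R.
have T0 : 0 < T by apply: le_lt_trans hT; rewrite mulr_ge0 // ltW.
pose vp : R := pi / a.
have vp0 : 0 < vp by rewrite divr_gt0.
have vp_speed : vp ^+ 2 = k1 / rho1 * pi ^+ 2.
  by rewrite /vp exprMn exprVn a2 invf_div mulrC.
have ratio : (k0%:R * pi) ^+ 2 = k1 / k2 by rewrite -hcoef sqr_sqrtr // divr_ge0 // ltW.
have gap : (k0%:R * vp) ^+ 2 = k1 / rho2.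
  rewrite exprMn vp_speed mulrCA -exprMn ratio -speeds.
  by field; rewrite !lt0r_neq0.
(* The limit frequencies have period [2 * a], and two periods are needed. *)
have long : 2 * (2 * pi / vp) < T.
  have -> // : 2 * (2 * pi / vp) = 4 * a by rewrite /vp; move: (pi : R) pi0 => p p0; field; rewrite !lt0r_neq0.
have inj : injective (freq vp k0).
  apply: freq_inj => //; apply: (nonresonance r0 (c := k1 / rho2)).
    by rewrite ratio -speeds; field; rewrite !lt0r_neq0.
  move=> m1 m2 m0; have := hres m1 m2 m0.
  by rewrite !(mulrAC _ _ rho2^-1) !(mulrAC _ _ rho1^-1) speeds.
have [Cu Cu0 upper] := trace_upper hrho1 hrho2 hk1 hk2 vp0 hk0 speeds vp_speed gap T0.
have [Cl Cl0 lower] := trace_lower hrho1 hrho2 hk1 hk2 vp0 hk0 speeds vp_speed gap T0 inj long.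
have [Cw Cw0 weak] := weak_sq_upper vp0 hk0.
exists Cu; split=> //.
  move=> Phi sPhi; split; last by move=> y; exact: upper.
  exact: (trace_exists hrho1 hrho2 hk1 hk2 vp0 hk0 speeds vp_speed gap T0 sPhi).
pose c4 : R := Num.min (Cu / 2) (Cw * Cl)^-1.
have w0 : 0 < (Cw * Cl)^-1 by rewrite invr_gt0 mulr_gt0.
have c40 : 0 < c4 by rewrite lt_min w0 divr_gt0.
exists c4; split; first by rewrite c40 /= gt_min; apply/orP; left; lra.
move=> Phi y sPhi tr; have [/L2P Ly _] := tr; have [fPhi _] := sPhi.
have fP := energy_space_finite (fPhi 0 (lexx 0)).
have hw := weak _ _ fP (lower Phi y sPhi tr).
apply: le_trans (lee_wpmul2l _ hw) _; first by rewrite lee_fin ltW.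
rewrite l2sqE // -EFinM lee_fin (mulrA Cw) mulrA ler_piMl ?cnorm_sq_ge0 //.
apply: (@le_trans _ _ ((Cw * Cl)^-1 * (Cw * Cl))); last by rewrite mulVf // lt0r_neq0 // mulr_gt0.
by rewrite ler_wpM2r ?ge_min ?lexx ?orbT // ltW // mulr_gt0.
Qed.
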